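(* Given positive real numbers $a_1,\dots,a_n$ and $\alpha\in(0,1]$, there exists a compact star-shaped domain $W\subset\mathbb{R}^{2n}$ whose boundary has Hausdorff dimension $2n-1+\alpha$ and whose interior is symplectomorphic to the interior of the symplectic ellipsoid $E(a_1,\dots,a_n)$.
   Context: $\mathbb{R}^{2n}\cong\mathbb{C}^n$ carries the standard symplectic form $\omega_0=\sum_i dx_i\wedge dy_i$, and open subsets carry its restriction. A star-shaped domain in $\mathbb{R}^{2n}$ is a set that is the closure of an open, bounded set that is star-shaped with respect to the origin. For $a_1,\dots,a_n>0$, $E(a_1,\dots,a_n):=\{(z_1,\dots,z_n)\in\mathbb{C}^n\mid \sum_i \pi|z_i|^2/a_i\le 1\}$. *)

(* Defs.v *)
From HB Require Import structures.
From mathcomp Require Import all_boot all_order all_algebra.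
From mathcomp Require Import all_classical all_reals all_analysis.

Set Implicit Arguments.
Unset Strict Implicit.
Unset Printing Implicit Defensive.

Import Order.TTheory GRing.Theory Num.Theory.
Import numFieldNormedType.Exports.

Local Open Scope classical_set_scope.
Local Open Scope ring_scope.

Section HausdorffDimension.
Context {R : realType} {m : nat}.
Implicit Types (x y : 'rV[R]_m) (A : set 'rV[R]_m) (s d : R).

(* The library's norm on 'rV[R]_m is the sup norm, so the Euclidean distance
   is spelled out. *)
Definition edist x y : R := Num.sqrt (\sum_i (x 0 i - y 0 i) ^+ 2).

(* [diam set0 = -oo]. *)
Definition diam A : \bar R :=
  ereal_sup [set (edist p.1 p.2)%:E | p in A `*` A].

(* [diam A] to the power [s], with the conventions [0 `^ 0 = 1] for nonempty
   sets and [0] for the empty set, so that the measure of index [0] is the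
   counting measure. *)
Definition hausdorff_gauge s A : \bar R :=
  if A == set0 then 0%E else poweR (diam A) s.

Definition hausdorff_premeasure s d A : \bar R :=
  ereal_inf [set (\sum_(0 <= k <oo) hausdorff_gauge s (F k))%E |
    F in [set F : nat -> set 'rV[R]_m |
      A `<=` \bigcup_k F k /\ forall k, (diam (F k) <= d%:E)%E]].

Definition hausdorff_measure s A : \bar R :=
  ereal_sup [set hausdorff_premeasure s d A | d in [set d : R | 0 < d]].

Definition hausdorff_dim A : \bar R :=
  ereal_inf [set s%:E | s in [set s : R | 0 <= s /\ hausdorff_measure s A = 0%E]].

End HausdorffDimension.

Definition boundary {T : topologicalType} (A : set T) : set T :=
  closure A `\` interior A.

Section StarShaped.
Context {R : realType} {m : nat}.
Implicit Types U W : set 'rV[R]_m.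

Definition star_shaped0 U : Prop :=
  U 0 /\ forall x t, U x -> 0 <= t <= 1 -> U (t *: x).

Definition star_shaped_domain W : Prop :=
  exists U, [/\ open U, bounded_set U, star_shaped0 U & W = closure U].

End StarShaped.

(* Maps are total, but only their germs at points of the open set [U] matter.
   For [V] finite-dimensional, this is the usual notion of a C^k map on [U]. *)
Fixpoint Ck_on {R : realType} {V W : normedModType R} (k : nat)
    (U : set V) (f : V -> W) : Prop :=
  if k is k'.+1 then
    (forall x, U x -> differentiable f x) /\ forall v, Ck_on k' U ('D_v f)
  else forall x, U x -> {for x, continuous f}.

Definition smooth_on {R : realType} {V W : normedModType R}
    (U : set V) (f : V -> W) : Prop := forall k, Ck_on k U f.

Section Symplectic.
Context {R : realType} {n : nat}.
Implicit Types (z u v : 'rV[R]_(n + n)) (U V : set 'rV[R]_(n + n)).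

(* Coordinates on R^(2n) = C^n are ordered (x_1, ..., x_n, y_1, ..., y_n), with
   z_j = x_j + i y_j. *)
Definition xcoord z (i : 'I_n) : R := z 0 (lshift n i).
Definition ycoord z (i : 'I_n) : R := z 0 (rshift n i).

(* \sum_i dx_i /\ dy_i evaluated on a pair of tangent vectors. *)
Definition omega0 u v : R :=
  \sum_i (xcoord u i * ycoord v i - xcoord v i * ycoord u i).

Definition symplectomorphic U V : Prop :=
  exists f g : 'rV[R]_(n + n) -> 'rV[R]_(n + n),
    [/\ (forall z, U z -> V (f z) /\ g (f z) = z),
        (forall w, V w -> U (g w) /\ f (g w) = w),
        smooth_on U f,
        smooth_on V g &
        forall z, U z ->
          forall u v, omega0 ('d f z u) ('d f z v) = omega0 u v].

Definition ellipsoid (a : 'I_n -> R) : set 'rV[R]_(n + n) :=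
  [set z | \sum_i pi * (xcoord z i ^+ 2 + ycoord z i ^+ 2) / a i <= 1].

End Symplectic.

(* Main.v *)
(* Put [h i = pi / a i] and [HH z = \sum_i h i * |z_i|^2], so that the interior of
   the ellipsoid is [HH < 1]. Single out one coordinate, with squared modulus [sg]
   and argument [th], and let [uu] be the contribution of the others to [HH].

   Choose disjoint pulses [B k] in the variable [th] whose centers accumulate on a
   Cantor set of dimension [alpha], and whose derivatives [dB k] reach the same
   height at every center but are nowhere very negative. Let [g] be the sum over
   [k] of [B k th] times a function of [sg] and [uu] that vanishes for
   [HH <= 1 - w k], so that the sum is locally finite in the ellipsoid. The map
   that rotates the coordinate planes by the derivatives of [g] in the squared
   moduli, and the map that stretches [sg] to [sg + g_th], pull the standard
   symplectic form back to the same form. Composing the second with the inverse of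
   the first gives a symplectomorphism from the open ellipsoid onto
   [U = {HH < 1 + Lam uu * \sum_k dB k th}].

   [U] is star-shaped because the [dB k] are barely negative, and it is the interior
   of its closure. Away from the accumulation angles the frontier of [U] is a
   Lipschitz image of the sphere [HH = 1]; over the accumulation angles it contains
   all points with [HH] between [1] and [1 + Lam uu * max (dB k)], which up to
   Lipschitz changes of coordinates is the product of a set of dimension [alpha]
   and a set with interior in dimension [2n - 1]. *)

(* The composite is the canonical transformation with the mixed generating function [sg * th + g].
   Its two factors are invertible for one common reason: the radius after stretching, as a function
   of [sg], and the angle after turning, as a function of [th], both have derivative
   [1 + g_{sg,th}]. So a lower bound on the mixed derivative suffices, and the pulses may rise as
   steeply as they like. Cutting the [k]-th term off at depth [w k] costs a factor [1 / w k] in that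
   derivative; this is harmless where [dB k > 0] and is compensated by the smallness of [dB k] where
   it is negative. A peak of fixed height and a negligible negative part are compatible, although
   [dB k] has mean zero, because the peak can be made arbitrarily thin.

   The other obstacle is the origin of the distinguished plane, where the angle is singular. The
   pulses occupy angles between [0] and [1 / 2], and a further cutoff removes them where
   [h i0 * sg <= 1 / 2], so that every finite sum of terms is smooth on the whole space. *)
Require Import Defs.
From mathcomp Require Import all_boot all_order all_algebra.
From mathcomp Require Import all_classical all_reals all_analysis.
From mathcomp Require Import ring lra zify perm measurable_realfun.
Import Order.TTheory GRing.Theory Num.Theory.
Import numFieldNormedType.Exports.
Local Open Scope classical_set_scope.
Local Open Scope ring_scope.

Set Implicit Arguments.
Unset Strict Implicit.
Unset Printing Implicit Defensive.

(** * C^k functions *)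

Section CkGeneral.
Context {R : realType} {V W : normedModType R}.
Implicit Types (U : set V) (f g : V -> W) (k : nat).

Lemma eq_derive_on U f g v x : open U -> (forall y, U y -> f y = g y) ->
  U x -> 'D_v f x = 'D_v g x.
Proof.
move=> oU fg Ux; have [->|v0] := eqVneq v 0; first by rewrite !derive0.
apply: near_eq_derive => //.
by near=> y; apply: fg; near: y; exact: open_nbhs_nbhs.
Unshelve. all: by end_near. Qed.

Lemma differentiable_near f g x : (\forall y \near x, f y = g y) ->
  differentiable f x -> differentiable g x.
Proof.
move=> fg /diff_locallyP[dc df].
have fgx : f x = g x := nbhs_singleton fg.
apply/diff_locallyP.
have E : g \o shift x = cst (g x) + 'd f x +o_ 0 id.
  apply/eqaddoP => _/posnumP[e].
  move/eqaddoP : df => /(_ e%:num ltac:(by [])) df.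
  have fg0 : \forall h \near 0, f (h + x) = g (h + x).
    have c : (h + x) @[h --> (0:V)] --> x.
      by rewrite -[X in _ --> X]add0r; apply: cvgD; [exact: cvg_id|exact: cvg_cst].
    exact: c _ fg.
  near=> h => /=.
  have -> : (g \o shift x - (cst (g x) + 'd f x)) h =
     (f \o shift x - (cst (f x) + 'd f x)) h.
    rewrite /= !fctE /= /shift /= -fgx.
    suff -> : f (h + x) = g (h + x) by [].
    by near: h.
  by near: h; exact: df.
by rewrite (diff_unique dc E).
Unshelve. all: by end_near. Qed.

Lemma eq_Ck_on k U f g : open U -> (forall y, U y -> f y = g y) ->
  Ck_on k U f -> Ck_on k U g.
Proof.
move=> oU; elim: k f g => [|k IH] f g fg /=.
  move=> fc x Ux; have fx := fc x Ux; rewrite /prop_for /continuous_at -(fg x Ux).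
  apply: cvg_trans fx; apply: near_eq_cvg.
  by near=> y; apply: fg; near: y; exact: open_nbhs_nbhs.
move=> [fd fk]; split => [x Ux|v].
  apply: differentiable_near (fd x Ux).
  by near=> y; apply: fg; near: y; exact: open_nbhs_nbhs.
apply: IH (fk v) => y Uy; exact: eq_derive_on fg Uy.
Unshelve. all: by end_near. Qed.

(** Every clause of [Ck_on] concerns the germ of the total map at a single point, so regularity may
    be checked point by point. Locally finite sums are treated this way. *)
Lemma Ck_on_local k U f : (forall x, U x -> exists2 U', U' x & Ck_on k U' f) ->
  Ck_on k U f.
Proof.
elim: k f => [|k IH] f fl /=.
  by move=> x /fl[U' U'x]; apply.
split=> [x /fl[U' U'x [+ _]]|v]; first exact.
by apply: IH => x /fl[U' U'x [_ +]] => /(_ v); exists U'.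
Qed.

Lemma subset_Ck_on k U U' f : U' `<=` U -> Ck_on k U f -> Ck_on k U' f.
Proof. by move=> U'U fk; apply: Ck_on_local => x /U'U Ux; exists U. Qed.

Lemma Ck_on_continuous k U f x : Ck_on k U f -> U x -> {for x, continuous f}.
Proof.
case: k => [|k] /=; first exact.
by move=> [fd _] Ux; apply: differentiable_continuous; exact: fd.
Qed.

Lemma Ck_onW k U f : Ck_on k.+1 U f -> Ck_on k U f.
Proof.
elim: k f => [|k IH] f; first by move=> fk x; exact: Ck_on_continuous fk.
by move=> [fd fk]; split => // v; exact: IH.
Qed.

Lemma Ck_on_cst k U (c : W) : Ck_on k U (fun=> c).
Proof.
elim: k c => [|k IH] c /=; first by move=> x _; exact: cvg_cst.
split=> [x _|v]; first exact: differentiable_cst.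
rewrite (_ : 'D_v _ = fun=> 0); first exact: IH.
by apply/funext => x; rewrite (derive_cst c).
Qed.

Lemma Ck_onD k U f g : open U -> Ck_on k U f -> Ck_on k U g ->
  Ck_on k U (fun x => f x + g x).
Proof.
move=> oU; elim: k f g => [|k IH] f g /=.
  by move=> fc gc x Ux; apply: cvgD; [exact: fc|exact: gc].
move=> [fd fk] [gd gk]; split=> [x Ux|v].
  by apply: differentiableD; [exact: fd|exact: gd].
apply: eq_Ck_on (IH _ _ (fk v) (gk v)) => // x Ux.
by rewrite -deriveD//; apply: diff_derivable; [exact: fd|exact: gd].
Qed.

End CkGeneral.

Section CkReal.
Context {R : realType} {V : normedModType R}.
Implicit Types (U : set V) (f g : V -> R) (k : nat).

Lemma Ck_onM k U f g : open U -> Ck_on k U f -> Ck_on k U g ->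
  Ck_on k U (fun x => f x * g x).
Proof.
move=> oU; elim: k f g => [|k IH] f g.
  by move=> fc gc x Ux; apply: cvgM; [exact: fc|exact: gc].
move=> fk1 gk1; have fk0 := Ck_onW fk1; have gk0 := Ck_onW gk1.
move: fk1 gk1 => [fd fk] [gd gk]; split=> [x Ux|v].
  by apply: differentiableM; [exact: fd|exact: gd].
have := Ck_onD oU (IH _ _ fk0 (gk v)) (IH _ _ gk0 (fk v)).
apply: eq_Ck_on => // x Ux.
by rewrite [in RHS]deriveM//; apply: diff_derivable; [exact: fd|exact: gd].
Qed.

Lemma Ck_onN k U f : open U -> Ck_on k U f -> Ck_on k U (fun x => - f x).
Proof.
move=> oU fk; have := Ck_onM oU (Ck_on_cst k U (-1 : R)) fk.
by apply: eq_Ck_on => // x _; rewrite mulN1r.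
Qed.

Lemma Ck_onB k U f g : open U -> Ck_on k U f -> Ck_on k U g ->
  Ck_on k U (fun x => f x - g x).
Proof. by move=> oU fk gk; apply: Ck_onD => //; exact: Ck_onN. Qed.

Lemma Ck_on_sum (I : Type) (r : seq I) (P : pred I) k U (F : I -> V -> R) :
  open U -> (forall i, P i -> Ck_on k U (F i)) ->
  Ck_on k U (fun x => \sum_(i <- r | P i) F i x).
Proof.
move=> oU Fk; elim: r => [|i r IH].
  by apply: eq_Ck_on (Ck_on_cst k U (0 : R)) => // x _; rewrite big_nil.
have [Pi|Pi] := boolP (P i); last first.
  by apply: eq_Ck_on IH => // x _; rewrite big_cons (negbTE Pi).
by apply: eq_Ck_on (Ck_onD oU (Fk i Pi) IH) => // x _; rewrite big_cons Pi.
Qed.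

Lemma Ck_on_prod (I : Type) (r : seq I) (P : pred I) k U (F : I -> V -> R) :
  open U -> (forall i, P i -> Ck_on k U (F i)) ->
  Ck_on k U (fun x => \prod_(i <- r | P i) F i x).
Proof.
move=> oU Fk; elim: r => [|i r IH].
  by apply: eq_Ck_on (Ck_on_cst k U (1 : R)) => // x _; rewrite big_nil.
have [Pi|Pi] := boolP (P i); last first.
  by apply: eq_Ck_on IH => // x _; rewrite big_cons (negbTE Pi).
by apply: eq_Ck_on (Ck_onM oU (Fk i Pi) IH) => // x _; rewrite big_cons Pi.
Qed.

Lemma is_derive_comp_real (p : R -> R) dp f x v : is_derive (f x) 1 p dp ->
  differentiable f x ->
  differentiable (p \o f) x /\ 'D_v (p \o f) x = dp * 'D_v f x.
Proof.
move=> pd fd; have /derivable1_diffP pdiff : derivable p (f x) 1 by [].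
split; first exact: differentiable_comp.
rewrite deriveE; last exact: differentiable_comp.
rewrite diff_comp //= deriveE// deriv1E// derive1E.
by rewrite (@derive_val _ _ _ _ _ _ _ pd) mulrC.
Qed.

(** The inductive step for functions of one variable: the chain rule trades one order of [p] for the
    regularity of [dp]. *)
Lemma Ck_on_comp_derive k U (p dp : R -> R) f : open U ->
  (forall x, U x -> is_derive (f x) 1 p (dp (f x))) ->
  Ck_on k U (dp \o f) -> Ck_on k.+1 U f -> Ck_on k.+1 U (p \o f).
Proof.
move=> oU pd dpk [fd fk]; split=> [x Ux|v].
  by have [] := is_derive_comp_real 0 (pd x Ux) (fd x Ux).
have := Ck_onM oU dpk (fk v); apply: eq_Ck_on => // x Ux.
by have [_ ->] := is_derive_comp_real v (pd x Ux) (fd x Ux).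
Qed.

Lemma continuous_comp_derive U (p : R -> R) (dp : R) f x : 
  is_derive (f x) 1 p dp -> {for x, continuous f} -> {for x, continuous (p \o f)}.
Proof.
move=> pd fc; apply: continuous_comp => //.
by apply: differentiable_continuous; apply/derivable1_diffP.
Qed.

(** When a family of functions is closed under differentiation, the induction on the order runs over
    all its members at once. *)
Lemma Ck_on_comp_family (P : set (R -> R)) (D : set R) k U (p : R -> R) f :
  open U -> (forall q, P q -> exists2 dq, P dq & forall y, D y -> is_derive y 1 q (dq y)) ->
  P p -> (forall x, U x -> D (f x)) -> Ck_on k U f -> Ck_on k U (p \o f).
Proof.
move=> oU Pd + fD; elim: k p => [|k IH] p Pp fk.
  move=> x Ux; have [dp _ pd] := Pd p Pp.
  by apply: (continuous_comp_derive U (pd _ (fD x Ux))); exact: fk.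
have [dp Pdp pd] := Pd p Pp.
apply: (@Ck_on_comp_derive k U p dp) => //.
  by move=> x Ux; exact/pd/fD.
by apply: IH => //; exact: Ck_onW.
Qed.

End CkReal.

Section CkElementary.
Context {R : realType} {V : normedModType R}.
Implicit Types (U : set V) (f g : V -> R) (k : nat).

Lemma is_derive_inv (x : R) : x != 0 -> is_derive x 1 (@GRing.inv R) (- (x^-1 * x^-1)).
Proof.
move=> x0; have h := @is_deriveV R id x 1 1 x0 (is_derive_id x 1).
by apply: is_derive_eq; rewrite /= [LHS]mulr1 expr2 invfM.
Qed.

Lemma Ck_onV k U f : open U -> (forall x, U x -> f x != 0) ->
  Ck_on k U f -> Ck_on k U (fun x => (f x)^-1).
Proof.
move=> oU f0; elim: k => [|k IH] fk.
  move=> x Ux; apply: (continuous_comp_derive U (is_derive_inv (f0 x Ux))).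
  exact: fk.
apply: (@Ck_on_comp_derive _ _ k U GRing.inv (fun y => - (y^-1 * y^-1))) => //.
  by move=> x Ux; exact/is_derive_inv/f0.
have fk' := IH (Ck_onW fk).
by apply: Ck_onN => //; exact: Ck_onM.
Qed.

Lemma Ck_on_sqrt k U f : open U -> (forall x, U x -> 0 < f x) ->
  Ck_on k U f -> Ck_on k U (fun x => Num.sqrt (f x)).
Proof.
move=> oU f0; elim: k => [|k IH] fk.
  move=> x Ux; apply: (continuous_comp_derive U (is_derive1_sqrt (f0 x Ux))).
  exact: fk.
apply: (@Ck_on_comp_derive _ _ k U Num.sqrt (fun y => (2 * Num.sqrt y)^-1)) => //.
  by move=> x Ux; exact/is_derive1_sqrt/f0.
apply: Ck_onV => // [x Ux|].
  by rewrite mulf_neq0// gt_eqF// sqrtr_gt0 f0.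
by apply: Ck_onM => //; [exact: Ck_on_cst|exact/IH/Ck_onW].
Qed.

Let trig : set (R -> R) :=
  [set q | [\/ q = cos, q = sin, q = (fun x => - cos x) | q = (fun x => - sin x)]].

Let trig_derive q : trig q ->
  exists2 dq : R -> R, trig dq & forall y : R, [set: R] y -> is_derive y 1 q (dq y).
Proof.
case=> ->.
- exists (fun x => - sin x); first exact: Or44.
  by move=> y _; exact: is_derive_cos.
- exists cos; first exact: Or41.
  by move=> y _; exact: is_derive_sin.
- exists sin; first exact: Or42.
  by move=> y _; rewrite -[X in is_derive _ _ _ X]opprK; apply: is_deriveN.
- exists (fun x => - cos x); first exact: Or43.
  by move=> y _; apply: is_deriveN.
Qed.

Lemma Ck_on_cos k U f : open U -> Ck_on k U f -> Ck_on k U (fun x => cos (f x)).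
Proof.
move=> oU; apply: (@Ck_on_comp_family _ _ trig setT k U cos f) => //.
exact: Or41.
Qed.

Lemma Ck_on_sin k U f : open U -> Ck_on k U f -> Ck_on k U (fun x => sin (f x)).
Proof.
move=> oU; apply: (@Ck_on_comp_family _ _ trig setT k U sin f) => //.
exact: Or42.
Qed.

Lemma Ck_on_atan k U f : open U -> Ck_on k U f -> Ck_on k U (fun x => atan (f x)).
Proof.
move=> oU; case: k => [|k] fk.
  move=> x Ux; apply: (continuous_comp_derive U (is_derive1_atan (f x))).
  exact: fk.
apply: (@Ck_on_comp_derive _ _ k U atan (fun y => (1 + y ^+ 2)^-1)) => //.
apply: (@Ck_onV k U (fun x => 1 + f x ^+ 2)) => // [x Ux|].
  by rewrite gt_eqF// ltr_pwDl// sqr_ge0.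
have := Ck_onW fk => {}fk.
apply: Ck_onD => //; first exact: Ck_on_cst.
by apply: eq_Ck_on (Ck_onM oU fk fk).
Qed.

End CkElementary.

Section CkRow.
Context {R : realType} {m : nat}.
Implicit Types (k : nat).

Lemma Ck_on_coord k (U : set 'rV[R]_m) i : open U -> Ck_on k U (fun x : 'rV[R]_m => x 0 i).
Proof.
move=> oU; case: k => [|k].
  by move=> x _; exact: coord_continuous.
split=> [x _|v]; first exact: differentiable_coord.
apply: eq_Ck_on (Ck_on_cst k U (v 0 i)) => // x _.
have cd := differentiable_coord x 0 i.
have did : derivable (id : 'rV[R]_m -> 'rV[R]_m) x v by exact: derivable_id.
have := @derive_mx R _ 1 m id x v did.
by move=> /matrixP /(_ 0 i); rewrite !mxE derive_id.
Qed.

Context {V : normedModType R}.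
Implicit Types (U : set V) (f : V -> 'rV[R]_m).

Lemma row_sum_fun f :
  f = \sum_(i < m) (fun x => f x 0 i *: delta_mx 0 i : 'rV[R]_m).
Proof. by apply/funext => x; rewrite [LHS](row_sum_delta (f x)) fct_sumE. Qed.

Lemma differentiable_rV f x :
  (forall i, differentiable (fun y => f y 0 i) x) -> differentiable f x.
Proof.
move=> fd; rewrite (row_sum_fun f); apply: differentiable_sum => i.
exact: differentiableZl.
Qed.

Lemma continuous_rV f x :
  (forall i, {for x, continuous (fun y => f y 0 i)}) -> {for x, continuous f}.
Proof.
move=> fc; rewrite (row_sum_fun f); apply: (@big_ind _ (fun h : V -> 'rV[R]_m => {for x, continuous h})).
- exact: cvg_cst.
- by move=> g h gc hc; exact: cvgD.
- by move=> i _; apply: cvgZl; exact: fc.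
Qed.

Lemma derive_rV f x v i : differentiable f x ->
  ('D_v f x) 0 i = 'D_v (fun y => f y 0 i) x.
Proof. by move=> fd; rewrite derive_mx ?mxE//; exact: diff_derivable. Qed.

Lemma differentiable_rV_coord f x i : differentiable f x ->
  differentiable (fun y => f y 0 i) x.
Proof.
by move=> fd; apply: (@differentiable_comp _ _ _ _ f (fun y => y 0 i)) => //; exact: differentiable_coord.
Qed.

Lemma Ck_on_rV k U f : open U -> (forall i, Ck_on k U (fun x => f x 0 i)) ->
  Ck_on k U f.
Proof.
move=> oU; elim: k f => [|k IH] f fk.
  by move=> x Ux; apply: continuous_rV => i; exact: fk.
have fd x : U x -> differentiable f x.
  by move=> Ux; apply: differentiable_rV => i; have [fd _] := fk i; exact: fd.
split=> // v; apply: IH => i.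
have [_ fkv] := fk i; apply: eq_Ck_on (fkv v) => // x Ux.
by rewrite derive_rV//; exact: fd.
Qed.

Lemma Ck_on_rV_coord k U f i : open U -> Ck_on k U f ->
  Ck_on k U (fun x => f x 0 i).
Proof.
move=> oU; elim: k f => [|k IH] f.
  move=> fc x Ux; apply: (@continuous_comp _ _ _ f (fun y : 'rV[R]_m => y 0 i)); first exact: fc.
  exact: coord_continuous.
move=> [fd fk]; split=> [x Ux|v].
  by apply: differentiable_rV_coord; exact: fd.
by apply: eq_Ck_on (IH _ (fk v)) => // x Ux; rewrite derive_rV//; exact: fd.
Qed.

End CkRow.

Section CkComp.
Context {R : realType} {m : nat} {V : normedModType R}.

Lemma derive_comp_rV (g : V -> 'rV[R]_m) (f : 'rV[R]_m -> R) x v :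
  differentiable g x -> differentiable f (g x) ->
  'D_v (f \o g) x =
  \sum_i 'D_(delta_mx 0 i) f (g x) * 'D_v (fun y => g y 0 i) x.
Proof.
move=> gd fd; rewrite deriveE; last exact: differentiable_comp.
rewrite diff_comp //= -(deriveE v gd) (row_sum_delta ('D_v g x)) linear_sum.
by apply: eq_bigr => i _; rewrite linearZ /= derive_rV// mulrC (deriveE _ fd).
Qed.

Lemma Ck_on_comp k (U : set V) (U' : set 'rV[R]_m) (g : V -> 'rV[R]_m) (f : 'rV[R]_m -> R) :
  open U -> (forall x, U x -> U' (g x)) ->
  Ck_on k U g -> Ck_on k U' f -> Ck_on k U (f \o g).
Proof.
move=> oU gU; elim: k f => [|k IH] f gk fk.
  by move=> x Ux; apply: continuous_comp; [exact: gk|exact: (fk _ (gU _ Ux))].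
have gk0 := Ck_onW gk; move: gk fk => [gd gk] [fd fk].
split=> [x Ux|v].
  by apply: differentiable_comp; [exact: gd|exact: (fd _ (gU _ Ux))].
have : Ck_on k U (fun x => \sum_i ('D_(delta_mx 0 i) f \o g) x * ('D_v g x) 0 i).
  apply: Ck_on_sum => // i _; apply: Ck_onM => //; first exact: (IH _ gk0 (fk _)).
  exact: (Ck_on_rV_coord i oU (gk v)).
apply: eq_Ck_on => // x Ux.
rewrite derive_comp_rV; [|exact: gd|exact: (fd _ (gU _ Ux))].
by apply: eq_bigr => i _; rewrite derive_rV//; exact: gd.
Qed.

End CkComp.

(** * Smoothness of inverse maps *)

(** With [K = g (h + y) - g y], the expansion of [f] at [g y] bounds [L h - K] by a small multiple
    of [K]. This first gives the a priori bound [|K| <= 2 * C * |h|], and then an error of order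
    [o(h)]. *)
Lemma is_diff_inverse (R : realType) (E : normedModType R) (f g : E -> E)
    (L : {linear E -> E}) (y : E) : {for y, continuous g} ->
  differentiable f (g y) -> continuous L -> (forall v, L ('d f (g y) v) = v) ->
  (\forall z \near y, f (g z) = z) ->
  differentiable g y /\ 'd g y = L :> (E -> E).
Proof.
move=> gc fd Lc LA fgK; set x := g y in fd LA *.
have [C C0 LC] := linear_lipschitz Lc.
have fgy : f x = y := nbhs_singleton fgK.
suff EL : g \o shift y = cst (g y) + L +o_ 0 id.
  have dL := diff_unique Lc EL.
  by split=> //; apply/diff_locallyP; rewrite dL.
apply/eqaddoP => _/posnumP[e].
have [_ /eqaddoP fo] := (diff_locallyP _ _).1 fd.
(* The first entry gives [C * e1 <= 1 / 2], hence the a priori bound; the second turns the error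
   [C * e1 * |K|] into at most [e * |h|]. *)
pose e1 : R := Num.min (2 * C)^-1 (e%:num / (2 * C * C)).
have e10 : 0 < e1.
  by rewrite lt_min invr_gt0 mulr_gt0//= divr_gt0// !mulr_gt0.
have cs : (h + y) @[h --> (0:E)] --> y.
  by rewrite -[X in _ --> X]add0r; apply: cvgD; [exact: cvg_id|exact: cvg_cst].
have c0 : g (h + y) - x @[h --> (0:E)] --> (0 : E).
  rewrite -[X in _ --> X](subrr x); apply: cvgB; last exact: cvg_cst.
  have gc' : g z @[z --> y] --> x := gc.
  exact: (cvg_comp _ _ cs gc').
have fo1 := c0 _ (fo e1 e10); have fgK1 := cs _ fgK.
near=> h.
have H0 : `|(f \o shift x - (cst (f x) + 'd f x)) (g (h + y) - x)|
    <= e1 * `|g (h + y) - x| by near: h; exact: fo1.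
have H2 : f (g (h + y)) = h + y by near: h; exact: fgK1.
set K := g (h + y) - x in H0 *.
have H1 : `|f (g (h + y)) - f x - 'd f x K| <= e1 * `|K|.
  by move: H0; rewrite /= !fctE /= /shift /= /K subrK opprD addrA; exact.
rewrite H2 fgy addrK in H1.
have H3 : `|L h - K| <= C * (e1 * `|K|).
  rewrite -[X in _ - X]LA -linearB (le_trans (LC _))// ler_wpM2l//.
  exact: ltW.
have H4 : `|K| <= 2 * C * `|h|.
  have : `|K| <= `|L h| + `|L h - K|.
    by rewrite -{1}(subrK (L h) K) addrC (le_trans (ler_normD _ _))// lerD2l distrC.
  have : C * (e1 * `|K|) <= 2^-1 * `|K|.
    rewrite mulrA ler_wpM2r//.
    have e1C : e1 <= (2 * C)^-1 by rewrite ge_min lexx.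
    rewrite (le_trans (ler_wpM2l (ltW C0) e1C))//.
    by rewrite invfM mulrCA mulfV ?mulr1// gt_eqF.
  have := LC h.
  move: (normr_ge0 K) (normr_ge0 h) H3 => *; lra.
have -> : (g \o shift y - (cst (g y) + L)) h = K - L h.
  by rewrite /= !fctE /= /shift /= /K opprD addrA.
rewrite distrC (le_trans H3)//.
have H5 : e1 <= e%:num / (2 * C * C) by rewrite ge_min lexx orbT.
have : C * (e1 * `|K|) <= C * (e%:num / (2 * C * C) * (2 * C * `|h|)).
  rewrite ler_wpM2l//; first exact: ltW.
  by apply: ler_pM => //; exact: ltW.
move/le_trans; apply.
rewrite le_eqVlt; apply/orP; left; apply/eqP; rewrite /=.
by field; rewrite gt_eqF.
Unshelve. all: by end_near. Qed.

Section InverseMap.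
Context {R : realType} {m : nat}.
Local Notation E := 'rV[R]_m.
Implicit Types (f g : E -> E) (k : nat).

Lemma mulmxr_continuous (B : 'M[R]_m) : continuous (fun v : E => v *m B).
Proof.
move=> x; apply: continuous_rV => i.
have : Ck_on 0 [set: E] (fun v => \sum_j v 0 j * B j i).
  apply: Ck_on_sum => [|j _]; first exact: openT.
  apply: Ck_onM; [exact: openT|exact: Ck_on_coord openT|exact: Ck_on_cst].
move=> /(_ x I); rewrite /prop_for.
suff -> : (fun y : E => (y *m B) 0 i) = (fun v => \sum_j v 0 j * B j i) by [].
by apply/funext => v; rewrite mxE.
Qed.

Lemma jacobian_unit f x : (forall v, 'd f x v = 0 -> v = 0) ->
  jacobian f x \in unitmx.
Proof.
move=> f0; rewrite -row_free_unit; apply/row_freeP.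
have : kermx (jacobian f x) = 0.
  apply/row_matrixP => i; rewrite row0; apply: f0.
  by rewrite -mul_rV_lin1; apply/sub_kermxP; rewrite row_sub.
move/eqP; rewrite kermx_eq0 => /row_freeP[B fB]; by exists B.
Qed.

Lemma differentiable_inverse f g y : {for y, continuous g} -> differentiable f (g y) ->
  (forall v, 'd f (g y) v = 0 -> v = 0) ->
  (\forall z \near y, f (g z) = z) ->
  differentiable g y /\ forall v, 'd g y v = v *m invmx (jacobian f (g y)).
Proof.
move=> gc fd f0 fgK; have Au := jacobian_unit f0.
pose L : {linear E -> E} := mulmxr (invmx (jacobian f (g y))).
have LA v : L ('d f (g y) v) = v by rewrite /= -mul_rV_lin1 mulmxK.
have Lc : continuous L by exact: mulmxr_continuous.
by have [? ->] := is_diff_inverse gc fd Lc LA fgK.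
Qed.

Lemma Ck_on_det (V : normedModType R) k (U : set V) n (M : V -> 'M[R]_n) : open U ->
  (forall i j, Ck_on k U (fun x => M x i j)) -> Ck_on k U (fun x => \det (M x)).
Proof.
move=> oU Mk.
have : Ck_on k U (fun x => \sum_(s : 'S_n) (-1) ^+ s * \prod_i M x i (s i)).
  apply: Ck_on_sum => // s _; apply: Ck_onM => //; first exact: Ck_on_cst.
  by apply: Ck_on_prod => // i _; exact: Mk.
by apply: eq_Ck_on.
Qed.

(** Cramer's rule: the entries are cofactors divided by the determinant. *)
Lemma Ck_on_invmx (V : normedModType R) k (U : set V) n (M : V -> 'M[R]_n) i j : open U ->
  (forall x, U x -> M x \in unitmx) ->
  (forall i j, Ck_on k U (fun x => M x i j)) -> Ck_on k U (fun x => invmx (M x) i j).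
Proof.
move=> oU Mu Mk.
have : Ck_on k U (fun x => (\det (M x))^-1 *
    ((-1) ^+ (j + i) * \det (row' j (col' i (M x))))).
  apply: Ck_onM => //.
    apply: Ck_onV => //; last exact: Ck_on_det.
    by move=> x /Mu; rewrite unitmxE unitfE.
  apply: Ck_onM => //; first exact: Ck_on_cst.
  apply: Ck_on_det => // i' j'.
  by apply: eq_Ck_on (Mk (lift j i') (lift i j')) => // x _; rewrite !mxE.
apply: eq_Ck_on => // x Ux.
by rewrite /invmx Mu// !mxE.
Qed.

(** The derivative of [g] is the inverse Jacobian of [f] taken at [g y], so each order of regularity
    of [g] yields the next one, up to the order of [f]. *)
Lemma Ck_on_inverse k (U V : set E) f g : open U -> open V ->
  (forall y, V y -> U (g y) /\ f (g y) = y) ->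
  (forall y, V y -> {for y, continuous g}) ->
  (forall x, U x -> forall v, 'd f x v = 0 -> v = 0) ->
  Ck_on k.+1 U f -> Ck_on k.+1 V g.
Proof.
move=> oU oV fgK gc f0 fk1.
have fd x : U x -> differentiable f x by move: fk1 => [+ _]; exact.
have dg y : V y -> differentiable g y /\
    forall v, 'd g y v = v *m invmx (jacobian f (g y)).
  move=> Vy; have [Ug _] := fgK y Vy.
  apply: differentiable_inverse; [exact: gc|exact: fd|exact: f0|].
  by near=> z; apply: (fgK z _).2; near: z; exact: open_nbhs_nbhs.
have step j : (j <= k)%N -> Ck_on j V g -> Ck_on j.+1 V g.
  move=> jk gj; split=> [y /dg[]//|v].
  have fj : Ck_on j.+1 U f.
    have {jk} : exists i, (k = i + j)%N by exists (k - j)%N; rewrite subnK.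
    move=> [i ki]; move: fk1; rewrite ki; elim: i {ki} => // i IH.
    by rewrite addSn => /Ck_onW.
  apply: Ck_on_rV => // i.
  have : Ck_on j V (fun y => \sum_l v 0 l * invmx (jacobian f (g y)) l i).
    apply: Ck_on_sum => // l _; apply: Ck_onM => //; first exact: Ck_on_cst.
    apply: Ck_on_invmx => // [y Vy|a b].
      by apply: jacobian_unit; apply: f0; have [] := fgK y Vy.
    have [_ /(_ (delta_mx 0 a)) fa] := fj.
    have := @Ck_on_comp _ _ _ j V U g (fun x => 'D_(delta_mx 0 a) f x 0 b) oV
      (fun y Vy => (fgK y Vy).1) gj (Ck_on_rV_coord b oU fa).
    apply: eq_Ck_on => // y Vy /=.
    by rewrite deriveE ?mxE//; apply: fd; exact: (fgK y Vy).1.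
  apply: eq_Ck_on => // y Vy; have [gd gE] := dg y Vy.
  by rewrite deriveE// gE mxE.
have : forall j, (j <= k.+1)%N -> Ck_on j V g.
  elim=> [_|j IH jk]; first exact: gc.
  by apply: step => //; apply: IH; exact: ltnW.
by apply.
Unshelve. all: by end_near. Qed.

End InverseMap.

(** * Directional derivatives and bump functions *)

Section DirDer.
Context {R : realType} {V : normedModType R}.
Implicit Types (f g : V -> R) (x v : V).

(** Differentiability and the value of the derivative travel together through the calculus rules;
    the value produced by the rules is brought to the desired form at the end by [dir_der_eq]. *)
Definition dir_der f x v (d : R) := differentiable f x /\ 'D_v f x = d.

Lemma dir_der_cst x v (c : R) : dir_der (fun=> c) x v 0.
Proof. by split; [exact: differentiable_cst|rewrite (derive_cst c)]. Qed.

Lemma dir_derD f g x v df dg : dir_der f x v df -> dir_der g x v dg ->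
  dir_der (fun y => f y + g y) x v (df + dg).
Proof.
move=> [fd <-] [gd <-]; split; first exact: differentiableD.
by apply: deriveD; exact: diff_derivable.
Qed.

Lemma dir_derM f g x v df dg : dir_der f x v df -> dir_der g x v dg ->
  dir_der (fun y => f y * g y) x v (df * g x + f x * dg).
Proof.
move=> [fd <-] [gd <-]; split; first exact: differentiableM.
have sE (a b : R) : a *: b = a * b by [].
rewrite [LHS](@deriveM _ _ f g); [|exact: diff_derivable|exact: diff_derivable].
by rewrite !sE addrC (mulrC (g x)).
Qed.

Lemma dir_derN f x v df : dir_der f x v df -> dir_der (fun y => - f y) x v (- df).
Proof.
by move=> fd; have := dir_derM (dir_der_cst x v (-1)) fd;
  rewrite mul0r add0r mulN1r; under eq_fun do rewrite mulN1r.
Qed.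

Lemma dir_derB f g x v df dg : dir_der f x v df -> dir_der g x v dg ->
  dir_der (fun y => f y - g y) x v (df - dg).
Proof. by move=> fd gd; apply: dir_derD => //; exact: dir_derN. Qed.

Lemma dir_der_sum (I : Type) (r : seq I) (P : pred I) (F : I -> V -> R) dF x v :
  (forall i, P i -> dir_der (F i) x v (dF i)) ->
  dir_der (fun y => \sum_(i <- r | P i) F i y) x v (\sum_(i <- r | P i) dF i).
Proof.
move=> Fd; elim: r => [|i r IH].
  rewrite big_nil (_ : (fun _ => _) = fun=> 0); first exact: dir_der_cst.
  by apply/funext => y; rewrite big_nil.
rewrite big_cons (_ : (fun _ => _) = fun y => if P i then F i y +
    \sum_(j <- r | P j) F j y else \sum_(j <- r | P j) F j y); last first.
  by apply/funext => y; rewrite big_cons.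
by case: ifPn => // Pi; apply: dir_derD => //; exact: Fd.
Qed.

Lemma dir_der_comp (p : R -> R) dp f x v df : is_derive (f x) 1 p dp ->
  dir_der f x v df -> dir_der (fun y => p (f y)) x v (dp * df).
Proof. by move=> pd [fd <-]; exact: is_derive_comp_real. Qed.

Lemma dir_der_eq f x v d d' : dir_der f x v d -> d = d' -> dir_der f x v d'.
Proof. by move=> ? <-. Qed.

Lemma dir_der_near f g x v d : (\forall y \near x, f y = g y) ->
  dir_der f x v d -> dir_der g x v d.
Proof.
move=> fg [fd <-]; split; first exact: differentiable_near fg fd.
by apply/esym; exact: near_eq_derive.
Qed.

End DirDer.

Lemma dir_der_is_derive (R : realType) (f : R -> R) (x d : R) :
  dir_der f x 1 d -> is_derive x 1 f d.
Proof. by move=> [fd <-]; apply/derivableP/diff_derivable. Qed.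

Lemma is_derive_dir_der (R : realType) (f : R -> R) (x d : R) :
  is_derive x 1 f d -> dir_der f x 1 d.
Proof. by move=> fd; split; [exact/derivable1_diffP|exact: derive_val]. Qed.

Lemma dir_der_id (R : realType) (x : R) : dir_der (fun y : R => y) x 1 1.
Proof. by apply: is_derive_dir_der; exact: is_derive_id. Qed.

Lemma dir_der_coord (R : realType) m (x v : 'rV[R]_m) i :
  dir_der (fun y : 'rV[R]_m => y 0 i) x v (v 0 i).
Proof.
split; first exact: differentiable_coord.
have did : derivable (id : 'rV[R]_m -> 'rV[R]_m) x v by exact: derivable_id.
have := @derive_mx R _ 1 m id x v did.
by move=> /matrixP /(_ 0 i); rewrite !mxE derive_id.
Qed.

Section MeanValue.
Context {R : realType}.
Implicit Types (f df : R -> R).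

Lemma mean_value f df (a b : R) : a <= b ->
  (forall x, a <= x <= b -> is_derive x 1 f (df x)) ->
  exists2 c, a <= c <= b & f b - f a = df c * (b - a).
Proof.
move=> ab fd; have [x xab|x|c cab fE] := @MVT_segment R f df a b ab.
- by apply: fd; move: xab; rewrite in_itv /= => /andP[? ?]; rewrite !ltW.
- apply: derivable_within_continuous => {}x xab.
  have fx : is_derive x 1 f (df x) by apply: fd; move: xab; rewrite in_itv.
  exact: ex_derive.
- by exists c => //; move: cab; rewrite in_itv.
Qed.

Lemma lipschitz_derive f df (a b L : R) :
  (forall x, a <= x <= b -> is_derive x 1 f (df x)) ->
  (forall x, a <= x <= b -> `|df x| <= L) ->
  forall x y, a <= x <= b -> a <= y <= b -> `|f x - f y| <= L * `|x - y|.
Proof.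
move=> fd dfL x y.
wlog xy : x y / y <= x => [hw xab yab|/andP[ax xb] /andP[ay yb]].
  have [yx|/ltW xy] := leP y x; first exact: hw.
  by rewrite distrC (distrC x); exact: hw.
have [z zxy|c /andP[yc cx] ->] := mean_value xy (f := f) (df := df).
  by apply: fd; case/andP: zxy => yz zx; rewrite (le_trans ay)// (le_trans zx).
rewrite normrM ler_wpM2r// dfL//.
by rewrite (le_trans ay)// (le_trans cx).
Qed.

Lemma nondecreasing_derive f df (a b : R) : a <= b ->
  (forall x, a <= x <= b -> is_derive x 1 f (df x)) ->
  (forall x, a <= x <= b -> 0 <= df x) -> f a <= f b.
Proof.
move=> ab fd df0; have [c cab fE] := mean_value ab fd.
by rewrite -subr_ge0 fE mulr_ge0 ?df0// subr_ge0.
Qed.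

Lemma increasing_derive f df (a b : R) : a < b ->
  (forall x, a <= x <= b -> is_derive x 1 f (df x)) ->
  (forall x, a <= x <= b -> 0 < df x) -> f a < f b.
Proof.
move=> ab fd df0; have [c cab fE] := mean_value (ltW ab) fd.
by rewrite -subr_gt0 fE mulr_gt0 ?df0// subr_gt0.
Qed.

(** Meant for [flat k] at the origin, where no single formula is valid on both sides. *)
Lemma is_derive_sqr_bound f (C : R) : f 0 = 0 ->
  (forall x, `|f x| <= C * x ^+ 2) -> is_derive (0 : R) 1 f 0.
Proof.
move=> f0 fC.
have cv : h^-1 *: (f (h *: 1 + 0) - f 0) @[h --> (0:R)^'] --> (0 : R).
  apply/cvgrPdist_le => e e0.
  near=> h; rewrite f0 subr0 addr0 [h *: 1]mulr1 sub0r normrN normrZ.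
  have h0 : h != 0 by near: h; exact: nbhs_dnbhs_neq.
  rewrite normfV ler_pdivrMl ?normr_gt0// (le_trans (fC h))//.
  rewrite -real_normK ?num_real// expr2 mulrCA ler_wpM2l//.
  have he : `|h| <= e / (`|C| + 1).
    by near: h; apply: dnbhs0_le; rewrite divr_gt0// ltr_wpDl.
  rewrite (le_trans (ler_wpM2r _ (ler_norm C)))//.
  rewrite (le_trans (ler_wpM2l _ he))// mulrCA ger_pMr//.
  by rewrite ler_pdivrMr ?mul1r ?lerDl// ltr_wpDl.
by split; [apply/cvg_ex; exists 0|apply/cvg_lim].
Unshelve. all: by end_near. Qed.

End MeanValue.

Lemma is_derive_exprn (R : realType) k (x : R) :
  is_derive x 1 (fun y : R => y ^+ k) (k%:R * x ^+ k.-1).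
Proof.
have h := @is_deriveX _ _ id k x 1 1 (is_derive_id x 1).
have -> : (fun y : R => y ^+ k) = id ^+ k :> (R -> R) by apply/funext => y; rewrite exprfctE.
by apply: is_derive_eq; rewrite [LHS]mulr1.
Qed.

(** * Flat functions and thin pulses *)

Section Flat.
Context {R : realType}.
Implicit Types x y : R.

(** [flat 0] is the classical [exp (- 1 / x)] extended by [0]; the negative powers of [x] make the
    span of the family closed under differentiation. *)
Definition flat (k : nat) x : R := if 0 < x then x ^- k * expR (- x^-1) else 0.

Lemma flat_le0 k x : x <= 0 -> flat k x = 0.
Proof. by rewrite /flat leNgt => /negbTE ->. Qed.

Lemma flat_ge0 k x : 0 <= flat k x.
Proof.
rewrite /flat; case: ifPn => // x0.
by rewrite mulr_ge0 ?expR_ge0// invr_ge0 exprn_ge0// ltW.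
Qed.

(** For positive [k], raise [y / k <= expR (y / k)] to the power [k]. *)
Lemma expR_bound k y : 0 < y -> y ^+ k * expR (- y) <= k%:R ^+ k.
Proof.
move=> y0; case: k => [|k].
  by rewrite !expr0 mul1r expR_le1 oppr_le0 ltW.
rewrite expRN ler_pdivrMr ?expR_gt0//.
have -> : y = (k.+1)%:R * (y / (k.+1)%:R) by rewrite mulrCA mulfV ?mulr1// pnatr_eq0.
rewrite expRM_natl -exprMn; apply: lerXn2r.
- by rewrite nnegrE mulr_ge0// divr_ge0// ltW.
- by rewrite nnegrE mulr_ge0// expR_ge0.
- by rewrite ler_wpM2l// (le_trans _ (expR_ge1Dx _))// lerDr.
Qed.

Lemma flat_bound k x : flat k x <= k%:R ^+ k.
Proof.
rewrite /flat; case: ifPn => [x0|_]; last by rewrite exprn_ge0.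
by rewrite -exprVn expR_bound// invr_gt0.
Qed.

(** Away from the origin this is the product rule. At the origin [flat k y = flat k.+2 y * y ^+ 2]
    with a bounded first factor, so the function is quadratically small. *)
Lemma is_derive_flat k x :
  is_derive x 1 (flat k) (- k%:R * flat k.+1 x + flat k.+2 x).
Proof.
have [x0|x0|->] := ltgtP x 0.
- rewrite !flat_le0 ?mulr0 ?addr0; [|exact: ltW|exact: ltW].
  apply: (@near_eq_is_derive _ _ _ (cst 0)).
  near=> y; rewrite flat_le0// ltW//; near: y; exact: lt_nbhsl.
- apply: (@near_eq_is_derive _ _ _ (fun y => y^-1 ^+ k * expR (- y^-1))).
    near=> y; have y0 : 0 < y by near: y; exact: lt_nbhsr.
    by rewrite /flat y0 exprVn.
  have dx := is_derive_inv (lt0r_neq0 x0).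
  apply: dir_der_is_derive; apply: dir_der_eq.
    apply: dir_derM.
      apply: (@dir_der_comp _ _ (fun y => y ^+ k)); last exact: is_derive_dir_der.
      exact: is_derive_exprn.
    apply: dir_der_comp.
    apply: dir_derN; exact: is_derive_dir_der.
  rewrite /flat x0 /= -!exprVn; set y := x^-1.
  rewrite !exprS; case: k => [|k]; rewrite ?exprS /=; ring.
- rewrite !flat_le0// mulr0 addr0.
  apply: (@is_derive_sqr_bound _ _ (k.+2%:R ^+ k.+2)); first by rewrite flat_le0.
  move=> y; rewrite ger0_norm ?flat_ge0//.
  have [y0|y0] := leP y 0; first by rewrite flat_le0// mulr_ge0 ?sqr_ge0.
  have -> : flat k y = flat k.+2 y * y ^+ 2.
    rewrite /flat y0 mulrAC; congr (_ * _).
    rewrite -!exprVn; have := mulVf (lt0r_neq0 y0); set z := y^-1 => zy.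
    have -> : z ^+ k.+2 * y ^+ 2 = z ^+ k * (z * y) ^+ 2 by rewrite !exprS; ring.
    by rewrite zy expr1n mulr1.
  by rewrite ler_wpM2r ?sqr_ge0// flat_bound.
Unshelve. all: by end_near. Qed.

Lemma Ck_on_flat (V : normedModType R) k j (U : set V) (f : V -> R) : open U ->
  Ck_on k U f -> Ck_on k U (fun z => flat j (f z)).
Proof.
move=> oU; elim: k j => [|k IH] j fk.
  by move=> z Uz; apply: (continuous_comp_derive U (is_derive_flat j (f z))); exact: fk.
apply: (@Ck_on_comp_derive _ _ k U (flat j)
  (fun y => - j%:R * flat j.+1 y + flat j.+2 y)) => //.
  by move=> z _; exact: is_derive_flat.
apply: Ck_onD => //; last exact: IH (Ck_onW fk).
by apply: Ck_onM => //; [exact: Ck_on_cst|exact: IH (Ck_onW fk)].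
Qed.

Lemma is_derive_flat0 x : is_derive x 1 (flat 0) (flat 2 x).
Proof. by have h := is_derive_flat 0 x; apply: is_derive_eq; rewrite mulr0n oppr0 mul0r add0r. Qed.

Lemma flat0_le1 x : flat 0 x <= 1.
Proof. by rewrite (le_trans (flat_bound 0 x)). Qed.

Lemma flat2_le4 x : flat 2 x <= 4.
Proof. by rewrite (le_trans (flat_bound 2 x))// -natrX ler_nat. Qed.

Lemma flat0_nondecreasing x y : x <= y -> flat 0 x <= flat 0 y.
Proof.
move=> xy; apply: (nondecreasing_derive xy) => z _; first exact: is_derive_flat0.
exact: flat_ge0.
Qed.

Lemma flat0_lipschitz x y : `|flat 0 x - flat 0 y| <= 4 * `|x - y|.
Proof.
apply: (@lipschitz_derive _ _ (flat 2) (Num.min x y) (Num.max x y)).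
- by move=> z _; exact: is_derive_flat0.
- by move=> z _; rewrite ger0_norm ?flat_ge0// flat2_le4.
- by rewrite ge_min lexx le_max lexx.
- by rewrite ge_min lexx orbT le_max lexx orbT.
Qed.

Lemma flat0_gt0 x : 0 < x -> 0 < flat 0 x.
Proof. by move=> x0; rewrite /flat x0 expr0 invr1 mul1r expR_gt0. Qed.

End Flat.

Section Finger.
Context {R : realType}.
Implicit Types (B dB : R -> R).

(** One-variable smoothness in the form in which it is used, by composition with the angle; taking
    [f] to be the identity recovers the usual notion. *)
Definition smooth1 B := forall (V : normedModType R) (k : nat) (U : set V) (f : V -> R), open U ->
  Ck_on k U f -> Ck_on k U (fun x => B (f x)).

(* [B'] has a tall narrow peak at [m] but is nowhere below [- eta], although [B]
   has compact support: [B] is a bump times [atan (K (x - m)) / K], [K] large. *)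
Record finger (m w eta : R) B dB : Prop := Finger {
  finger_smooth : smooth1 B;
  finger_dsmooth : smooth1 dB;
  finger_derive : forall x : R, is_derive x 1 B (dB x);
  finger_supp : forall x, w <= `|x - m| -> B x = 0 /\ dB x = 0;
  finger_ge : forall x, - eta <= dB x;
  finger_le : forall x, dB x <= 1 + eta;
  finger_top : dB m = flat 0 1 }.

Lemma finger_exists (m w eta : R) : 0 < w -> 0 < eta ->
  exists B dB, finger m w eta B dB.
Proof.
(* The bump part of [dB] is at most [4 * (2 / w) * (2 / K)], from [flat 2 <= 4], the slope [2 / w]
   of the argument [b], and [|atan| <= 2]. This is [eta] for the present [K]. *)
move=> w0 eta0; pose K : R := 16 / (w * eta).
have K0 : 0 < K by rewrite divr_gt0// mulr_gt0.
pose b (x : R) := 1 - ((x - m) / w) ^+ 2.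
pose B (x : R) := flat 0 (b x) * (atan (K * (x - m)) / K).
(* The first summand differentiates the bump and is uniformly small; the second is the peak,
   nonnegative and equal to [flat 0 1] at [m]. *)
pose dB (x : R) := flat 2 (b x) * (- 2 * (x - m) / w ^+ 2) * (atan (K * (x - m)) / K)
    + flat 0 (b x) * (1 + (K * (x - m)) ^+ 2)^-1.
have dbx x : dir_der b x 1 (- 2 * (x - m) / w ^+ 2).
  apply: dir_der_eq.
    apply: dir_derB; first exact: dir_der_cst.
    apply: (dir_der_comp (is_derive_exprn 2 _)).
    apply: dir_derM; last exact: dir_der_cst.
    by apply: dir_derB; [exact: dir_der_id|exact: dir_der_cst].
  by rewrite /=; field; rewrite gt_eqF.
have dBx (x : R) : is_derive x 1 B (dB x).
  apply: dir_der_is_derive; apply: dir_der_eq.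
    apply: dir_derM.
      exact: (dir_der_comp (is_derive_flat0 _) (dbx x)).
    apply: dir_derM; last exact: dir_der_cst.
    apply: (dir_der_comp (is_derive1_atan _)).
    apply: dir_derM; first exact: dir_der_cst.
    by apply: dir_derB; [exact: dir_der_id|exact: dir_der_cst].
  rewrite /dB mul0r add0r subr0 mulr1 mulr0 addr0; congr (_ + _ * _).
  by rewrite -mulrA mulfV ?mulr1// gt_eqF.
have lin (V : normedModType R) k (U : set V) f (c : R) : open U -> Ck_on k U f ->
    Ck_on k U (fun x => c * (f x - m)).
  move=> oU fk; apply: Ck_onM => //; first exact: Ck_on_cst.
  by apply: Ck_onB => //; exact: Ck_on_cst.
have bk (V : normedModType R) k (U : set V) f : open U -> Ck_on k U f ->
    Ck_on k U (fun x => b (f x)).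
  move=> oU fk; have h := lin V k U f w^-1 oU fk.
  apply: eq_Ck_on (Ck_onB oU (Ck_on_cst k U (1 : R)) (Ck_onM oU h h)) => // x _.
  by rewrite /b expr2 (mulrC w^-1).
have ak (V : normedModType R) k (U : set V) f : open U -> Ck_on k U f ->
    Ck_on k U (fun x => atan (K * (f x - m)) / K).
  move=> oU fk; apply: Ck_onM => //; last exact: Ck_on_cst.
  by apply: Ck_on_atan => //; exact: (lin V k U f K oU fk).
have main x : - eta <= flat 2 (b x) * (- 2 * (x - m) / w ^+ 2) * (atan (K * (x - m)) / K) <= eta.
  have [bx|bx] := leP (b x) 0; first by rewrite flat_le0// !mul0r oppr_le0 ltW.
  rewrite -ler_norml !normrM.
  have xw : `|x - m| <= w.
    rewrite leNgt; apply/negP => wx; move: bx; rewrite subr_gt0.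
    rewrite -real_normK ?num_real// normrM normfV (gtr0_norm w0) expr_div_n.
    by rewrite ltr_pdivrMr ?exprn_gt0// mul1r ltr_pXn2r// ?nnegrE ?ltW// ltNge ltW.
  have aK : `|atan (K * (x - m))| <= 2.
    rewrite ler_norml; apply/andP; split.
      apply: ltW (lt_trans _ (atan_gtNpi2 _)); rewrite ltrN2; exact: pihalf_lt2.
    by apply: ltW (lt_trans (atan_ltpi2 _) _); exact: pihalf_lt2.
  rewrite !normfV normrX (gtr0_norm w0) (gtr0_norm K0) normrN (ger0_norm (ler0n _ 2)).
  rewrite (ger0_norm (flat_ge0 _ _)).
  apply: (@le_trans _ _ (4 * (2 * w / w ^+ 2) * (2 / K))).
    apply: ler_pM => //.
    - by rewrite !mulr_ge0// ?flat_ge0// invr_ge0 exprn_ge0// ltW.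
    - by rewrite mulr_ge0// invr_ge0 ltW.
    - apply: ler_pM => //; [exact: flat_ge0| |exact: flat2_le4|].
        by rewrite !mulr_ge0// invr_ge0 exprn_ge0// ltW.
      by rewrite ler_wpM2r ?ler_pM2l// invr_ge0 exprn_ge0// ltW.
    - by rewrite ler_wpM2r// invr_ge0 ltW.
  rewrite /K le_eqVlt; apply/orP; left; apply/eqP; field.
  by rewrite !gt_eqF.
have snd x : 0 <= flat 0 (b x) * (1 + (K * (x - m)) ^+ 2)^-1 <= 1.
  have h : 1 <= 1 + (K * (x - m)) ^+ 2 by rewrite lerDl sqr_ge0.
  have h0 : 0 < 1 + (K * (x - m)) ^+ 2 by rewrite (lt_le_trans _ h).
  rewrite mulr_ge0 ?flat_ge0 ?invr_ge0 ?(ltW h0)//=.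
  by rewrite mulr_ile1 ?flat_ge0 ?flat0_le1 ?invr_ge0 ?invf_le1 ?(ltW h0).
exists B, dB; split => //.
- move=> V k U f oU fk.
  exact: (Ck_onM oU (Ck_on_flat 0 oU (bk V k U f oU fk)) (ak V k U f oU fk)).
- move=> V k U f oU fk; have bf := bk V k U f oU fk.
  have h := lin V k U f K oU fk.
  have h1 : Ck_on k U (fun x => 1 + (K * (f x - m)) ^+ 2).
    by apply: eq_Ck_on (Ck_onD oU (Ck_on_cst k U (1 : R)) (Ck_onM oU h h)).
  have h2 : Ck_on k U (fun x => - 2 * (f x - m) / w ^+ 2).
    by apply: Ck_onM => //; [exact: (lin V k U f (-2) oU fk)|exact: Ck_on_cst].
  apply: (Ck_onD oU (Ck_onM oU (Ck_onM oU (Ck_on_flat 2 oU bf) h2) (ak V k U f oU fk))).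
  apply: (Ck_onM oU (Ck_on_flat 0 oU bf)); apply: Ck_onV => // x _.
  by rewrite gt_eqF// (@lt_le_trans _ _ 1)// lerDl sqr_ge0.
- move=> x wx.
  have bx : b x <= 0.
    rewrite subr_le0 -real_normK ?num_real// normrM normfV (gtr0_norm w0).
    by rewrite exprn_ege1// ler_pdivlMr// mul1r.
  by rewrite /B /dB !flat_le0// !mul0r addr0.
- by move=> x; rewrite /dB; move: (main x) (snd x) => /andP[? _] /andP[? _]; lra.
- by move=> x; rewrite /dB; move: (main x) (snd x) => /andP[_ ?] /andP[_ ?]; lra.
- rewrite /dB /b !subrr mul0r !mulr0 mul0r mulr0 mul0r add0r.
  by rewrite !expr0n /= subr0 addr0 invr1 mulr1.
Qed.

End Finger.

(** * Bounds for the Hausdorff dimension *)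

Section RowNorm.
Context {R : realType} {m : nat}.
Implicit Types x y : 'rV[R]_m.

Lemma normr_coord x i : `|x 0 i| <= `|x|.
Proof.
rewrite [leRHS]/Num.Def.normr/= mx_normrE.
exact: (@le_bigmax _ _ _ _ (fun ij : 'I_1 * 'I_m => `|x ij.1 ij.2|) (0, i)).
Qed.

Lemma normr_rV_le x r : 0 <= r -> (forall i, `|x 0 i| <= r) -> `|x| <= r.
Proof.
move=> r0 xr; rewrite [leLHS]/Num.Def.normr/= mx_normrE bigmax_le// => -[i j] _ /=.
by rewrite ord1.
Qed.

Lemma edist_le x y : Defs.edist x y <= m%:R * `|x - y|.
Proof.
rewrite /Defs.edist -[leRHS]ger0_norm ?mulr_ge0// -sqrtr_sqr ler_wsqrtr//.
apply: (@le_trans _ _ (\sum_(i < m) `|x - y| ^+ 2)).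
  apply: ler_sum => i _; rewrite -real_normK ?num_real// lerXn2r ?nnegrE//.
  by have := normr_coord (x - y) i; rewrite !mxE.
rewrite sumr_const card_ord -[leLHS]mulr_natl exprMn ler_wpM2r ?sqr_ge0//.
by rewrite -natrX ler_nat -mulnn; case: (m) => // n; rewrite leq_pmulr.
Qed.

Lemma edist_ge x y : `|x - y| <= Defs.edist x y.
Proof.
apply: normr_rV_le => [|i]; first exact: sqrtr_ge0.
rewrite -sqrtr_sqr ler_wsqrtr// !mxE (bigD1 i)//= lerDl sumr_ge0// => j _.
exact: sqr_ge0.
Qed.

End RowNorm.

Section FiniteCovers.
Context {R : realType}.

(** The diameters are bounded by positive numbers, which keeps powers of [0] out of the way. No mesh
    is recorded: for a positive exponent a small sum forces small diameters. *)
Definition fin_cover {m} (s e : R) (A : set 'rV[R]_m) := exists (I : finType) (F : I -> set 'rV[R]_m) (d : I -> R),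
  [/\ A `<=` \bigcup_i F i, (forall i, 0 < d i),
      (forall i x y, F i x -> F i y -> `|x - y| <= d i) &
      \sum_i d i `^ s <= e].

Definition fin_null {m} (s : R) (A : set 'rV[R]_m) := forall e : R, 0 < e -> fin_cover s e A.

Lemma subset_fin_cover m s e (A B : set 'rV[R]_m) : A `<=` B -> fin_cover s e B ->
  fin_cover s e A.
Proof.
move=> AB [I [F [d [BF d0 Fd de]]]].
by exists I, F, d; split => //; exact: subset_trans BF.
Qed.

Lemma subset_fin_null m s (A B : set 'rV[R]_m) : A `<=` B -> fin_null s B ->
  fin_null s A.
Proof.
by move=> AB Bs e e0; apply: subset_fin_cover AB _; exact: Bs.
Qed.

Lemma fin_coverU m s e e' (A B : set 'rV[R]_m) : fin_cover s e A -> fin_cover s e' B ->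
  fin_cover s (e + e') (A `|` B).
Proof.
move=> [I [F [d [AF d0 Fd de]]]] [J [G [d' [BG d'0 Gd de']]]].
exists (I + J)%type, (fun k => match k with inl i => F i | inr j => G j end),
  (fun k => match k with inl i => d i | inr j => d' j end); split.
- move=> x [/AF[i _ Fx]|/BG[j _ Gx]]; first by exists (inl i).
  by exists (inr j).
- by case.
- by case=> k x y; [exact: Fd|exact: Gd].
- by rewrite big_sumType /= lerD.
Qed.

Lemma fin_nullU m s (A B : set 'rV[R]_m) : fin_null s A -> fin_null s B ->
  fin_null s (A `|` B).
Proof.
move=> As Bs e e0; have e20 : 0 < e / 2 by rewrite divr_gt0.
by rewrite (splitr e); apply: fin_coverU; [exact: As|exact: Bs].
Qed.

Lemma fin_cover_image m m' s e (A : set 'rV[R]_m) (f : 'rV[R]_m -> 'rV[R]_m') C :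
  0 < C -> (forall x y, A x -> A y -> `|f x - f y| <= C * `|x - y|) ->
  fin_cover s (e / C `^ s) A -> fin_cover s e (f @` A).
Proof.
move=> C0 fC [I [F [d [AF d0 Fd de]]]].
exists I, (fun i => f @` (A `&` F i)), (fun i => C * d i); split.
- move=> _ [x Ax <-]; have [i _ Fx] := AF x Ax.
  by exists i => //; exists x.
- by move=> i; rewrite mulr_gt0.
- move=> i _ _ [x [Ax Fx] <-] [y [Ay Fy] <-].
  by rewrite (le_trans (fC _ _ Ax Ay))// ler_wpM2l ?(ltW C0)//; exact: Fd.
- rewrite (eq_bigr (fun i => C `^ s * d i `^ s)); last first.
    by move=> i _; rewrite powRM// ltW.
  by rewrite -mulr_sumr mulrC -ler_pdivlMr// powR_gt0.
Qed.

Lemma fin_null_image m m' s (A : set 'rV[R]_m) (f : 'rV[R]_m -> 'rV[R]_m') C :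
  (forall x y, A x -> A y -> `|f x - f y| <= C * `|x - y|) ->
  fin_null s A -> fin_null s (f @` A).
Proof.
move=> fC As e e0; have C0 : 0 < `|C| + 1 by rewrite ltr_wpDl.
apply: (fin_cover_image C0); last by apply: As; rewrite divr_gt0// powR_gt0.
move=> x y Ax Ay; rewrite (le_trans (fC _ _ Ax Ay))// ler_wpM2r//.
by rewrite (le_trans (ler_norm _))// lerDl.
Qed.

(** The intervals have one common length [d], so that their products with the cells of a grid of
    mesh [d] are cubes. The bound [d <= 1] lets a segment of length [2 * r] be cut into at most
    [(2 * r + 1) / d] cells. *)
Definition box_cover (s e : R) (P : set R) := exists (d : R) (cs : seq R), [/\ 0 < d <= 1,
    (forall x, P x -> exists2 c, c \in cs & c <= x <= c + d) &
    (size cs)%:R * d `^ s <= e].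

Definition box_null (s : R) (P : set R) := forall e : R, 0 < e -> box_cover s e P.

Lemma box_null0 s : 0 < s -> box_null s [set 0].
Proof.
move=> s0 e e0; exists (Num.min 1 (e `^ s^-1)), [:: 0]; split.
- by rewrite lt_min ltr01 powR_gt0//= ge_min lexx.
- by move=> _ ->; exists 0; rewrite ?mem_head// add0r lexx /= le_min ler01 powR_ge0.
- rewrite mul1r /=; apply: (@le_trans _ _ ((e `^ s^-1) `^ s)).
    by apply: ge0_ler_powR; rewrite ?nnegrE ?(ltW s0)// ?powR_ge0 ?le_min ?ler01 ?powR_ge0// ge_min lexx orbT.
  by rewrite -powRrM mulVf ?gt_eqF// powRr1// ltW.
Qed.

Definition slab {m} (i0 : 'I_m) (P : set R) (r : R) : set 'rV[R]_m :=
  [set x | P (x 0 i0) /\ forall i, `|x 0 i| <= r].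

(** The cubes are products of an interval of the cover with cells of a grid in the other [m.-1]
    coordinates. They number at most [size cs] times the power [m.-1] of [(2 * r + 1) / d], and the
    powers of [d] cancel. *)
Lemma fin_cover_slab m (i0 : 'I_m) (P : set R) r s e : 0 < r -> 0 < e ->
  box_cover s (e / (2 * r + 1) ^+ m.-1) P -> fin_cover (s + m.-1%:R) e (slab i0 P r).
Proof.
move=> r0 e0 [d [cs [/andP[d0 d1] Pcs de]]].
have C0 : 0 < (2 * r + 1) ^+ m.-1 by rewrite exprn_gt0// addr_gt0// mulr_gt0.
pose K := `|Num.floor (2 * r / d)|%N.
have fl0 : 0 <= 2 * r / d by rewrite divr_ge0 ?mulr_ge0 ?ltW.
have KE : K%:R = (Num.floor (2 * r / d))%:~R :> R.
  by rewrite /K natr_absz ger0_norm// floor_ge0.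
have cellP (x : R) : `|x| <= r -> exists k : 'I_K.+1,
    - r + k%:R * d <= x <= - r + k%:R * d + d.
  rewrite ler_norml => /andP[rx xr].
  pose k := `|Num.floor ((x + r) / d)|%N.
  have xr0 : 0 <= (x + r) / d by apply: divr_ge0; [lra|exact: ltW].
  have kE : k%:R = (Num.floor ((x + r) / d))%:~R :> R.
    by rewrite /k natr_absz ger0_norm// floor_ge0.
  have kd : k%:R * d <= x + r by rewrite kE -ler_pdivlMr// floor_le_tmp.
  have kd1 : x + r < (k%:R + 1) * d.
    by rewrite kE -ltr_pdivrMr// -intrD1 floorD1_gt.
  have kK : (k < K.+1)%N.
    rewrite ltnS -(ler_nat R) kE KE ler_int; apply: le_floor.
    by rewrite ler_pM2r ?invr_gt0//; move: xr; lra.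
  by exists (Ordinal kK) => /=; rewrite mulrDl mul1r in kd1; apply/andP; split; lra.
(* Cell functions are pinned to [ord0] at the distinguished index, so that they number [K.+1 ^ m.-1]
   and not [K.+1 ^ m]. *)
pose I := {x : 'I_(size cs) * {ffun 'I_m -> 'I_K.+1} |
   x.2 \in pffun_on ord0 (predC1 i0) predT}.
pose F (i : I) : set 'rV[R]_m := [set x | 
   (nth 0 cs (val i).1 <= x 0 i0 <= nth 0 cs (val i).1 + d) /\
   forall j, j != i0 -> - r + ((val i).2 j)%:R * d <= x 0 j <= - r + ((val i).2 j)%:R * d + d].
exists I, F, (fun=> d); split => //.
- move=> x [Px xr]; have [c ccs xc] := Pcs _ Px.
  have ic : (index c cs < size cs)%N by rewrite index_mem.
  pose g : {ffun 'I_m -> 'I_K.+1} :=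
    [ffun j => if j == i0 then ord0 else sval (cid (cellP _ (xr j)))].
  have gI : (Ordinal ic, g).2 \in pffun_on ord0 (predC1 i0) predT.
    apply/pffun_onP; split => //; apply/supportP => j /=.
    by rewrite inE negbK ffunE => ->.
  pose k : I := exist _ (Ordinal ic, g) gI.
  exists k => //; split=> [|j ji]; first by rewrite /= nth_index.
  by rewrite /= ffunE (negbTE ji); exact: (svalP (cid (cellP _ (xr j)))).
- move=> i x y [x0 xj] [y0 yj]; apply: normr_rV_le => [|j]; first exact: ltW.
  rewrite !mxE ler_norml; have [->|ji] := eqVneq j i0.
    by move: x0 y0; lra.
  by move: (xj _ ji) (yj _ ji); lra.
- rewrite sumr_const card_sig -[leLHS]mulr_natl.
  set N := #|_|; have -> : N = (size cs * K.+1 ^ m.-1)%N.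
    have -> : N = #|[predX 'I_(size cs) & pffun_on (@ord0 K) (predC1 i0) predT]|.
      by apply: eq_card => p; rewrite !inE.
    by rewrite cardX card_pffun_on cardC1 !card_ord.
  rewrite powRD; last by rewrite (gt_eqF d0) implybT.
  rewrite powR_mulrn ?(ltW d0)// natrM natrX.
  rewrite mulrACA -exprMn.
  apply: le_trans (_ : (e / (2 * r + 1) ^+ m.-1) * (2 * r + 1) ^+ m.-1 <= _); last first.
    by rewrite divfK// gt_eqF.
  apply: ler_pM => //; first by rewrite mulr_ge0 ?powR_ge0.
    by rewrite exprn_ge0// mulr_ge0// ltW.
  rewrite lerXn2r ?nnegrE//; [by rewrite mulr_ge0// ltW|by rewrite addr_ge0 ?mulr_ge0 ?ltW|].
  rewrite -natr1 mulrDl mul1r lerD// KE -ler_pdivlMr//.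
  by rewrite floor_le_tmp.
Qed.

Lemma fin_null_slab m (i0 : 'I_m) (P : set R) r s : box_null s P ->
  fin_null (s + m.-1%:R) (slab i0 P r).
Proof.
move=> Ps e e0; apply: (@subset_fin_cover _ _ _ _ (slab i0 P (`|r| + 1))).
  move=> x [Px xr]; split=> // i; rewrite (le_trans (xr i))//.
  by rewrite (le_trans (ler_norm _))// lerDl.
have r0 : 0 < `|r| + 1 by rewrite ltr_wpDl.
apply: fin_cover_slab => //; apply: Ps.
by rewrite divr_gt0// exprn_gt0// addr_gt0// mulr_gt0.
Qed.

(* The hypothesis says that [A] is a Lipschitz graph over its projection. *)
Lemma fin_null_graph m (i0 : 'I_m) (A : set 'rV[R]_m) r L s : 0 < s ->
  (forall x, A x -> forall i, `|x 0 i| <= r) ->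
  (forall x y c, A x -> A y -> (forall i, i != i0 -> `|x 0 i - y 0 i| <= c) ->
     0 <= c -> `|x 0 i0 - y 0 i0| <= L * c) ->
  fin_null (s + m.-1%:R) A.
Proof.
move=> s0 Ar AL.
have [->|/set0P[z0 Az0]] := eqVneq A set0.
  move=> e e0; exists void, (fun=> set0), (fun=> 1); split => //; try by case.
  by rewrite big1 ?ltW// => -[].
(* The projection stays in the same space, with the coordinate [i0] replaced by [0]; its image lies
   in a slab over [[set 0]], which is null for every positive exponent. *)
pose pr (x : 'rV[R]_m) : 'rV[R]_m := \row_i (if i == i0 then 0 else x 0 i).
pose A' := pr @` A.
pose f q := get [set x | A x /\ pr x = q].
have fP q : A' q -> A (f q) /\ pr (f q) = q.
  move=> [x Ax xq]; rewrite /f; case: xgetP => [y _ //|/(_ x) []].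
  by split.
have Af : A `<=` f @` A'.
  move=> x Ax; have A'x : A' (pr x) by exists x.
  exists (pr x) => //; have [Afx prx] := fP _ A'x.
  apply/rowP => i; have [->|ii0] := eqVneq i i0; last first.
    by have /rowP/(_ i) := prx; rewrite !mxE (negbTE ii0).
  apply/eqP; rewrite -subr_eq0 -normr_le0 -(mulr0 L); apply: AL => // j ji0.
  by have /rowP/(_ j) := prx; rewrite !mxE (negbTE ji0) => ->; rewrite subrr normr0.
apply: (subset_fin_null Af).
apply: (@fin_null_image _ _ _ _ _ (Num.max 1 L)).
- move=> p q A'p A'q; have [Ap Ep] := fP p A'p; have [Aq Eq] := fP q A'q.
  apply: normr_rV_le => [|i]; first by rewrite mulr_ge0// le_max ler01.
  have H j : j != i0 -> `|f p 0 j - f q 0 j| <= `|p - q|.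
    move=> ji; have := normr_coord (p - q) j; rewrite !mxE.
    have -> : p 0 j = f p 0 j by rewrite -[in LHS]Ep !mxE (negbTE ji).
    by have -> : q 0 j = f q 0 j by rewrite -[in LHS]Eq !mxE (negbTE ji).
  rewrite !mxE; have [->|ii0] := eqVneq i i0.
    apply: le_trans (AL _ _ _ Ap Aq H (normr_ge0 _)) _.
    by rewrite ler_wpM2r// le_max lexx orbT.
  by rewrite (le_trans (H _ ii0))// ler_peMl// le_max lexx.
- apply: (@subset_fin_null _ _ _ (slab i0 [set 0] `|r|)); last first.
    exact/fin_null_slab/box_null0.
  move=> _ [x Ax <-]; split=> /= [|i]; first by rewrite mxE eqxx.
  rewrite mxE; case: ifPn => _; first by rewrite normr0.
  by rewrite (le_trans (Ar x Ax i))// ler_norm.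
Qed.

End FiniteCovers.

Section HausdorffUpper.
Context {R : realType} {m : nat}.
Implicit Types (A F : set 'rV[R]_m) (s d : R).

Lemma diam_le F d : 0 <= d -> (forall x y, F x -> F y -> `|x - y| <= d) ->
  (diam F <= (m%:R * d)%:E)%E.
Proof.
move=> d0 Fd; apply: ge_ereal_sup => _ [[x y] /= [Fx Fy] <-].
by rewrite lee_fin (le_trans (edist_le _ _))// ler_wpM2l// Fd.
Qed.

Lemma diam_ge0 F : F !=set0 -> (0 <= diam F)%E.
Proof.
move=> [x Fx]; apply: ereal_sup_ubound; exists (x, x); first by split.
congr (_%:E); rewrite /Defs.edist big1 ?sqrtr0// => i _.
by rewrite subrr expr0n.
Qed.

Lemma hausdorff_gauge_ge0 s F : (0 <= hausdorff_gauge s F)%E.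
Proof. by rewrite /hausdorff_gauge; case: ifPn => // _; exact: poweR_ge0. Qed.

Lemma hausdorff_gauge_le F d s : 0 < s -> 0 < d ->
  (forall x y, F x -> F y -> `|x - y| <= d) ->
  (hausdorff_gauge s F <= (m%:R `^ s * d `^ s)%:E)%E.
Proof.
move=> s0 d0 Fd; rewrite /hausdorff_gauge; case: ifPn => [_|/set0P F0].
  by rewrite lee_fin mulr_ge0// powR_ge0.
rewrite -powRM// ?(ltW d0)// -poweR_EFin.
apply: gt0_ler_poweR; first exact: ltW.
- by rewrite in_itv /= leey andbT diam_ge0.
- by rewrite in_itv /= leey andbT lee_fin mulr_ge0// ltW.
- by apply: diam_le => //; exact: ltW.
Qed.

Lemma fin_null_premeasure s d A : 0 < s -> 0 < d -> fin_null s A ->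
  hausdorff_premeasure s d A = 0%E.
Proof.
move=> s0 d0 As.
apply/eqP; rewrite eq_le; apply/andP; split; last first.
  apply: le_ereal_inf_tmp => _ [F _ <-]; apply: nneseries_ge0 => k _ _.
  exact: hausdorff_gauge_ge0.
apply/lee_addgt0Pr => e e0; rewrite add0e.
pose M : R := (m%:R + 1).
have M0 : 0 < M by rewrite ltr_wpDl.
(* The first entry absorbs the passage from the sup norm to Euclidean diameters; the second forces
   [r i <= d / M], so that the cover is admissible at scale [d]. *)
pose e1 := Num.min (e / M `^ s) ((d / M) `^ s).
have e10 : 0 < e1.
  by rewrite lt_min divr_gt0 ?powR_gt0// divr_gt0.
have [I [F [r [AF r0 Fr re]]]] := As e1 e10.
have rd i : r i <= d / M.
  rewrite leNgt; apply/negP => dr.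
  have : (d / M) `^ s < r i `^ s.
    by apply: gt0_ltr_powR; rewrite ?nnegrE// ?ltW// divr_gt0.
  apply/negP; rewrite -leNgt (le_trans _ (le_trans re _)) ?ge_min ?lexx ?orbT//.
  by rewrite (bigD1 i)//= lerDl sumr_ge0// => j _; exact: powR_ge0.
(* The finite cover is continued to a sequence by empty sets, whose gauge is [0] by convention. *)
pose G (k : nat) : set 'rV[R]_m := if [pick i : I | enum_rank i == k :> nat] is Some i
   then F i else set0.
have GE (i : I) : G (enum_rank i) = F i.
  rewrite /G; case: pickP => [j /eqP/val_inj/enum_rank_inj ->//|/(_ i)].
  by rewrite eqxx.
have G0 k : (#|I| <= k)%N -> G k = set0.
  rewrite /G; case: pickP => // i /eqP <-.
  by rewrite leqNgt ltn_ord.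
have sumE : (\sum_(0 <= k <oo) hausdorff_gauge s (G k) =
    \sum_(i : I) hausdorff_gauge s (F i))%E.
  rewrite (nneseries_split 0 #|I|); last by move=> k _; exact: hausdorff_gauge_ge0.
  rewrite add0n eseries0; last first.
    by move=> k Ik _; rewrite G0// /hausdorff_gauge eqxx.
  rewrite adde0 big_mkord (reindex (@enum_rank I)); last exact/onW_bij/enum_rank_bij.
  by apply: eq_bigr => i _; rewrite GE.
apply: (@le_trans _ _ (\sum_(0 <= k <oo) hausdorff_gauge s (G k))%E).
  apply: ereal_inf_lbound; exists G => //; split=> [x /AF[i _ Fx]|k].
    by exists (enum_rank i) => //; rewrite GE.
  rewrite /G; case: pickP => [i _|_]; last first.
    by apply: ge_ereal_sup => y [p [p0 _] _].
  apply: (le_trans (diam_le (ltW (r0 i)) (Fr i))); rewrite lee_fin.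
  apply: (@le_trans _ _ (M * r i)); first by rewrite ler_wpM2r ?lerDl// ltW.
  by rewrite mulrC -ler_pdivlMr.
rewrite sumE; apply: (@le_trans _ _ (\sum_(i : I) (m%:R `^ s * r i `^ s)%:E)%E).
  by apply: lee_sum => i _; exact: (hausdorff_gauge_le s0 (r0 i) (Fr i)).
rewrite sumEFin lee_fin -mulr_sumr.
apply: (@le_trans _ _ (M `^ s * (e / M `^ s))); last first.
  by rewrite mulrC divfK// gt_eqF// powR_gt0.
apply: ler_pM; rewrite ?powR_ge0//.
- by rewrite sumr_ge0// => i _; exact: powR_ge0.
- by apply: ge0_ler_powR; rewrite ?nnegrE ?(ltW s0) ?(ltW M0)// lerDl.
- by rewrite (le_trans re)// ge_min lexx.
Qed.

Lemma hausdorff_dim_le (D : R) A : 0 <= D -> (forall s, D < s -> fin_null s A) ->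
  (hausdorff_dim A <= D%:E)%E.
Proof.
move=> D0 As; apply/lee_addgt0Pr => e e0; apply: ereal_inf_lbound.
exists (D + e) => //; have De0 : 0 < D + e by rewrite ltr_wpDl.
split; first exact: ltW.
apply/eqP; rewrite eq_le; apply/andP; split.
  apply: ge_ereal_sup => _ [d d0 <-].
  by rewrite fin_null_premeasure//; apply: As; rewrite ltrDl.
apply: (@le_trans _ _ (hausdorff_premeasure (D + e) 1 A)).
  by rewrite fin_null_premeasure//; apply: As; rewrite ltrDl.
by apply: ereal_sup_ubound; exists 1 => //=; exact: ltr01.
Qed.

End HausdorffUpper.

(** * Lower bounds by comparing volumes *)

Section BoxVolume.
Context {R : realType}.
Implicit Types (c : nat -> R) (p l : nat -> nat -> R).

Let ind (a b x : R) : R := (a <= x <= a + b)%R%:R.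

(** Countable subadditivity of volume for boxes covering the unit cube, proved with one-dimensional
    measure alone. The weights [c k] carry the induction: fixing the last coordinate turns its
    indicator into a weight, and integrating over that coordinate restores the length. Points are
    functions on [nat] so that the dimension can vary without casts. *)
Lemma box_volume m c p l : (forall k, 0 <= c k) -> (forall k i, 0 <= l k i) ->
  (forall x : nat -> R, (forall i, (i < m)%N -> 0 <= x i < 1) ->
    (1 <= \sum_(0 <= k <oo) (c k * \prod_(i < m) ind (p k i) (l k i) (x i))%:E)%E) ->
  (1 <= \sum_(0 <= k <oo) (c k * \prod_(i < m) l k i)%:E)%E.
Proof.
elim: m c => [|m IH] c c0 l0 H.
  have := H (fun=> 0) (fun i (h : (i < 0)%N) => ltac:(by [])).
  by under eq_eseriesr do rewrite big_ord0; under [X in _ -> (_ <= X)%E]eq_eseriesr do rewrite big_ord0.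
pose g k (y : R) : \bar R := ((c k * \prod_(i < m) l k i)%:E * (\1_(`[p k m, p k m + l k m]%classic) y)%:E)%E.
have K0 k : 0 <= c k * \prod_(i < m) l k i by rewrite mulr_ge0// prodr_ge0.
have g0 k y : (0 <= g k y)%E by rewrite /g -EFinM lee_fin mulr_ge0// indicE.
have gm k : measurable_fun (`[0, 1[%classic : set R) (g k).
  apply: emeasurable_funM; first exact: measurable_cst.
  exact/measurable_EFinP/measurable_indic.
have slice y : 0 <= y < 1 -> (1 <= \sum_(0 <= k <oo) g k y)%E.
  move=> y01.
  have -> : (\sum_(0 <= k <oo) g k y = \sum_(0 <= k <oo)
      (c k * ind (p k m) (l k m) y * \prod_(i < m) l k i)%:E)%E.
    apply: eq_eseriesr => k _; rewrite /g -EFinM; congr (_%:E).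
    rewrite mulrAC; congr (_ * _ * _); rewrite indicE /ind.
    by rewrite mem_setE in_itv.
  apply: IH => // [k|x x01]; first by rewrite mulr_ge0.
  pose x' i := if i == m then y else x i.
  have x'01 i : (i < m.+1)%N -> 0 <= x' i < 1.
    rewrite /x'; case: eqVneq => // im; rewrite ltnS leq_eqVlt (negbTE im) /=; exact: x01.
  apply: le_trans (H x' x'01) _; rewrite le_eqVlt; apply/orP; left; apply/eqP.
  apply: eq_eseriesr => k _; rewrite big_ord_recr /= /x' eqxx mulrA mulrAC.
  congr (_ * _ * _)%:E; apply: eq_bigr => i _.
  by rewrite ltn_eqF.
pose D : set R := `[0, 1[%classic.
have mD : measurable D by exact: measurable_itv.
have D1 : @lebesgue_measure R D = 1%E.
  by rewrite lebesgue_measure_itv /= lte_fin ltr01 oppr0 adde0.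
have A : (1 <= \int[@lebesgue_measure R]_(y in D) (\sum_(0 <= k <oo) g k y))%E.
  rewrite -[leLHS]mul1e -[X in (1 * X)%E]D1 -integral_cst//.
  apply: ge0_le_integral => //.
  by apply: (@ge0_emeasurable_sum _ _ _ D g predT).
apply: (le_trans A); rewrite integral_nneseries//; apply: lee_nneseries => [k _ _|k _]; first exact: integral_ge0.
rewrite ge0_integralZl_EFin//; last first.
  exact/measurable_EFinP/measurable_indic.
rewrite integral_indic// big_ord_recr /= mulrA [leRHS]EFinM; apply: lee_wpmul2l; first by rewrite lee_fin.
apply: (@le_trans _ _ (lebesgue_measure (`[p k m, p k m + l k m]%classic : set R))).
  by apply: le_measure; rewrite ?inE//; exact: measurableI.
rewrite lebesgue_measure_itv /= lte_fin; case: ifPn => _; last by rewrite lee_fin.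
by rewrite -EFinB lee_fin addrAC subrr add0r.
Qed.

End BoxVolume.

Section HausdorffLower.
Context {R : realType} {m : nat}.
Implicit Types (A F : set 'rV[R]_m) (s d : R).

(* A cover of [A] pulls back to a cover of the unit cube by boxes, whose total
   volume is at least [1]. *)
Lemma hausdorff_measure_neq0 A (z : (nat -> R) -> 'rV[R]_m) (C : R) (a : nat -> R) s :
  0 <= C -> 0 < \sum_(i < m) a i -> 0 <= s <= \sum_(i < m) a i ->
  (forall i, 0 <= a i) ->
  (forall x, (forall i, (i < m)%N -> 0 <= x i < 1) -> A (z x)) ->
  (forall x y, (forall i, (i < m)%N -> 0 <= x i < 1) ->
    (forall i, (i < m)%N -> 0 <= y i < 1) -> `|z x - z y| <= 1 ->
    forall i, (i < m)%N -> `|x i - y i| <= C * `|z x - z y| `^ a i) ->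
  hausdorff_measure s A != 0%E.
Proof.
move=> C0 S0 /andP[s0 sS] a0 Az zC; apply/negP => /eqP As.
pose Q (x : nat -> R) := forall i, (i < m)%N -> 0 <= x i < 1.
have M0 : 0 < (2 * C + 1) ^+ m :> R by rewrite exprn_gt0// ltr_wpDl// mulr_ge0.
have : (((2 * C + 1) ^+ m)^-1%:E <= hausdorff_premeasure s 1 A)%E.
  apply: le_ereal_inf_tmp => _ [F [AF Fd] <-].
  pose ne k := `[< exists x, Q x /\ F k (z x) >].
  pose x0 k := get [set x | Q x /\ F k (z x)].
  have x0P k : ne k -> Q (x0 k) /\ F k (z (x0 k)).
    by move=> /asboolP[x xP]; rewrite /x0; case: xgetP => [y _ //|/(_ x)].
  pose d k := fine (diam (F k)).
  have dE k : ne k -> diam (F k) = (d k)%:E /\ 0 <= d k <= 1.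
    move=> /asboolP[x [_ Fx]]; have := Fd k.
    have : (0 <= diam (F k))%E by apply: diam_ge0; exists (z x).
    by rewrite /d; case: (diam _) => //= r; rewrite !lee_fin => -> ->.
  have dP k x y : ne k -> F k x -> F k y -> `|x - y| <= d k.
    move=> nek Fx Fy; apply: (le_trans (edist_ge x y)); rewrite -lee_fin.
    have [<- _] := dE k nek; apply: ereal_sup_ubound.
    by exists (x, y).
  pose c k : R := (ne k)%:R.
  (* Parameters whose images lie in [F k] differ in coordinate [i] by at most [C] times the power
     [a i] of [d k], so a box around the sample [x0 k] contains them all. The side has [2 * C + 1]
     in place of [2 * C] so that it can be inverted when [C = 0]. *)
  pose l k i := if ne k then (2 * C + 1) * d k `^ a i else 0.
  pose p k i := x0 k i - C * d k `^ a i.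
  have l0 k i : 0 <= l k i.
    by rewrite /l; case: ifP => // _; rewrite mulr_ge0 ?powR_ge0// addr_ge0// mulr_ge0.
  have := @box_volume R m c p l (fun k => ler0n _ _) l0.
  have cov (x : nat -> R) : Q x -> (1 <= \sum_(0 <= k <oo)
      (c k * \prod_(i < m) (p k i <= x i <= p k i + l k i)%R%:R)%:E)%E.
    move=> Qx; have [k _ Fk] := AF _ (Az x Qx).
    have nek : ne k by apply/asboolP; exists x.
    have [Q0 F0] := x0P k nek; have [_ /andP[d0 d1]] := dE k nek.
    apply: (@le_trans _ _ (\sum_(0 <= j < k.+1) (c j * \prod_(i < m) (p j i <= x i <= p j i + l j i)%R%:R)%:E)%E); last first.
      by apply: nneseries_lim_ge => j _ _; rewrite lee_fin mulr_ge0// prodr_ge0.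
    rewrite big_nat_recr //= -[leLHS]add0e; apply: leeD.
      by apply: sume_ge0 => j _; rewrite lee_fin mulr_ge0// prodr_ge0.
    rewrite /c nek mul1r lee_fin big1// => i _.
    have zz := dP k _ _ nek Fk F0.
    have := zC _ _ Qx Q0 (le_trans zz d1) i (ltn_ord i).
    have /(ler_wpM2l C0) h : `|z x - z (x0 k)| `^ a i <= d k `^ a i.
      by apply: ge0_ler_powR; rewrite ?nnegrE.
    move=> /le_trans /(_ h); rewrite ler_norml => /andP[h1 h2].
    have h3 : 0 <= d k `^ a i by rewrite powR_ge0.
    have -> // : (p k i <= x i <= p k i + l k i).
    by rewrite /p /l nek; apply/andP; split; lra.
  move=> /(_ cov) vol.
  rewrite -[leLHS]mule1; apply: (@le_trans _ _ (((2 * C + 1) ^+ m)^-1%:E *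
     \sum_(0 <= k <oo) (c k * \prod_(i < m) l k i)%:E)%E).
    by apply: lee_wpmul2l => //; rewrite lee_fin invr_ge0 ltW.
  rewrite -nneseriesZl; last by move=> k _; rewrite lee_fin mulr_ge0// prodr_ge0.
  apply: lee_nneseries => [k _ _|k _].
    by rewrite -EFinM lee_fin mulr_ge0 ?invr_ge0 ?(ltW M0)// mulr_ge0// prodr_ge0.
  rewrite /c; have [nek|] := boolP (ne k); last first.
    by rewrite mul0r mule0 hausdorff_gauge_ge0.
  have [dk /andP[d0 d1]] := dE k nek.
  have Fk0 : F k != set0.
    by apply/set0P; have /asboolP[x [_ Fx]] := nek; exists (z x).
  rewrite /hausdorff_gauge (negbTE Fk0) dk poweR_EFin -EFinM lee_fin mul1r.
  rewrite /l nek big_split /= prodr_const card_ord mulrA mulVf ?gt_eqF// mul1r.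
  have -> : \prod_(i < m) d k `^ a i = d k `^ (\sum_(i < m) a i).
    (* For [d k = 0] a factor with exponent [0] would be [1]; a nonzero exponent exists because the
       sum of the [a i] is positive. *)
    have [d00|d0'] := eqVneq (d k) 0.
      rewrite d00 powR0 ?gt_eqF//.
      have [i ai|ai] := pickP (fun i : 'I_m => a i != 0).
        by rewrite (bigD1 i)//= powR0// mul0r.
      by move: S0; rewrite big1 ?ltxx// => i _; have := ai i => /negbFE /eqP.
    elim/big_ind2 : _ => [|x1 y1 x2 y2 -> ->|i _ //]; first by rewrite powRr0.
    by rewrite powRD// d0' implybT.
  have [->|d0'] := eqVneq (d k) 0.
    by rewrite powR0 ?gt_eqF// powR_ge0.
  by apply: ger_powR => //; rewrite d1 andbT lt_neqAle eq_sym d0' d0.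
apply/negP; rewrite -ltNge.
have : (hausdorff_premeasure s 1 A <= hausdorff_measure s A)%E.
  by apply: ereal_sup_ubound; exists 1 => //=; exact: ltr01.
by rewrite As => /le_lt_trans; apply; rewrite lte_fin invr_gt0.
Qed.

End HausdorffLower.

(** * A Cantor set and the midpoints of its gaps *)

Section CantorNodes.
Context {R : realType}.
Variable alpha : R.
Hypothesis alpha01 : 0 < alpha <= 1.

Let alpha0 : 0 < alpha. Proof. by case/andP: alpha01. Qed.
Let ln20 : 0 < ln 2 :> R. Proof. by rewrite ln_gt0// ltr1n. Qed.

(** The contraction for which two copies give dimension [alpha]: the power [alpha] of [ratio] is
    [1 / 2]. *)
Definition ratio : R := expR (- (ln 2 / alpha)).

Lemma ratio_gt0 : 0 < ratio. Proof. exact: expR_gt0. Qed.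

Lemma expR_ln2 : expR (ln 2) = 2 :> R.
Proof. by rewrite lnK// posrE. Qed.

Lemma ratio_le : 2 * ratio <= 1.
Proof.
rewrite -ler_pdivlMl// mulr1 -expR_ln2 -expRN ler_expR lerN2.
by rewrite ler_pdivlMr// ler_piMr ?(ltW ln20)//; case/andP: alpha01.
Qed.

(* The factor [N.+1%:R^-1] keeps the gaps positive when [alpha = 1], where
   [2 * ratio = 1]. *)
Definition len (N : nat) : R := 2^-1 * ratio ^+ N / N.+1%:R.
Definition gap (N : nat) : R := len N - 2 * len N.+1.

Lemma len_gt0 N : 0 < len N.
Proof. by rewrite !mulr_gt0// ?invr_gt0 ?exprn_gt0 ?ratio_gt0// ltr0n. Qed.

Lemma len0 : len 0 = 2^-1. Proof. by rewrite /len expr0 mulr1 divr1. Qed.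

(** As [2 * ratio <= 1], the gap is at least [ratio ^+ N / 2] times [1 / (N + 1) - 1 / (N + 2)]: a
    polynomial loss, harmless for the dimension. *)
Lemma gap_ge N : 2^-1 * ratio ^+ N / N.+2%:R ^+ 2 <= gap N.
Proof.
rewrite /gap /len (exprS ratio).
have r0 := exprn_gt0 N ratio_gt0; move: (ratio ^+ N) r0 => r r0.
have n1 : 0 < N.+1%:R :> R by rewrite ltr0n.
have n2E : N.+2%:R = N.+1%:R + 1 :> R by rewrite natr1.
rewrite n2E; move: (N.+1%:R : R) n1 => n n0.
have -> : 2^-1 * r / n - 2 * (2^-1 * (ratio * r) / (n + 1)) =
   2^-1 * r * (n^-1 - (2 * ratio) / (n + 1)).
  by field; rewrite !gt_eqF// addr_gt0.
rewrite ler_pM2l ?mulr_gt0//.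
apply: (@le_trans _ _ (n^-1 - (n + 1)^-1)); last first.
  by rewrite lerB// ler_piMl ?ratio_le// invr_ge0 ltW// addr_gt0.
have -> : n^-1 - (n + 1)^-1 = (n * (n + 1))^-1.
  by field; rewrite !gt_eqF// addr_gt0.
rewrite lef_pV2 ?posrE ?exprn_gt0 ?mulr_gt0 ?addr_gt0// expr2 ler_pM2r ?addr_gt0//.
by rewrite lerDl.
Qed.

Lemma gap_gt0 N : 0 < gap N.
Proof.
apply: lt_le_trans (gap_ge N).
by rewrite divr_gt0 ?exprn_gt0 ?ltr0n// mulr_gt0// exprn_gt0// ratio_gt0.
Qed.

Lemma gap_le N : gap N <= len N.
Proof. by rewrite gerBl mulr_ge0// ltW// len_gt0. Qed.

Lemma len_le N M : (N <= M)%N -> len M <= len N.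
Proof.
elim: M => [|M IH]; first by rewrite leqn0 => /eqP ->.
rewrite leq_eqVlt => /predU1P[->//|NM]; apply: le_trans (IH NM).
by have := gap_gt0 M; have := len_gt0 M.+1; rewrite /gap; lra.
Qed.

(* The interval of level [N] numbered [j < 2 ^ N] starts at [left_end N j]; its
   parent is numbered [j./2]. *)
Fixpoint left_end (N j : nat) : R :=
  if N is N'.+1 then left_end N' j./2 + (odd j)%:R * (len N' - len N'.+1)
  else 0.

Arguments left_end : simpl never.

Lemma left_endS N j : left_end N.+1 j = left_end N j./2 + (odd j)%:R * (len N - len N.+1).
Proof. by []. Qed.

Lemma left_end_nested1 N j : left_end N j./2 <= left_end N.+1 j /\
  left_end N.+1 j + len N.+1 <= left_end N j./2 + len N.
Proof.
rewrite left_endS; have := gap_gt0 N; have := len_gt0 N.+1; rewrite /gap.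
by case: (odd j) => /=; rewrite ?mul0r ?mul1r; split; lra.
Qed.

Lemma left_end_nested N k j : left_end N (iter k half j) <= left_end (k + N) j /\
  left_end (k + N) j + len (k + N) <= left_end N (iter k half j) + len N.
Proof.
elim: k j => [|k IH] j //; rewrite iterSr addSn.
have [h1 h2] := IH j./2; have [h3 h4] := left_end_nested1 (k + N) j.
by split; [exact: le_trans h3|exact: le_trans h2].
Qed.

Lemma left_end_lt N i j : (i < j < 2 ^ N)%N -> left_end N i + len N <= left_end N j.
Proof.
elim: N i j => [|N IH] i j; first by rewrite expn0 ltnS leqn0 => /andP[/[swap] /eqP ->].
rewrite expnS => /andP[ij jN].
have [ij2|ij2] := ltnP i./2 j./2.
  have : left_end N i./2 + len N <= left_end N j./2 by apply: IH; lia.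
  have [_ h1] := left_end_nested1 N i; have [h2 _] := left_end_nested1 N j.
  lra.
have e2 : i./2 = j./2 by lia.
have [oi oj] : odd i = false /\ odd j = true by lia.
rewrite !left_endS e2 oi oj mul0r mul1r; have := gap_gt0 N; rewrite /gap; lra.
Qed.

Lemma iter_half_lt N k j : (j < 2 ^ (k + N))%N -> (iter k half j < 2 ^ N)%N.
Proof.
elim: k j => [|k IH] j //; rewrite iterSr addSn expnS => jk; apply: IH; lia.
Qed.

Definition mid N j := left_end N j + len N / 2.

(** [iter k half j] numbers the ancestor of level [N], whose interval contains the whole gap removed
    below it. *)
Lemma mid_in N k j : left_end N (iter k half j) <= mid (k + N) j - gap (k + N) / 2 /\
  mid (k + N) j + gap (k + N) / 2 <= left_end N (iter k half j) + len N.
Proof.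
have [h1 h2] := left_end_nested N k j; have := gap_le (k + N).
have := gap_gt0 (k + N).
by rewrite /mid; split; lra.
Qed.

(** The deeper gap lies inside one interval of level [N.+1]. That interval is either at or before
    the child [i.*2] or at or after the child [i.*2.+1], so it is on one side of the gap between
    them. *)
Lemma mid_sep_lt N M i j : (N < M)%N -> (i < 2 ^ N)%N -> (j < 2 ^ M)%N ->
  (gap N + gap M) / 2 <= `|mid N i - mid M j|.
Proof.
move=> NM iN jM; have [k Mk] : exists k, M = (k + N.+1)%N by exists (M - N.+1)%N; lia.
rewrite Mk in jM *; have [h1 h2] := mid_in N.+1 k j.
have a2 := iter_half_lt jM; set a := iter k half j in h1 h2 a2.
have gN : gap N = len N - 2 * len N.+1 by [].
have [ai|ai] := leqP a i.*2.
  have h3 : left_end N.+1 a <= left_end N.+1 i.*2.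
    move: ai; rewrite leq_eqVlt => /predU1P[->//|ai].
    have := @left_end_lt N.+1 a i.*2; rewrite ai expnS => /(_ ltac:(lia)).
    have := len_gt0 N.+1; lra.
  rewrite (left_endS N i.*2) odd_double mul0r doubleK in h3.
  rewrite ger0_norm; rewrite /mid in h1 h2 *; have := gap_gt0 (k + N.+1); have := gap_gt0 N; lra.
have h3 : left_end N.+1 i.*2.+1 <= left_end N.+1 a.
  move: ai; rewrite leq_eqVlt => /predU1P[->//|ai].
  have := @left_end_lt N.+1 i.*2.+1 a; rewrite ai a2 => /(_ isT).
  have := len_gt0 N.+1; lra.
rewrite (left_endS N i.*2.+1) /= odd_double mul1r uphalf_double in h3.
rewrite ler0_norm; rewrite /mid in h1 h2 *; have := gap_gt0 (k + N.+1); have := gap_gt0 N; lra.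
Qed.

Lemma mid_sep_eq N i j : (i < j < 2 ^ N)%N -> gap N <= `|mid N i - mid N j|.
Proof.
move=> /left_end_lt ij; have gl := gap_le N; have l0 := len_gt0 N.
by rewrite distrC ger0_norm /mid; lra.
Qed.

Lemma mid_sep N M i j : (N, i) != (M, j) -> (i < 2 ^ N)%N -> (j < 2 ^ M)%N ->
  (gap N + gap M) / 2 <= `|mid N i - mid M j|.
Proof.
move=> NM iN jM; have [NltM|MltN|eNM] := ltngtP N M.
- exact: mid_sep_lt.
- by rewrite distrC addrC; exact: mid_sep_lt.
rewrite -eNM in NM jM *; rewrite -mulr2n -[X in X / 2]mulr_natr mulfK//.
have [ij|ij|eij] := ltngtP i j.
- by apply: mid_sep_eq; rewrite ij.
- by rewrite distrC; apply: mid_sep_eq; rewrite ij.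
- by rewrite eij eqxx in NM.
Qed.

(** The gaps [(N, j)] with [j < 2 ^ N] are enumerated by [k.+1 = 2 ^ N + j], the heap order of a
    binary tree. *)
Definition level (k : nat) := trunc_log 2 k.+1.
Definition posit (k : nat) := (k.+1 - 2 ^ level k)%N.

Lemma level_bounds k : (2 ^ level k <= k.+1 < 2 ^ (level k).+1)%N.
Proof. exact: trunc_log_bounds. Qed.

Lemma posit_lt k : (posit k < 2 ^ level k)%N.
Proof. have := level_bounds k; rewrite /posit expnS; lia. Qed.

Lemma level_posit k : k.+1 = (2 ^ level k + posit k)%N.
Proof. have := level_bounds k; rewrite /posit; lia. Qed.

Lemma level_ge N k : (2 ^ N <= k.+1)%N -> (N <= level k)%N.
Proof. by move=> Nk; rewrite /level trunc_log_max. Qed.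

Lemma level_posit_node N j : (j < 2 ^ N)%N ->
  level (2 ^ N + j).-1 = N /\ posit (2 ^ N + j).-1 = j.
Proof.
move=> jN; have N0 : (0 < 2 ^ N)%N by rewrite expn_gt0.
have lE : level (2 ^ N + j).-1 = N.
  apply: trunc_log_eq => //; rewrite expnS; lia.
by rewrite /posit lE; split=> //; lia.
Qed.

Definition dig (N : nat) (t : R) : nat := Num.truncn (2 ^+ N * t).

Lemma dig_bounds N t : 0 <= t -> (dig N t)%:R <= 2 ^+ N * t < (dig N t)%:R + 1.
Proof. by move=> t0; rewrite natr1 truncn_itv// mulr_ge0// exprn_ge0. Qed.

Lemma dig_lt N t : 0 <= t < 1 -> (dig N t < 2 ^ N)%N.
Proof.
move=> /andP[t0 t1]; rewrite truncn_lt_nat ?mulr_ge0 ?exprn_ge0//.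
by rewrite natrX gtr_pMr// exprn_gt0.
Qed.

Lemma dig_half N t : 0 <= t -> (dig N.+1 t)./2 = dig N t.
Proof.
move=> t0; apply/esym/eqP; rewrite truncn_eq ?mulr_ge0 ?exprn_ge0//.
have := dig_bounds N.+1 t0; set d := dig N.+1 t; rewrite exprS.
have : (d%:R = (odd d)%:R + 2 * (d./2)%:R :> R).
  by rewrite -{1}(odd_double_half d) natrD -muln2 natrM mulrC.
rewrite -natr1; case: (odd d) => /=; lra.
Qed.

Lemma dig_iter N k t : 0 <= t -> iter k half (dig (k + N) t) = dig N t.
Proof. by move=> t0; elim: k => // k IH; rewrite iterSr addSn dig_half. Qed.

(** The point of the Cantor set whose address is the binary expansion of [t]: the intervals numbered
    by the truncations of [t] are nested and shrink to it. *)
Definition branch (t : R) : R := sup [set left_end N (dig N t) | N in [set: nat]].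

Lemma left_dig_le N M t : 0 <= t ->
  left_end N (dig N t) <= left_end M (dig M t) + len M.
Proof.
move=> t0; have [NM|/ltnW MN] := leqP N M.
  have [k ->] : exists k, M = (k + N)%N by exists (M - N)%N; rewrite subnK.
  have [h1 _] := left_end_nested N k (dig (k + N) t).
  by rewrite dig_iter// in h1; have := len_gt0 (k + N); lra.
have [k ->] : exists k, N = (k + M)%N by exists (N - M)%N; rewrite subnK.
have [_ h1] := left_end_nested M k (dig (k + M) t).
by rewrite dig_iter// in h1; have := len_gt0 (k + M); lra.
Qed.

Lemma branch_bounds N t : 0 <= t ->
  left_end N (dig N t) <= branch t <= left_end N (dig N t) + len N.
Proof.
move=> t0; apply/andP; split.
  apply: ub_le_sup; last by exists N.
  by exists (left_end 0 (dig 0 t) + len 0) => _ [M _ <-]; exact: left_dig_le.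
apply: ge_sup; first by exists (left_end 0 (dig 0 t)), 0%N.
by move=> _ [M _ <-]; exact: left_dig_le.
Qed.

Lemma len_bound N : len N <= ratio ^+ N.
Proof.
rewrite /len -[leRHS]mul1r -mulrAC ler_pM2r ?exprn_gt0 ?ratio_gt0//.
by rewrite mulr_ile1 ?invr_ge0// invf_le1// ?ler1n// ler1n.
Qed.

Lemma len_small e : 0 < e -> exists N, forall M, (N <= M)%N -> len M < e.
Proof.
move=> e0; have r1 : `|ratio| < 1.
  by rewrite gtr0_norm ?ratio_gt0//; have := ratio_le; have := ratio_gt0; lra.
have /cvgrPdist_lt /(_ e e0) [N _ NP] := cvg_expr r1.
exists N => M NM; apply: le_lt_trans (len_bound M) _.
by have := NP M NM; rewrite /= sub0r normrN gtr0_norm// exprn_gt0// ratio_gt0.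
Qed.

Definition center k := mid (level k) (posit k).
(** A pulse occupies the middle half of its gap. The margin of one [width] on either side leaves
    angles next to each center that no pulse meets. *)
Definition width k := gap (level k) / 4.

Definition accum (c : nat -> R) : set R :=
  [set x | forall e N, 0 < e -> exists2 k, (N <= k)%N & `|c k - x| < e].

Lemma width_gt0 k : 0 < width k.
Proof. by rewrite divr_gt0// gap_gt0. Qed.

Lemma center_itv k : 2 * width k <= center k <= 2^-1 - 2 * width k.
Proof.
have p := posit_lt k; have [] := mid_in 0 (level k) (posit k); rewrite addn0.
rewrite /left_end len0 add0r /center /width; set g := gap _; set c := mid _ _.
lra.
Qed.

Lemma center_sep k l : k != l -> 2 * (width k + width l) <= `|center k - center l|.
Proof.
move=> kl; have := @mid_sep (level k) (level l) (posit k) (posit l) _ (posit_lt k) (posit_lt l).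
have -> : (level k, posit k) != (level l, posit l).
  apply: contra kl; rewrite xpair_eqE => /andP[/eqP l1 /eqP p1].
  have hk := level_posit k; have hl := level_posit l.
  by rewrite l1 p1 -hl in hk; case: hk => ->.
by move=> /(_ isT); rewrite /width /center; lra.
Qed.

Lemma width_small e : 0 < e -> exists N, forall k, (N <= k)%N -> width k < e.
Proof.
move=> e0; have [N NP] := len_small e0; exists (2 ^ N)%N => k Nk.
have /NP : (N <= level k)%N by apply: level_ge; exact: leqW.
have := gap_le (level k); have := gap_gt0 (level k); rewrite /width; lra.
Qed.

Lemma branch_accum t : 0 <= t < 1 -> accum center (branch t).
Proof.
move=> t01 e N e0; have [t0 t1] := andP t01.
have [M MP] := len_small e0; pose K := maxn M N.
have dK := dig_lt K t01.
have [lE pE] := level_posit_node dK.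
exists (2 ^ K + dig K t).-1.
  have : (K < 2 ^ K)%N by exact: ltn_expl.
  rewrite /K; lia.
have /MP lK : (M <= K)%N by exact: leq_maxl.
rewrite /center lE pE /mid; have /andP[] := branch_bounds K t0.
have := len_gt0 K; rewrite ltr_norml; lra.
Qed.

(** Take the last level [N] at which the digits agree: both parameters lie in one dyadic interval of
    length [2 ^ (- N)], while the two points lie in different children of one interval, on opposite
    sides of its gap. *)
Lemma branch_sep t t' : 0 <= t < t' -> t' < 1 -> exists N,
  t' - t <= (2 ^+ N)^-1 /\ gap N <= branch t' - branch t.
Proof.
move=> /andP[t0 tt'] t'1; have t'0 : 0 <= t' by rewrite (le_trans t0)// ltW.
have t1 := lt_trans tt' t'1.
have neq : exists N, dig N t != dig N t'.
  have tt0 : 0 < t' - t by rewrite subr_gt0.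
  pose N := (Num.truncn (t' - t)^-1).+1; exists N.
  have hN : (t' - t)^-1 < 2 ^+ N.
    apply: lt_trans (truncnS_gt _) _; rewrite -natrX ltr_nat; exact: ltn_expl.
  apply/eqP => dE; have := dig_bounds N t0; have := dig_bounds N t'0; rewrite dE.
  have : 1 < 2 ^+ N * (t' - t) by rewrite -ltr_pdivrMr// mul1r.
  lra.
have dig0 (x : R) : 0 <= x < 1 -> dig 0 x = 0%N.
  by move=> /(dig_lt 0); rewrite expn0 ltnS leqn0 => /eqP.
case: (ex_minnP neq) => -[|N].
  by rewrite !dig0 ?t0 ?t'0 ?t1.
move=> dN /(_ N); rewrite ltnn => minN.
have eN : dig N t = dig N t' by apply/eqP/negPn/negP => /minN.
have le1 : (dig N.+1 t <= dig N.+1 t')%N by apply: le_truncn; rewrite ler_pM2l ?exprn_gt0// ltW.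
have h1 := dig_half N t0; have h2 := dig_half N t'0.
have [od1 od2] : odd (dig N.+1 t) = false /\ odd (dig N.+1 t') = true.
  by move: dN le1 h1 h2 eN => /eqP; lia.
exists N; split.
  rewrite -[leRHS]mul1r ler_pdivlMr ?exprn_gt0//.
  by have := dig_bounds N t0; have := dig_bounds N t'0; rewrite eN; lra.
have := branch_bounds N.+1 t0; have := branch_bounds N.+1 t'0.
rewrite !left_endS h1 h2 od1 od2 eN /= mul0r mul1r /gap; lra.
Qed.

(** The angles at which the frontier is not described by the first [K] pulses. *)
Definition tail (c w : nat -> R) (K : nat) : set R :=
  accum c `|` [set x | exists2 k, (K <= k)%N & `|x - c k| < w k].

Lemma tail_cover N x : tail center width (2 ^ N) x ->
  exists2 j, (j < 2 ^ N)%N & left_end N j - len N <= x <= left_end N j + 2 * len N.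
Proof.
move=> tx; have [k Nk kx] : exists2 k, (2 ^ N <= k)%N & `|center k - x| < len N.
  case: tx => [/(_ (len N) (2 ^ N)%N (len_gt0 N))//|[k Nk kx]]; exists k => //.
  have lk : (N <= level k)%N by apply: level_ge; exact: leqW.
  rewrite distrC (lt_le_trans kx)// /width.
  by have := gap_le (level k); have := len_le lk; have := len_gt0 (level k); lra.
have lk : (N <= level k)%N by apply: level_ge; exact: leqW.
have pk := posit_lt k.
have [h1 h2] := mid_in N (level k - N) (posit k).
rewrite -{1}(subnK lk) in pk; have ik := iter_half_lt pk.
rewrite subnK// in h1 h2; have := gap_gt0 (level k); have := len_gt0 N.
exists (iter (level k - N) half (posit k)) => //.
move: kx; rewrite /center ltr_norml; lra.
Qed.

Lemma exp_lt_bound (c : R) : 0 < c -> exists2 C, 0 < C &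
  forall N, expR (- (c * N%:R)) * N.+2%:R ^+ 2 <= C.
Proof.
move=> c0; exists (expR (2 * c) * (4 / c ^+ 2)).
  by rewrite mulr_gt0 ?expR_gt0// divr_gt0// exprn_gt0.
move=> N; pose y := c * N.+2%:R; have y0 : 0 < y by rewrite mulr_gt0.
have := @expR_bound R 2 y y0; rewrite -natrX => yb.
have -> : - (c * N%:R) = 2 * c - y by rewrite /y -addn2 natrD; ring.
rewrite expRD -mulrA ler_pM2l ?expR_gt0// ler_pdivlMr ?exprn_gt0//.
by rewrite -mulrA mulrC -exprMn (mulrC _ c).
Qed.

(** With [N] from [branch_sep], [t' - t] is at most [2 ^ (- N)] and the points are at least [gap N]
    apart, which is of order [2 ^ (- N / alpha)] up to a polynomial factor. An exponent [s < alpha]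
    leaves an exponential margin that absorbs this factor. *)
Lemma branch_expand s : 0 < s < alpha -> exists2 C, 0 <= C &
  forall t t', 0 <= t < 1 -> 0 <= t' < 1 -> `|t - t'| <= C * `|branch t - branch t'| `^ s.
Proof.
move=> /andP[s0 sa].
have s1 : s <= 1 by case/andP: alpha01 => _ a1; rewrite (le_trans _ a1)// ltW.
have c0 : 0 < ln 2 * (1 - s / alpha) :> R.
  by rewrite mulr_gt0// subr_gt0 ltr_pdivrMr// mul1r.
have [C C0 CP] := exp_lt_bound c0.
exists (2 * C); first by rewrite mulr_ge0// ltW.
have key N : (2 ^+ N)^-1 <= 2 * C * gap N `^ s.
  have e1 : (2 ^+ N)^-1 = expR (- (ln 2 * N%:R)) :> R.
    by rewrite expRN expRM_natr expR_ln2.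
  have low : 2^-1 * expR (- (ln 2 * N%:R * (s / alpha))) / N.+2%:R ^+ 2 <= gap N `^ s.
    apply: (@le_trans _ _ ((2^-1 * ratio ^+ N / N.+2%:R ^+ 2) `^ s)); last first.
      apply: ge0_ler_powR; rewrite ?nnegrE ?(ltW s0)//; last exact: gap_ge.
      - by rewrite !mulr_ge0 ?invr_ge0 ?exprn_ge0 ?(ltW ratio_gt0).
      - exact/ltW/gap_gt0.
    have r0 : 0 <= ratio ^+ N by rewrite exprn_ge0// ltW// ratio_gt0.
    have rs : (ratio ^+ N) `^ s = expR (- (ln 2 * N%:R * (s / alpha))).
      rewrite /ratio -expRM_natr -expRM; congr expR; field.
      by rewrite gt_eqF.
    have pE : (2^-1 * ratio ^+ N / N.+2%:R ^+ 2) `^ s =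
        2^-1 `^ s * (ratio ^+ N) `^ s * (N.+2%:R ^- 2) `^ s.
      rewrite powRM; [|by rewrite mulr_ge0|by rewrite invr_ge0 exprn_ge0].
      by rewrite powRM.
    rewrite pE rs.
    apply: ler_pM; rewrite ?mulr_ge0 ?expR_ge0 ?invr_ge0 ?exprn_ge0//.
      by rewrite ler_pM2r ?expR_gt0// ger1_powR// invr_gt0 ltr0n invf_le1// ler1n.
    apply: ger1_powR => //; rewrite invr_gt0 exprn_gt0 ?ltr0n// invf_le1 ?exprn_gt0 ?ltr0n//.
    by rewrite exprn_ege1// ler1n.
  apply: (@le_trans _ _ (2 * C * (2^-1 * expR (- (ln 2 * N%:R * (s / alpha))) / N.+2%:R ^+ 2))); last first.
    by rewrite ler_pM2l// mulr_gt0.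
  have -> : 2 * C * (2^-1 * expR (- (ln 2 * N%:R * (s / alpha))) / N.+2%:R ^+ 2)
     = C * expR (- (ln 2 * N%:R * (s / alpha))) / N.+2%:R ^+ 2.
    by move: (expR _) (N.+2%:R ^- 2) => X Z; field.
  rewrite ler_pdivlMr ?exprn_gt0 ?ltr0n// e1.
  have := CP N; rewrite -(ler_pM2r (expR_gt0 (- (ln 2 * N%:R * (s / alpha))))) mulrAC -expRD.
  suff -> : - (ln 2 * (1 - s / alpha) * N%:R) + - (ln 2 * N%:R * (s / alpha)) = - (ln 2 * N%:R) by [].
  by ring.
have main t t' : 0 <= t < t' -> t' < 1 -> t' - t <= 2 * C * (branch t' - branch t) `^ s.
  move=> tt' t'1; have [N [h1 h2]] := branch_sep tt' t'1.
  rewrite (le_trans h1)// (le_trans (key N))// ler_pM2l ?mulr_gt0//.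
  have g0 := gap_gt0 N.
  apply: ge0_ler_powR; rewrite ?nnegrE ?(ltW s0) ?(ltW g0)//.
  by rewrite (le_trans _ h2)// ltW.
have brl t t' : 0 <= t < t' -> t' < 1 -> branch t <= branch t'.
  move=> tt' t'1; have [N [h1 h2]] := branch_sep tt' t'1.
  by rewrite -subr_ge0 (le_trans _ h2)// ltW// gap_gt0.
move=> t t' /andP[t0 t1] /andP[t'0 t'1]; have [tt'|tt'|->] := ltgtP t t'.
- have := main t t'; have := brl t t'; rewrite t0 tt' => /(_ isT t'1) h1 /(_ isT t'1).
  by rewrite distrC (distrC (branch t)) !ger0_norm// subr_ge0// ltW.
- have := main t' t; have := brl t' t; rewrite t'0 tt' => /(_ isT t1) h1 /(_ isT t1).
  by rewrite !ger0_norm// subr_ge0// ltW.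
- by rewrite subrr normr0 !mulr_ge0 ?powR_ge0// ltW.
Qed.

(** At level [N] the tail is covered by [2 ^ N] intervals of length [3 * len N], and [r ^+ N] tends
    to [0] because [s > alpha] makes [r < 1]. *)
Lemma tail_box_cover s e : alpha < s -> 0 < e ->
  exists K, box_cover s e (tail center width K).
Proof.
move=> as_ e0; have s0 : 0 < s := lt_trans alpha0 as_.
pose r : R := 2 * ratio `^ s.
have r0 : 0 < r by rewrite mulr_gt0// powR_gt0// ratio_gt0.
have r1 : r < 1.
  have -> : r = expR (ln 2 * (1 - s / alpha)).
    rewrite mulrBr mulr1 expRD expR_ln2 /r /ratio -expRM; congr (_ * expR _).
    by field; rewrite gt_eqF.
  by rewrite expR_lt1 pmulr_rlt0// subr_lt0 ltr_pdivlMr// mul1r.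
have rn1 : `|r| < 1 by rewrite gtr0_norm.
have e30 : 0 < e / 3 `^ s by rewrite divr_gt0// powR_gt0.
have /cvgrPdist_lt /(_ _ e30) [N1 _ N1P] := cvg_expr rn1.
have [N2 N2P] := @len_small 3^-1 ltac:(by []).
pose N := maxn N1 N2.
have lN : len N < 3^-1 by apply: N2P; exact: leq_maxr.
have rN : r ^+ N < e / 3 `^ s.
  have := N1P N (leq_maxl _ _).
  by rewrite /= sub0r normrN gtr0_norm// exprn_gt0.
exists (2 ^ N)%N, (3 * len N), [seq left_end N j - len N | j <- iota 0 (2 ^ N)]; split.
- by have := len_gt0 N; lra.
- move=> x /tail_cover[j jN xj].
  exists (left_end N j - len N); last by move: xj; lra.
  by apply/mapP; exists j => //; rewrite mem_iota.
- rewrite size_map size_iota powRM ?(ltW (len_gt0 N))//.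
  have h : len N `^ s <= (ratio `^ s) ^+ N.
    rewrite -powR_mulrn ?powR_ge0// powRAC powR_mulrn ?(ltW ratio_gt0)//.
    apply: ge0_ler_powR; rewrite ?nnegrE ?(ltW s0) ?(ltW (len_gt0 N))//; last exact: len_bound.
    by rewrite exprn_ge0// ltW// ratio_gt0.
  rewrite natrX mulrCA -ler_pdivlMl ?powR_gt0// [leRHS]mulrC.
  by apply: le_trans (ltW rN); rewrite exprMn ler_pM2l// exprn_gt0.
Qed.

End CantorNodes.

(** * The generating function and its two maps *)

Lemma open_pos (R : realType) (m : nat) (F : 'rV[R]_m -> R) :
  continuous F -> open [set q | 0 < F q].
Proof.
move=> Fc; have := @open_comp _ _ F [set r | 0 < r].
by apply => [q _|]; [exact: Fc|exact: open_gt].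
Qed.

Section Terms.
Context {R : realType} {n : nat} (i0 : 'I_n) (h : 'I_n -> R).
Local Notation E := 'rV[R]_(n + n).
Implicit Types (q v : E) (k N : nat).

Definition sg q : R := xcoord q i0 ^+ 2 + ycoord q i0 ^+ 2.
Definition uu q : R := \sum_(i | i != i0) h i * (xcoord q i ^+ 2 + ycoord q i ^+ 2).
Definition HH q : R := h i0 * sg q + uu q.
Definition th q : R := atan (ycoord q i0 / xcoord q i0).
Definition gate (f : R -> R) q : R := if 0 < xcoord q i0 then f (th q) else 0.
(** Positive exactly where [h i0 * sg > 1 / 2]; the factors [flat j yy] are the cutoff that removes
    the singularity of the angle at [sg = 0]. *)
Definition yy q : R := 2 * h i0 * sg q - 1.

Lemma smooth_xcoord k (U : set E) i : open U -> Ck_on k U (fun q => xcoord q i).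
Proof. by move=> oU; exact: Ck_on_coord. Qed.

Lemma smooth_ycoord k (U : set E) i : open U -> Ck_on k U (fun q => ycoord q i).
Proof. by move=> oU; exact: Ck_on_coord. Qed.

Lemma smooth_sqnorm k (U : set E) i : open U ->
  Ck_on k U (fun q => xcoord q i ^+ 2 + ycoord q i ^+ 2).
Proof.
move=> oU; have xk := smooth_xcoord k i oU; have yk := smooth_ycoord k i oU.
by apply: eq_Ck_on (Ck_onD oU (Ck_onM oU xk xk) (Ck_onM oU yk yk)).
Qed.

Lemma smooth_sg k (U : set E) : open U -> Ck_on k U sg.
Proof. exact: smooth_sqnorm. Qed.

Lemma smooth_uu k (U : set E) : open U -> Ck_on k U uu.
Proof.
move=> oU; apply: Ck_on_sum => // i _; apply: Ck_onM => //; first exact: Ck_on_cst.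
exact: smooth_sqnorm.
Qed.

Lemma smooth_HH k (U : set E) : open U -> Ck_on k U HH.
Proof.
move=> oU; apply: Ck_onD => //; last exact: smooth_uu.
by apply: Ck_onM => //; [exact: Ck_on_cst|exact: smooth_sg].
Qed.

Lemma smooth_yy k (U : set E) : open U -> Ck_on k U yy.
Proof.
move=> oU; apply: Ck_onB => //; last exact: Ck_on_cst.
by apply: Ck_onM => //; [exact: Ck_on_cst|exact: smooth_sg].
Qed.

Lemma smooth_th k : Ck_on k [set q | 0 < xcoord q i0] th.
Proof.
have oU : open [set q : E | 0 < xcoord q i0].
  by apply: open_pos; exact: coord_continuous.
apply: Ck_on_atan => //; apply: Ck_onM => //; first exact: smooth_ycoord.
apply: Ck_onV => //; last exact: smooth_xcoord.
by move=> q q0; rewrite gt_eqF.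
Qed.

Lemma smooth_continuous (f : E -> R) : (forall k, Ck_on k setT f) -> continuous f.
Proof. by move=> fk q; exact: (fk 0%N q I). Qed.

(** An open set on which all cut-off terms vanish. Together with the half-space where [xcoord] is
    positive at [i0] it covers everything, so each germ is either zero or computed in polar
    coordinates. *)
Definition off_cone : set E := [set q | 0 < `|ycoord q i0| - xcoord q i0] `|` [set q | 0 < - yy q].

Lemma open_off_cone : open off_cone.
Proof.
apply: openU; apply: open_pos.
  move=> q; have yc : (ycoord p i0) @[p --> q] --> ycoord q i0 by exact: coord_continuous.
  have xc : (xcoord p i0) @[p --> q] --> xcoord q i0 by exact: coord_continuous.
  exact: (cvgB (cvg_comp _ _ yc (@norm_continuous _ R _)) xc).
apply: smooth_continuous => k; apply: Ck_onN; first exact: openT.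
by apply: smooth_yy; exact: openT.
Qed.

Lemma cone_cover q : 0 < xcoord q i0 \/ off_cone q.
Proof.
have [x0|x0] := ltP 0 (xcoord q i0); [by left|right].
have [y0|y0] := eqVneq (ycoord q i0) 0; last first.
  by left; rewrite /= subr_gt0 (le_lt_trans x0)// normr_gt0.
have [x00|x00] := eqVneq (xcoord q i0) 0.
  by right; rewrite /= /yy /sg x00 y0 expr0n addr0 mulr0 sub0r opprK.
by left; rewrite /= y0 normr0 sub0r oppr_gt0 lt_neqAle x00.
Qed.

(** The bound [1 / 2 < pi / 4] is the reason for placing the pulses at angles between [0] and
    [1 / 2]. *)
Lemma th_off q : 0 < xcoord q i0 -> xcoord q i0 < `|ycoord q i0| ->
  2^-1 < th q \/ th q < 0.
Proof.
move=> x0; rewrite ltr_normr => /orP[xy|xy]; [left|right].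
  apply: (@le_lt_trans _ _ (atan 1)).
    by rewrite atan1; have := @pi_ge2 R; lra.
  by apply: lt_atan; rewrite ltr_pdivlMr// mul1r.
rewrite -atan0; apply: lt_atan; rewrite ltr_pdivrMr// mul0r.
lra.
Qed.

Definition conical (f : R -> R) := forall x, x <= 0 \/ 2^-1 <= x -> f x = 0.

Lemma gate_off f j q : conical f -> off_cone q -> flat j (yy q) * gate f q = 0.
Proof.
move=> fc [/=|/= yq]; last first.
  by rewrite flat_le0 ?mul0r//; lra.
rewrite subr_gt0 /gate => xy; case: ifPn => x0; last by rewrite mulr0.
by have [t|t] := th_off x0 xy; rewrite fc ?mulr0//; [right|left]; exact: ltW.
Qed.

Lemma smooth_gate f j k : conical f -> smooth1 f ->
  Ck_on k setT (fun q => flat j (yy q) * gate f q).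
Proof.
move=> fc fs; apply: Ck_on_local => q _; have [x0|oq] := cone_cover q.
  exists [set q | 0 < xcoord q i0] => //.
  have oU : open [set q : E | 0 < xcoord q i0].
    by apply: open_pos; exact: coord_continuous.
  have yk := smooth_yy k oU.
  apply: eq_Ck_on (Ck_onM oU (Ck_on_flat j oU yk) (fs _ _ _ _ oU (smooth_th k))) => //.
  by move=> p p0; rewrite /gate p0.
exists off_cone => //; apply: eq_Ck_on (Ck_on_cst k off_cone (0 : R)) => //.
  exact: open_off_cone.
by move=> p op; rewrite gate_off.
Qed.

Definition dsg q v : R := 2 * (xcoord q i0 * xcoord v i0 + ycoord q i0 * ycoord v i0).
Definition duu q v : R := \sum_(i | i != i0)
  2 * h i * (xcoord q i * xcoord v i + ycoord q i * ycoord v i).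
Definition dth q v : R := (xcoord q i0 * ycoord v i0 - ycoord q i0 * xcoord v i0) / sg q.

Lemma dir_der_sqnorm q v i : dir_der (fun q => xcoord q i ^+ 2 + ycoord q i ^+ 2) q v
  (2 * (xcoord q i * xcoord v i + ycoord q i * ycoord v i)).
Proof.
apply: dir_der_eq.
  apply: dir_derD.
    exact: (dir_derM (dir_der_coord q v (lshift n i)) (dir_der_coord q v (lshift n i))).
  exact: (dir_derM (dir_der_coord q v (rshift n i)) (dir_der_coord q v (rshift n i))).
by rewrite /xcoord /ycoord; ring.
Qed.

Lemma dir_der_sg q v : dir_der sg q v (dsg q v).
Proof. exact: dir_der_sqnorm. Qed.

Lemma dir_der_uu q v : dir_der uu q v (duu q v).
Proof.
apply: dir_der_sum => i _; apply: dir_der_eq.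
  by apply: dir_derM; [exact: dir_der_cst|exact: dir_der_sqnorm].
by rewrite mul0r add0r mulrCA mulrA.
Qed.

Lemma dir_der_HH q v : dir_der HH q v (h i0 * dsg q v + duu q v).
Proof.
apply: dir_der_eq.
  apply: dir_derD (dir_der_uu q v).
  by apply: dir_derM; [exact: dir_der_cst|exact: dir_der_sg].
by rewrite mul0r add0r.
Qed.

Lemma dir_der_yy q v : dir_der yy q v (2 * h i0 * dsg q v).
Proof.
apply: dir_der_eq.
  apply: dir_derB (dir_der_cst q v 1).
  by apply: dir_derM; [exact: dir_der_cst|exact: dir_der_sg].
by rewrite mul0r add0r subr0.
Qed.

Lemma dir_der_th q v : 0 < xcoord q i0 -> dir_der th q v (dth q v).
Proof.
move=> x0; apply: dir_der_eq.
  apply: (dir_der_comp (is_derive1_atan _)).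
  apply: dir_derM; first exact: dir_der_coord.
  apply: (@dir_der_comp _ _ GRing.inv); first exact/is_derive_inv/lt0r_neq0.
  exact: dir_der_coord.
rewrite /dth /sg -/(xcoord q i0) -/(ycoord q i0) -/(xcoord v i0) -/(ycoord v i0).
have s0 : xcoord q i0 ^+ 2 + ycoord q i0 ^+ 2 != 0.
  by rewrite gt_eqF// ltr_wpDr ?sqr_ge0// exprn_gt0.
by field; rewrite s0 gt_eqF.
Qed.

Lemma dir_der_gate f df q v : 0 < xcoord q i0 -> is_derive (th q) 1 f df ->
  dir_der (gate f) q v (df * dth q v).
Proof.
move=> x0 fd; apply: (@dir_der_near _ _ (fun q => f (th q))).
  have oU : open [set q : E | 0 < xcoord q i0].
    by apply: open_pos; exact: coord_continuous.
  near=> p; rewrite /gate ifT//; near: p.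
  exact: (open_nbhs_nbhs (conj oU x0)).
by apply: (dir_der_comp fd); exact: dir_der_th.
Unshelve. all: by end_near. Qed.

End Terms.

(* The bound [w k / (52 * 2 ^+ k)] on the negative part of [dB k] makes the
   pulses change the radial slope by at most [1/2] in total. *)
Definition pulses (R : realType) (c w : nat -> R) (B dB : nat -> R -> R) : Prop :=
  forall k, [/\ 0 < w k <= 1, 2 * w k <= c k <= 2^-1 - 2 * w k
    & finger (c k) (w k) (w k / (52 * 2 ^+ k)) (B k) (dB k)].

Section Generators.
Context {R : realType} {n : nat} (i0 : 'I_n) (h : 'I_n -> R).
Hypothesis h_gt0 : forall i, 0 < h i.
Context {c w : nat -> R} {B dB : nat -> R -> R}.
Hypothesis fing : pulses c w B dB.
Local Notation E := 'rV[R]_(n + n).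
Implicit Types (q v : E) (k N : nat).
Local Notation sg := (@sg R n i0).
Local Notation uu := (@uu R n i0 h).
Local Notation HH := (@HH R n i0 h).
Local Notation th := (@th R n i0).
Local Notation gate := (@gate R n i0).
Local Notation yy := (@yy R n i0 h).
Local Notation dsg := (@dsg R n i0).
Local Notation duu := (@duu R n i0 h).
Local Notation dth := (@dth R n i0).

(** Nonpositive exactly where [HH <= 1 - w k], and equal to [1] on [HH = 1], where every pulse
    therefore acts with the same strength however small [w k] is. *)
Definition depth k q : R := 1 - (1 - HH q) / w k.

Let w0 k : 0 < w k. Proof. by have [/andP[]] := fing k. Qed.

(* The [k]-th summand of the generating function is
   [sg * flat 0 yy * flat 0 depth * gate (B k)]; [alk] and [bek] are its derivatives
   in [sg] and [uu], and [muk] is its angular derivative divided by [sg]. *)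
Definition muk k q : R := flat 0 (yy q) * gate (dB k) q * flat 0 (depth k q).
Definition alk k q : R :=
  (flat 0 (yy q) * gate (B k) q + 2 * h i0 * sg q * (flat 2 (yy q) * gate (B k) q))
    * flat 0 (depth k q)
  + h i0 * sg q * (flat 0 (yy q) * gate (B k) q) * (flat 2 (depth k q) / w k).
Definition bek k q : R :=
  sg q * (flat 0 (yy q) * gate (B k) q) * (flat 2 (depth k q) / w k).

Definition mu N q : R := \sum_(k < N) muk k q.
Definition al N q : R := \sum_(k < N) alk k q.
Definition be N q : R := \sum_(k < N) bek k q.

Lemma conicalB k : conical (B k) /\ conical (dB k).
Proof.
have [wk ck [_ _ _ supp _ _ _]] := fing k.
have wx x : x <= 0 \/ 2^-1 <= x -> w k <= `|x - c k|.
  move=> [x0|x0].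
    by rewrite distrC (le_trans _ (ler_norm _))//; lra.
  by rewrite (le_trans _ (ler_norm _))//; lra.
by split=> x /wx /supp[].
Qed.

Lemma smooth_depth k j : Ck_on j setT (depth k).
Proof.
apply: Ck_onB; [exact: openT|exact: Ck_on_cst|].
apply: Ck_onM; [exact: openT| |exact: Ck_on_cst].
by apply: Ck_onB; [exact: openT|exact: Ck_on_cst|exact: smooth_HH openT].
Qed.

Lemma smooth_flat_depth k i j : Ck_on j setT (fun q => flat i (depth k q)).
Proof. by apply: Ck_on_flat; [exact: openT|exact: smooth_depth]. Qed.

Lemma smooth_gateB k i j : Ck_on j setT (fun q => flat i (yy q) * gate (B k) q).
Proof.
have [cB _] := conicalB k; have [_ _ [sB _ _ _ _ _ _]] := fing k.
exact: smooth_gate.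
Qed.

Lemma smooth_gatedB k i j : Ck_on j setT (fun q => flat i (yy q) * gate (dB k) q).
Proof.
have [_ cB] := conicalB k; have [_ _ [_ sB _ _ _ _ _]] := fing k.
exact: smooth_gate.
Qed.

Lemma smooth_mu N j : Ck_on j setT (mu N).
Proof.
apply: Ck_on_sum => [|k _]; first exact: openT.
apply: Ck_onM; [exact: openT|exact: smooth_gatedB|exact: smooth_flat_depth].
Qed.

Lemma smooth_bek k j : Ck_on j setT (bek k).
Proof.
have oT : open [set: E] := openT.
apply: Ck_onM => //; first by apply: Ck_onM => //; [exact: smooth_sg|exact: smooth_gateB].
by apply: Ck_onM => //; [exact: smooth_flat_depth|exact: Ck_on_cst].
Qed.

Lemma smooth_be N j : Ck_on j setT (be N).
Proof.
by apply: Ck_on_sum => [|k _]; [exact: openT|exact: smooth_bek].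
Qed.

Lemma smooth_al N j : Ck_on j setT (al N).
Proof.
have oT : open [set: E] := openT.
apply: Ck_on_sum => // k _; apply: Ck_onD => //.
  apply: Ck_onM => //; last exact: smooth_flat_depth.
  apply: Ck_onD => //; first exact: smooth_gateB.
  apply: Ck_onM => //; last exact: smooth_gateB.
  by apply: Ck_onM => //; [exact: Ck_on_cst|exact: smooth_sg].
apply: Ck_onM => //; last first.
  by apply: Ck_onM => //; [exact: smooth_flat_depth|exact: Ck_on_cst].
apply: Ck_onM => //; last exact: smooth_gateB.
by apply: Ck_onM => //; [exact: Ck_on_cst|exact: smooth_sg].
Qed.

Lemma pulse_sum_le N : \sum_(k < N) (4 * 2 ^+ k)^-1 <= 2^-1 :> R.
Proof.
suff -> : \sum_(k < N) (4 * 2 ^+ k)^-1 = 2^-1 * (1 - (2 ^+ N)^-1) :> R.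
  by rewrite ger_pMr ?invr_gt0// gerBl invr_ge0 exprn_ge0.
elim: N => [|N IH]; first by rewrite big_ord0 expr0 invr1 subrr mulr0.
by rewrite big_ord_recr /= IH exprS; field; rewrite expf_neq0.
Qed.

(* The factor of [b] is the derivative in [sg] of
   [sg * flat 0 yy * flat 0 depth]. *)
Lemma slope_bound k (y s d b : R) : 0 <= s <= 1 -> - (w k / (52 * 2 ^+ k)) <= b ->
  - (4 * 2 ^+ k)^-1 <= ((flat 0 y + 2 * s * flat 2 y) * flat 0 d
     + s * flat 0 y * (flat 2 d / w k)) * b.
Proof.
move=> /andP[s0 s1] bk; set P := (X in _ <= X * b).
have [/andP[_ w1] _ _] := fing k.
have y0 := flat_ge0 0 y; have y1 := flat0_le1 y; have y2 := flat_ge0 2 y; have y3 := flat2_le4 y.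
have d0 := flat_ge0 0 d; have d1 := flat0_le1 d; have d2 := flat_ge0 2 d; have d3 := flat2_le4 d.
have wi0 : 0 < (w k)^-1 by rewrite invr_gt0.
have w1' : 1 <= (w k)^-1 by rewrite invf_ge1.
have P0 : 0 <= P.
  apply: addr_ge0; last by rewrite !mulr_ge0// ltW.
  by apply: mulr_ge0 => //; apply: addr_ge0 => //; rewrite !mulr_ge0.
(* The first summand contributes [1 + 2 * 4 = 9], the second [4 / w k]. This is the origin of
   [52 = 4 * 13] in the bound on [b]. *)
have P1 : P <= 13 / w k.
  apply: (@le_trans _ _ (9 + 4 / w k)); last lra.
  apply: lerD.
    rewrite -[leRHS]mulr1; apply: ler_pM => //.
      by rewrite addr_ge0// !mulr_ge0.
    suff : s * flat 2 y <= 1 * 4 by lra.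
    exact: ler_pM.
  rewrite -[leRHS]mul1r; apply: ler_pM; rewrite ?mulr_ge0 ?(ltW wi0)//.
    by rewrite mulr_ile1.
  by rewrite ler_pM2r.
have [b0|b0] := leP 0 b.
  apply: (@le_trans _ _ 0); last exact: mulr_ge0.
  by rewrite oppr_le0 invr_ge0 mulr_ge0// exprn_ge0.
apply: (@le_trans _ _ (13 / w k * b)); last by rewrite ler_wnM2r// ltW.
apply: (@le_trans _ _ (13 / w k * (- (w k / (52 * 2 ^+ k))))); last first.
  by rewrite ler_wpM2l// mulr_ge0// ltW.
rewrite le_eqVlt; apply/orP; left; apply/eqP; field.
by rewrite expf_neq0//= gt_eqF.
Qed.

Lemma mu_ge N q : - 2^-1 <= mu N q.
Proof.
rewrite lerNl -sumrN; apply: le_trans (pulse_sum_le N); apply: ler_sum => k _.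
have [/andP[_ w1] _ [_ _ _ _ dge _ _]] := fing k.
have p0 : 0 < (2 ^+ k : R) by rewrite exprn_gt0.
have e1 : w k / (52 * 2 ^+ k) <= (4 * 2 ^+ k)^-1.
  rewrite ler_pdivrMr ?mulr_gt0//.
  have -> : (4 * 2 ^+ k)^-1 * (52 * 2 ^+ k) = 13 :> R by field; rewrite gt_eqF.
  lra.
have e0 : 0 <= w k / (52 * 2 ^+ k) by rewrite divr_ge0 ?ltW// mulr_gt0.
have gb : - gate (dB k) q <= w k / (52 * 2 ^+ k).
  by rewrite /gate; case: ifP => _; rewrite ?oppr0// lerNl.
apply: le_trans e1; rewrite /muk mulrAC -mulrN.
have [g0|g0] := leP 0 (- gate (dB k) q).
  apply: le_trans gb; rewrite ler_piMl// mulr_ile1 ?flat_ge0 ?flat0_le1//.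
by apply: le_trans e0; rewrite mulr_ge0_le0 ?mulr_ge0 ?flat_ge0 ?ltW.
Qed.

(* [a], [b] and [sg * m] are the first derivatives of a function of [sg], [uu] and
   [th], whose Hessian has the entries [Ass], [Asu], [Auu], [P], [Q] and [Z]. *)
Record germ (a b m P Q Z : R) (da db dm : E -> R) (Ass Asu Auu : R) q : Prop := Germ {
  germ_a : forall v, da v = Ass * dsg q v + Asu * duu q v + P * dth q v;
  germ_b : forall v, db v = Asu * dsg q v + Auu * duu q v + Q * dth q v;
  germ_m : forall v, sg q * dm v + m * dsg q v = P * dsg q v + Q * duu q v + Z * dth q v }.

(** [P] is the mixed derivative in [sg] and [th]; its lower bound [l] is what makes the
    differentials of both maps injective. *)
Definition has_germ (fa fb fm : E -> R) (l : R) q := exists da db dm Ass Asu Auu P Q Z,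
  [/\ forall v, [/\ dir_der fa q v (da v), dir_der fb q v (db v) & dir_der fm q v (dm v)],
   germ (fa q) (fb q) (fm q) P Q Z da db dm Ass Asu Auu q & l <= P].

Lemma has_germk k q : 0 < xcoord q i0 -> h i0 * sg q <= 1 ->
  has_germ (alk k) (bek k) (muk k) (- (4 * 2 ^+ k)^-1) q.
Proof.
move=> x0 hs1.
have s0 : 0 < sg q by rewrite /sg ltr_wpDr ?sqr_ge0// exprn_gt0.
have [_ _ [_ dBs Bd _ dge _ _]] := fing k.
pose T := th q; pose h0 := h i0; pose s := sg q; pose y := yy q; pose D := depth k q.
(* The second derivative of the pulse, obtained from the smoothness of [dB k] composed with the
   identity. *)
have [ddB dBd] : exists d, is_derive T 1 (dB k) d.
  have idk : Ck_on 1 [set: R] id.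
    split=> [x _|v]; first exact: ex_diff.
    apply: eq_Ck_on (Ck_on_cst 0 setT v) => // [|x _]; first exact: openT.
    by rewrite derive_id.
  have [+ _] := dBs _ _ _ _ openT idk => /(_ T I) dd.
  by exists ('D_1 (dB k) T); apply/derivableP/diff_derivable.
pose g v := dth q v.
have dd v : dir_der (depth k) q v ((h0 * dsg q v + duu q v) / w k).
  apply: dir_der_eq.
    apply: dir_derB; first exact: dir_der_cst.
    apply: dir_derM; last exact: dir_der_cst.
    by apply: dir_derB; [exact: dir_der_cst|exact: dir_der_HH].
  by rewrite mulr0 addr0 !sub0r mulNr opprK.
have fd i v : dir_der (fun q => flat i (depth k q)) q v
    ((- i%:R * flat i.+1 D + flat i.+2 D) * ((h0 * dsg q v + duu q v) / w k)).
  exact: (dir_der_comp (is_derive_flat i _) (dd v)).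
have fy i v : dir_der (fun q => flat i (yy q)) q v
    ((- i%:R * flat i.+1 y + flat i.+2 y) * (2 * h0 * dsg q v)).
  exact: (dir_der_comp (is_derive_flat i _) (dir_der_yy _ _ _ v)).
have gB v : dir_der (gate (B k)) q v (dB k T * g v) by exact: dir_der_gate.
have gdB v : dir_der (gate (dB k)) q v (ddB * g v) by exact: dir_der_gate.
have da v := dir_derD
  (dir_derM (dir_derD (dir_derM (fy 0%N v) (gB v))
     (dir_derM (dir_derM (dir_der_cst q v (2 * h0)) (dir_der_sg i0 q v))
        (dir_derM (fy 2 v) (gB v)))) (fd 0%N v))
  (dir_derM (dir_derM (dir_derM (dir_der_cst q v h0) (dir_der_sg i0 q v))
      (dir_derM (fy 0%N v) (gB v))) (dir_derM (fd 2 v) (dir_der_cst q v (w k)^-1))).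
have db v := dir_derM (dir_derM (dir_der_sg i0 q v) (dir_derM (fy 0%N v) (gB v)))
  (dir_derM (fd 2 v) (dir_der_cst q v (w k)^-1)).
have dm v := dir_derM (dir_derM (fy 0%N v) (gdB v)) (fd 0%N v).
have gE f : gate f q = f T by rewrite /gate x0.
pose b := B k T; pose b' := dB k T; pose W := (w k)^-1.
pose Y0 := flat 0 y; pose Y1 := flat 2 y; pose Y2 := - 2%:R * flat 3 y + flat 4 y.
pose D0 := flat 0 D; pose D1 := flat 2 D; pose D2 := - 2%:R * flat 3 D + flat 4 D.
(* [F_s] and [F_u] are the derivatives of [sg * flat 0 yy * flat 0 depth] in [sg] and [uu]. Times
   [b'] they are the mixed entries [P] and [Q]; differentiating them again, times [b], gives the
   other entries. *)
pose F_s := (Y0 + 2 * h0 * s * Y1) * D0 + h0 * s * Y0 * (D1 * W).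
pose F_u := s * Y0 * (D1 * W).
eexists _, _, _.
exists (b * ((4 * h0 * Y1 + 4 * h0 ^+ 2 * s * Y2) * D0
       + 2 * (Y0 + 2 * h0 * s * Y1) * (D1 * W * h0) + h0 ^+ 2 * s * Y0 * (D2 * W ^+ 2))),
  (b * ((Y0 + 2 * h0 * s * Y1) * (D1 * W) + h0 * s * Y0 * (D2 * W ^+ 2))),
  (b * (s * Y0 * (D2 * W ^+ 2))), (F_s * b'), (F_u * b'), (s * Y0 * D0 * ddB).
split; first by move=> v; split; [exact: da|exact: db|exact: dm].
- split=> v; rewrite /muk !gE -/T -/h0 -/s -/y -/D -/b -/b' -/W -/(g v)
    -/Y0 -/Y1 -/Y2 -/D0 -/D1 -/D2 /F_s /F_u; ring.
- have hs : 0 <= h0 * s <= 1 by rewrite hs1 andbT mulr_ge0// ltW// h_gt0.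
  by have := @slope_bound k y (h0 * s) D b' hs (dge _); rewrite mulrA.
Qed.

End Generators.

Section Coordinates.
Context {R : realType} {n : nat}.
Local Notation E := 'rV[R]_(n + n).

Definition mkE (X Y : 'I_n -> R) : E := row_mx (\row_i X i) (\row_i Y i).

Lemma xcoord_mkE X Y i : xcoord (mkE X Y) i = X i.
Proof. by rewrite /xcoord /mkE row_mxEl mxE. Qed.

Lemma ycoord_mkE X Y i : ycoord (mkE X Y) i = Y i.
Proof. by rewrite /ycoord /mkE row_mxEr mxE. Qed.

Lemma coord_ext (u v : E) : (forall i, xcoord u i = xcoord v i) ->
  (forall i, ycoord u i = ycoord v i) -> u = v.
Proof.
move=> xuv yuv; apply/rowP => j.
by case: (fintype.split_ordP j) => i ->; [exact: xuv|exact: yuv].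
Qed.

Lemma Ck_on_mkE k (U : set E) (X Y : 'I_n -> E -> R) : open U ->
  (forall i, Ck_on k U (X i)) -> (forall i, Ck_on k U (Y i)) ->
  Ck_on k U (fun q => mkE (X ^~ q) (Y ^~ q)).
Proof.
move=> oU Xk Yk; apply: Ck_on_rV => // j; case: (fintype.split_ordP j) => i ->.
  by apply: eq_Ck_on (Xk i) => // q _; exact/esym/xcoord_mkE.
by apply: eq_Ck_on (Yk i) => // q _; exact/esym/ycoord_mkE.
Qed.

Lemma diff_xcoord (F : E -> E) q v i : differentiable F q ->
  xcoord ('d F q v) i = 'D_v (fun p => xcoord (F p) i) q.
Proof. by move=> Fd; rewrite -deriveE// /xcoord derive_rV. Qed.

Lemma diff_ycoord (F : E -> E) q v i : differentiable F q ->
  ycoord ('d F q v) i = 'D_v (fun p => ycoord (F p) i) q.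
Proof. by move=> Fd; rewrite -deriveE// /ycoord derive_rV. Qed.

End Coordinates.

(** * The two maps and the symplectic form *)

Section SymplecticPair.
Context {R : realType} {n : nat} (i0 : 'I_n) (h : 'I_n -> R).
Hypothesis h_gt0 : forall i, 0 < h i.
Context {c w : nat -> R} {B dB : nat -> R -> R}.
Hypothesis fing : pulses c w B dB.
Local Notation E := 'rV[R]_(n + n).
Implicit Types (q v : E) (k N : nat).
Local Notation sg := (@sg R n i0).
Local Notation uu := (@uu R n i0 h).
Local Notation HH := (@HH R n i0 h).
Local Notation dsg := (@dsg R n i0).
Local Notation duu := (@duu R n i0 h).
Local Notation dth := (@dth R n i0).
Local Notation mu := (@mu R n i0 h w dB).
Local Notation al := (@al R n i0 h w B).
Local Notation be := (@be R n i0 h w B).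
Local Notation has_germ := (@has_germ R n i0 h).

Lemma has_germD fa fb fm l fa' fb' fm' l' q :
  has_germ fa fb fm l q -> has_germ fa' fb' fm' l' q ->
  has_germ (fun q => fa q + fa' q) (fun q => fb q + fb' q) (fun q => fm q + fm' q)
    (l + l') q.
Proof.
move=> [da [db [dm [a1 [a2 [a3 [P [Q [Z [d1 [ga gb gm] lP]]]]]]]]]].
move=> [da' [db' [dm' [a1' [a2' [a3' [P' [Q' [Z' [d1' [ga' gb' gm'] lP']]]]]]]]]].
exists (fun v => da v + da' v), (fun v => db v + db' v), (fun v => dm v + dm' v).
exists (a1 + a1'), (a2 + a2'), (a3 + a3'), (P + P'), (Q + Q'), (Z + Z'); split.
- move=> v; have [? ? ?] := d1 v; have [? ? ?] := d1' v.
  by split; apply: dir_derD.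
- split=> v; rewrite ?ga ?gb ?ga' ?gb'; [ring|ring|].
  rewrite (_ : _ + _ = (sg q * dm v + fm q * dsg q v) + (sg q * dm' v + fm' q * dsg q v)).
    by rewrite gm gm'; ring.
  by ring.
- exact: lerD.
Qed.

Lemma has_germ0 q : has_germ (fun=> 0) (fun=> 0) (fun=> 0) 0 q.
Proof.
exists (fun=> 0), (fun=> 0), (fun=> 0), 0, 0, 0, 0, 0, 0; split => //.
- by move=> v; split; exact: dir_der_cst.
- by split=> v; ring.
Qed.

Lemma has_germ_near fa fb fm fa' fb' fm' l q :
  (\forall p \near q, [/\ fa p = fa' p, fb p = fb' p & fm p = fm' p]) ->
  has_germ fa fb fm l q -> has_germ fa' fb' fm' l q.
Proof.
move=> fE [da [db [dm [a1 [a2 [a3 [P [Q [Z [d1 g lP]]]]]]]]]].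
have [ea eb em] := nbhs_singleton fE.
exists da, db, dm, a1, a2, a3, P, Q, Z; split => //; last by rewrite -ea -eb -em.
move=> v; have [d2 d3 d4] := d1 v; split.
- by apply: dir_der_near d2; apply: filterS fE => p [].
- by apply: dir_der_near d3; apply: filterS fE => p [].
- by apply: dir_der_near d4; apply: filterS fE => p [].
Unshelve. all: by end_near. Qed.

Lemma off_cone_eq0 N q : off_cone i0 h q -> [/\ al N q = 0, be N q = 0 & mu N q = 0].
Proof.
move=> oq; split; rewrite /al /be /mu big1// => k _;
  have [cB cdB] := conicalB fing k.
- by rewrite /alk !(gate_off _ cB oq) !mulr0 addr0 !mul0r addr0.
- by rewrite /bek (gate_off _ cB oq) mulr0 mul0r.
- by rewrite /muk (gate_off _ cdB oq) mul0r.
Qed.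

(** Germs add, and the lower bounds on the mixed derivatives sum to at least [- 1 / 2] for every
    [N]. *)
Lemma has_germN N q : h i0 * sg q <= 1 -> has_germ (al N) (be N) (mu N) (- 2^-1) q.
Proof.
move=> hs; have [x0|oq] := cone_cover i0 h q; last first.
  have := has_germ0 q.
  move=> [da [db [dm [a1 [a2 [a3 [P [Q [Z [d1 g lP]]]]]]]]]].
  apply: (@has_germ_near (fun=> 0) (fun=> 0) (fun=> 0)).
    near=> p; have op : off_cone i0 h p.
      by near: p; apply: open_nbhs_nbhs; split => //; exact: open_off_cone.
    by have [-> -> ->] := off_cone_eq0 N op.
  exists da, db, dm, a1, a2, a3, P, Q, Z; split => //.
  by rewrite (le_trans _ lP)// oppr_le0.
suff [da [db [dm [a1 [a2 [a3 [P [Q [Z [d1 g lP]]]]]]]]]] :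
    has_germ (al N) (be N) (mu N) (- \sum_(k < N) (4 * 2 ^+ k)^-1) q.
  exists da, db, dm, a1, a2, a3, P, Q, Z; split => //.
  by rewrite (le_trans _ lP)// lerN2 pulse_sum_le.
elim: N => [|N IH].
  rewrite big_ord0 oppr0; apply: has_germ_near (has_germ0 q).
  by near=> p; rewrite /al /be /mu !big_ord0.
rewrite big_ord_recr /= opprD.
apply: has_germ_near (has_germD IH (has_germk h_gt0 fing N x0 hs)).
by near=> p; rewrite /al /be /mu !big_ord_recr.
Unshelve. all: by end_near. Qed.

(** For [i != i0] the squared modulus of [z_i] enters the generating function only through [uu],
    whence the factor [h i]. *)
Definition angle N i q : R := if i == i0 then al N q else h i * be N q.

Definition OM N q : E :=
  mkE (fun i => cos (angle N i q) * xcoord q i - sin (angle N i q) * ycoord q i)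
      (fun i => sin (angle N i q) * xcoord q i + cos (angle N i q) * ycoord q i).

(** Since [sg] is to become [sg * (1 + mu)], the coordinates are multiplied by the square root. *)
Definition stretch N i q : R := if i == i0 then Num.sqrt (1 + mu N q) else 1.

Definition NM N q : E :=
  mkE (fun i => stretch N i q * xcoord q i) (fun i => stretch N i q * ycoord q i).

Lemma mu1_gt0 N q : 0 < 1 + mu N q.
Proof. by have := mu_ge i0 h fing N q; lra. Qed.

Lemma smooth_angle N i k : Ck_on k setT (angle N i).
Proof.
rewrite /angle; have [_|_] := eqVneq i i0; first exact: smooth_al.
by apply: Ck_onM; [exact: openT|exact: Ck_on_cst|exact: smooth_be].
Qed.

Lemma smooth_stretch N i k : Ck_on k setT (stretch N i).
Proof.
rewrite /stretch; have [_|_] := eqVneq i i0; last exact: Ck_on_cst.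
apply: Ck_on_sqrt; [exact: openT|by move=> q _; exact: mu1_gt0|].
by apply: Ck_onD; [exact: openT|exact: Ck_on_cst|exact: smooth_mu].
Qed.

Lemma smooth_OM N k : Ck_on k setT (OM N).
Proof.
have oT : open [set: E] := openT.
have sa i := smooth_angle N i k.
have sx i := smooth_xcoord k i oT; have sy i := smooth_ycoord k i oT.
apply: Ck_on_mkE => // i.
  apply: Ck_onB => //; apply: Ck_onM => //; first exact: Ck_on_cos.
  exact: Ck_on_sin.
by apply: Ck_onD => //; apply: Ck_onM => //; [exact: Ck_on_sin|exact: Ck_on_cos].
Qed.

Lemma smooth_NM N k : Ck_on k setT (NM N).
Proof.
have oT : open [set: E] := openT.
by apply: Ck_on_mkE => // i; apply: Ck_onM => //;
  [exact: smooth_stretch|exact: smooth_xcoord|exact: smooth_stretch|exact: smooth_ycoord].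
Qed.

Lemma differentiable_OM N q : differentiable (OM N) q.
Proof. by have [+ _] := smooth_OM N 1; apply. Qed.

Lemma differentiable_NM N q : differentiable (NM N) q.
Proof. by have [+ _] := smooth_NM N 1; apply. Qed.

Lemma diff_OM N q v i da : dir_der (angle N i) q v da ->
  xcoord ('d (OM N) q v) i = cos (angle N i q) * (xcoord v i - da * ycoord q i)
     - sin (angle N i q) * (ycoord v i + da * xcoord q i) /\
  ycoord ('d (OM N) q v) i = sin (angle N i q) * (xcoord v i - da * ycoord q i)
     + cos (angle N i q) * (ycoord v i + da * xcoord q i).
Proof.
move=> dA; have Od := differentiable_OM N q.
have dc := dir_der_comp (is_derive_cos _) dA.
have ds := dir_der_comp (is_derive_sin _) dA.
have dx := dir_der_coord q v (lshift n i); have dy := dir_der_coord q v (rshift n i).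
rewrite diff_xcoord// diff_ycoord//; split.
  have [_ h1] := dir_derB (dir_derM dc dx) (dir_derM ds dy).
  rewrite (_ : (fun p => _) = fun p => cos (angle N i p) * xcoord p i - sin (angle N i p) * ycoord p i).
    by rewrite h1 /xcoord /ycoord; ring.
  by apply/funext => p; rewrite xcoord_mkE.
have [_ h1] := dir_derD (dir_derM ds dx) (dir_derM dc dy).
rewrite (_ : (fun p => _) = fun p => sin (angle N i p) * xcoord p i + cos (angle N i p) * ycoord p i).
  by rewrite h1 /xcoord /ycoord; ring.
by apply/funext => p; rewrite ycoord_mkE.
Qed.

Lemma diff_NM N q v i ds : dir_der (stretch N i) q v ds ->
  xcoord ('d (NM N) q v) i = ds * xcoord q i + stretch N i q * xcoord v i /\
  ycoord ('d (NM N) q v) i = ds * ycoord q i + stretch N i q * ycoord v i.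
Proof.
move=> dS; have Nd := differentiable_NM N q.
have dx := dir_der_coord q v (lshift n i); have dy := dir_der_coord q v (rshift n i).
rewrite diff_xcoord// diff_ycoord//; split.
  have [_ <-] := dir_derM dS dx; congr ('D_v _ q).
  by apply/funext => p; rewrite xcoord_mkE.
have [_ <-] := dir_derM dS dy; congr ('D_v _ q).
by apply/funext => p; rewrite ycoord_mkE.
Qed.

Lemma dir_der_angle N i q v da db : dir_der (al N) q v da -> dir_der (be N) q v db ->
  dir_der (angle N i) q v (if i == i0 then da else h i * db).
Proof.
move=> dA dB_; rewrite /angle; case: ifP => // _; apply: dir_der_eq.
  exact: (dir_derM (dir_der_cst q v (h i)) dB_).
by rewrite mul0r add0r.
Qed.

Lemma dir_der_stretch N i q v dm : dir_der (mu N) q v dm ->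
  dir_der (stretch N i) q v (if i == i0 then dm / (2 * stretch N i0 q) else 0).
Proof.
move=> dM; rewrite /stretch eqxx; case: ifP => _; last exact: dir_der_cst.
apply: dir_der_eq.
  apply: (dir_der_comp (f := fun p => 1 + mu N p) (is_derive1_sqrt (mu1_gt0 N q))).
  exact: (dir_derD (dir_der_cst q v 1) dM).
by rewrite add0r mulrC.
Qed.

Lemma omega0_D1 (u v : E) : omega0 u v =
  xcoord u i0 * ycoord v i0 - xcoord v i0 * ycoord u i0 +
  \sum_(i | i != i0) (xcoord u i * ycoord v i - xcoord v i * ycoord u i).
Proof. by rewrite /omega0 (bigD1 i0). Qed.

(** A rotation preserves the area form; letting its angle vary adds half of [d (|z|^2) /\ d A]. *)
Lemma omega_rot (A x y u1 u2 v1 v2 a b : R) :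
  (cos A * (u1 - a * y) - sin A * (u2 + a * x)) *
  (sin A * (v1 - b * y) + cos A * (v2 + b * x)) -
  (cos A * (v1 - b * y) - sin A * (v2 + b * x)) *
  (sin A * (u1 - a * y) + cos A * (u2 + a * x)) =
  (u1 * v2 - v1 * u2) + (b * (x * u1 + y * u2) - a * (x * v1 + y * v2)).
Proof.
have := cos2Dsin2 A; move: (cos A) (sin A) => C S CS.
transitivity ((C ^+ 2 + S ^+ 2) * ((u1 - a * y) * (v2 + b * x) - (v1 - b * y) * (u2 + a * x))).
  by ring.
by rewrite CS; ring.
Qed.

(** Up to the factor [1 / 2], the stretch adds [d (g_th) /\ d th] and the rotation adds
    [d sg /\ d (g_sg) + d uu /\ d (g_uu)]. Both equal [(P d sg + Q d uu) /\ d th]: in the second sum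
    the two occurrences of [Asu] cancel. *)
Lemma omega_pair N q u v : h i0 * sg q <= 1 ->
  omega0 ('d (NM N) q u) ('d (NM N) q v) = omega0 ('d (OM N) q u) ('d (OM N) q v).
Proof.
move=> hs; have [da [db [dm [a1 [a2 [a3 [P [Q [Z [d1 [ga gb gm] lP]]]]]]]]]] := has_germN N hs.
have [dau dbu dmu] := d1 u; have [dav dbv dmv] := d1 v.
suff H (nu nv ou ov : E) :
    (forall i, let da' := if i == i0 then da u else h i * db u in
      xcoord ou i = cos (angle N i q) * (xcoord u i - da' * ycoord q i)
        - sin (angle N i q) * (ycoord u i + da' * xcoord q i) /\
      ycoord ou i = sin (angle N i q) * (xcoord u i - da' * ycoord q i)
        + cos (angle N i q) * (ycoord u i + da' * xcoord q i)) ->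
    (forall i, let da' := if i == i0 then da v else h i * db v in
      xcoord ov i = cos (angle N i q) * (xcoord v i - da' * ycoord q i)
        - sin (angle N i q) * (ycoord v i + da' * xcoord q i) /\
      ycoord ov i = sin (angle N i q) * (xcoord v i - da' * ycoord q i)
        + cos (angle N i q) * (ycoord v i + da' * xcoord q i)) ->
    (forall i, let ds := if i == i0 then dm u / (2 * stretch N i0 q) else 0 in
      xcoord nu i = ds * xcoord q i + stretch N i q * xcoord u i /\
      ycoord nu i = ds * ycoord q i + stretch N i q * ycoord u i) ->
    (forall i, let ds := if i == i0 then dm v / (2 * stretch N i0 q) else 0 in
      xcoord nv i = ds * xcoord q i + stretch N i q * xcoord v i /\
      ycoord nv i = ds * ycoord q i + stretch N i q * ycoord v i) ->
    omega0 nu nv = omega0 ou ov.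
  apply: H => i.
  - exact: diff_OM (dir_der_angle i dau dbu).
  - exact: diff_OM (dir_der_angle i dav dbv).
  - exact: diff_NM (dir_der_stretch i dmu).
  - exact: diff_NM (dir_der_stretch i dmv).
move=> Ou Ov Nu Nv; rewrite (omega0_D1 nu nv) (omega0_D1 ou ov).
rewrite (eq_bigr (fun i => xcoord u i * ycoord v i - xcoord v i * ycoord u i)); last first.
  move=> i ii0; have [-> ->] := Nu i; have [-> ->] := Nv i.
  by rewrite (negbTE ii0) !mul0r !add0r /stretch (negbTE ii0) !mul1r.
rewrite [in RHS](eq_bigr (fun i => (xcoord u i * ycoord v i - xcoord v i * ycoord u i) +
   2^-1 * (db v * (2 * h i * (xcoord q i * xcoord u i + ycoord q i * ycoord u i)) -
           db u * (2 * h i * (xcoord q i * xcoord v i + ycoord q i * ycoord v i))))); last first.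
  move=> i ii0; have [-> ->] := Ou i; have [-> ->] := Ov i.
  by rewrite (negbTE ii0) omega_rot; field.
rewrite [in RHS]big_split /=.
have -> : \sum_(i | i != i0) 2^-1 *
     (db v * (2 * h i * (xcoord q i * xcoord u i + ycoord q i * ycoord u i)) -
      db u * (2 * h i * (xcoord q i * xcoord v i + ycoord q i * ycoord v i))) =
    2^-1 * (db v * duu q u - db u * duu q v).
  by rewrite -mulr_sumr sumrB -!mulr_sumr.
have [-> ->] := Nu i0; have [-> ->] := Nv i0; have [-> ->] := Ou i0; have [-> ->] := Ov i0.
rewrite eqxx omega_rot [RHS]addrA addrAC; congr (_ + _).
have st0 : 0 < stretch N i0 q by rewrite /stretch eqxx sqrtr_gt0 mu1_gt0.
have st2 : stretch N i0 q ^+ 2 = 1 + mu N q.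
  by rewrite /stretch eqxx sqr_sqrtr// ltW// mu1_gt0.
move: (stretch N i0 q) st0 st2 => st st0 st2.
have LE : (dm u / (2 * st) * xcoord q i0 + st * xcoord u i0) *
    (dm v / (2 * st) * ycoord q i0 + st * ycoord v i0) -
    (dm v / (2 * st) * xcoord q i0 + st * xcoord v i0) *
    (dm u / (2 * st) * ycoord q i0 + st * ycoord u i0) =
    st ^+ 2 * (xcoord u i0 * ycoord v i0 - xcoord v i0 * ycoord u i0)
    + 2^-1 * (dm u * (xcoord q i0 * ycoord v i0 - ycoord q i0 * xcoord v i0)
       - dm v * (xcoord q i0 * ycoord u i0 - ycoord q i0 * xcoord u i0)).
  by field; rewrite gt_eqF.
rewrite LE st2.
(* In the second case all terms vanish near [q], so their derivatives are [0]. In the first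
   [sg > 0], and the area form of the plane is half of [d sg /\ d th]. *)
have [x0|oq] := cone_cover i0 h q; last first.
  have Z0 (f : E -> R) w' d : (forall p, off_cone i0 h p -> f p = 0) ->
      dir_der f q w' d -> d = 0.
    move=> f0 [_ <-].
    rewrite (@eq_derive_on _ _ _ (off_cone i0 h) f (fun=> 0)) ?derive_cst//.
      exact: open_off_cone.
  have [z1 z2 z3] := off_cone_eq0 N oq.
  rewrite (Z0 _ _ _ _ dau) ?(Z0 _ _ _ _ dbu) ?(Z0 _ _ _ _ dmu) ?(Z0 _ _ _ _ dav)
    ?(Z0 _ _ _ _ dbv) ?(Z0 _ _ _ _ dmv) ?z3; try by move=> p /(off_cone_eq0 N)[].
  by rewrite !mul0r; ring.
have s0 : 0 < sg q by rewrite /sg ltr_wpDr ?sqr_ge0// exprn_gt0.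
have s0' : sg q != 0 by rewrite gt_eqF.
have K (w' : E) : xcoord q i0 * ycoord w' i0 - ycoord q i0 * xcoord w' i0 = sg q * dth q w'.
  by rewrite /dth [RHS]mulrC divfK.
have area : sg q * (xcoord u i0 * ycoord v i0 - xcoord v i0 * ycoord u i0) =
    2^-1 * (dsg q u * (sg q * dth q v) - dsg q v * (sg q * dth q u)).
  by rewrite -!K /dsg /sg; field.
have {}area : xcoord u i0 * ycoord v i0 - xcoord v i0 * ycoord u i0 =
    2^-1 * (dsg q u * dth q v - dsg q v * dth q u).
  by apply: (mulfI s0'); rewrite area; ring.
rewrite !K area.
have D w' : xcoord q i0 * xcoord w' i0 + ycoord q i0 * ycoord w' i0 = 2^-1 * dsg q w'.
  by rewrite /dsg; field.
rewrite !D !ga !gb; have gu := gm u; have gv := gm v.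
have -> : dm u * (sg q * dth q v) = (P * dsg q u + Q * duu q u + Z * dth q u - mu N q * dsg q u) * dth q v.
  by rewrite -gu; ring.
have -> : dm v * (sg q * dth q u) = (P * dsg q v + Q * duu q v + Z * dth q v - mu N q * dsg q v) * dth q u.
  by rewrite -gv; ring.
by field.
Qed.

End SymplecticPair.

Section DiffInjective.
Context {R : realType} {n : nat} (i0 : 'I_n) (h : 'I_n -> R).
Hypothesis h_gt0 : forall i, 0 < h i.
Context {c w : nat -> R} {B dB : nat -> R -> R}.
Hypothesis fing : pulses c w B dB.
Local Notation E := 'rV[R]_(n + n).
Implicit Types (q v : E) (k N : nat).
Local Notation sg := (@sg R n i0).
Local Notation dsg := (@dsg R n i0).
Local Notation duu := (@duu R n i0 h).
Local Notation dth := (@dth R n i0).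
Local Notation mu := (@mu R n i0 h w dB).
Local Notation al := (@al R n i0 h w B).
Local Notation be := (@be R n i0 h w B).
Local Notation stretch := (@stretch R n i0 h w dB).
Local Notation OM := (@OM R n i0 h w B).
Local Notation NM := (@NM R n i0 h w dB).

Lemma off_cone_dir_der N q v (da db dm : R) : off_cone i0 h q ->
  dir_der (al N) q v da -> dir_der (be N) q v db -> dir_der (mu N) q v dm ->
  [/\ da = 0, db = 0 & dm = 0].
Proof.
move=> oq d1 d2 d3.
have Z0 (f : E -> R) d : (forall p, off_cone i0 h p -> f p = 0) ->
    dir_der f q v d -> d = 0.
  move=> f0 [_ <-].
  rewrite (@eq_derive_on _ _ _ (off_cone i0 h) f (fun=> 0)) ?derive_cst//.
  exact: open_off_cone.
split; [apply: Z0 d1|apply: Z0 d2|apply: Z0 d3] => p op;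
  by have [] := off_cone_eq0 fing N op.
Qed.

Lemma rot_inj (A x y : R) : cos A * x - sin A * y = 0 -> sin A * x + cos A * y = 0 ->
  x = 0 /\ y = 0.
Proof.
have := cos2Dsin2 A; move: (cos A) (sin A) => C S CS e1 e2; split.
  transitivity ((C ^+ 2 + S ^+ 2) * x); first by rewrite CS mul1r.
  transitivity (C * (C * x - S * y) + S * (S * x + C * y)); first by ring.
  by rewrite e1 e2 !mulr0 addr0.
transitivity ((C ^+ 2 + S ^+ 2) * y); first by rewrite CS mul1r.
transitivity (C * (S * x + C * y) - S * (C * x - S * y)); first by ring.
by rewrite e1 e2 !mulr0 subr0.
Qed.

Lemma xcoord0 i : xcoord (0 : E) i = 0. Proof. by rewrite /xcoord mxE. Qed.
Lemma ycoord0 i : ycoord (0 : E) i = 0. Proof. by rewrite /ycoord mxE. Qed.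

(** A kernel vector is an infinitesimal rotation of the planes: it does not change the squared
    moduli, and it changes [th] by [- da v]. The germ then gives [(1 + P) * da v = 0], with
    [P >= - 1 / 2]. *)
Lemma diff_OM_inj N q v : h i0 * sg q <= 1 -> 'd (OM N) q v = 0 -> v = 0.
Proof.
move=> hs.
have [da [db [dm [a1 [a2 [a3 [P [Q [Z [d1 [ga gb gm] lP]]]]]]]]]] := has_germN h_gt0 fing N hs.
have [dav dbv dmv] := d1 v.
have Ov i := diff_OM fing (dir_der_angle i dav dbv).
move: ('d (OM N) q v) Ov => ov Ov ov0.
pose g i := if i == i0 then da v else h i * db v.
have V i : xcoord v i = g i * ycoord q i /\ ycoord v i = - (g i * xcoord q i).
  have [] := Ov i; rewrite ov0 xcoord0 ycoord0 -/(g i) => e1 e2.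
  have [] := rot_inj (esym e1) (esym e2); split; lra.
have ds0 : dsg q v = 0.
  by rewrite /dsg; have [-> ->] := V i0; ring.
have du0 : duu q v = 0.
  by rewrite /duu big1// => i _; have [-> ->] := V i; ring.
suff [a0 b0] : da v = 0 /\ db v = 0.
  have g0 i : g i = 0 by rewrite /g a0 b0 mulr0; case: ifP.
  by apply: coord_ext => i; rewrite ?(V i).1 ?(V i).2 g0 mul0r ?oppr0 ?xcoord0 ?ycoord0.
have [x0|oq] := cone_cover i0 h q; last by have [] := off_cone_dir_der oq dav dbv dmv.
have s0 : 0 < sg q by rewrite /sg ltr_wpDr ?sqr_ge0// exprn_gt0.
have t0 : dth q v = - da v.
  rewrite /dth; have [-> ->] := V i0; rewrite /g eqxx.
  have -> : xcoord q i0 * - (da v * xcoord q i0) - ycoord q i0 * (da v * ycoord q i0) = - da v * sg q.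
    by rewrite /sg; ring.
  by rewrite mulfK// gt_eqF.
have a0 : da v = 0.
  have := ga v; rewrite ds0 du0 t0 !mulr0 !add0r => e.
  have : (1 + P) * da v = 0 by move: e; lra.
  by move=> /eqP; rewrite mulf_eq0 => /orP[/eqP|/eqP//]; lra.
split=> //; by rewrite gb ds0 du0 t0 a0 oppr0 !mulr0 !addr0.
Qed.

(** A kernel vector is radial in the plane [i0], so it changes neither [th] nor [uu]. The relation
    [germ_m] reduces to [(1 + P) * k = 0]. *)
Lemma diff_NM_inj N q v : h i0 * sg q <= 1 -> 'd (NM N) q v = 0 -> v = 0.
Proof.
move=> hs.
have [da [db [dm [a1 [a2 [a3 [P [Q [Z [d1 [ga gb gm] lP]]]]]]]]]] := has_germN h_gt0 fing N hs.
have [dav dbv dmv] := d1 v.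
have Nv i := diff_NM fing (dir_der_stretch fing i dmv).
move: ('d (NM N) q v) Nv => nv Nv nv0.
have st0 : 0 < stretch N i0 q by rewrite /stretch eqxx sqrtr_gt0 (mu1_gt0 i0 h fing).
have st2 : stretch N i0 q ^+ 2 = 1 + mu N q.
  by rewrite /stretch eqxx sqr_sqrtr// ltW// (mu1_gt0 i0 h fing).
have Vi i : i != i0 -> xcoord v i = 0 /\ ycoord v i = 0.
  move=> ii0; have [] := Nv i; rewrite nv0 xcoord0 ycoord0 (negbTE ii0) !mul0r !add0r.
  by rewrite /stretch (negbTE ii0) !mul1r.
have du0 : duu q v = 0.
  by rewrite /duu big1// => i /Vi[-> ->]; rewrite !mulr0 addr0 mulr0.
have [e1 e2] := Nv i0; rewrite nv0 xcoord0 ycoord0 eqxx in e1 e2.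
move: (stretch N i0 q) st0 st2 e1 e2 => st st0 st2 e1 e2.
pose k := dm v / (2 * (1 + mu N q)).
have stn : st != 0 by rewrite gt_eqF.
have kE : dm v / (2 * st) = st * k.
  by rewrite /k -st2; field.
have xv : xcoord v i0 = - k * xcoord q i0.
  apply: (mulfI stn); move: e1; rewrite kE.
  rewrite (_ : st * k * _ + _ = st * xcoord v i0 + st * (k * xcoord q i0)); last by ring.
  by move=> e; rewrite mulNr mulrN; lra.
have yv : ycoord v i0 = - k * ycoord q i0.
  apply: (mulfI stn); move: e2; rewrite kE.
  rewrite (_ : st * k * _ + _ = st * ycoord v i0 + st * (k * ycoord q i0)); last by ring.
  by move=> e; rewrite mulNr mulrN; lra.
suff k0 : k = 0.
  by apply: coord_ext => i; have [->|/Vi[xi yi]] := eqVneq i i0;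
    rewrite ?xv ?yv ?xi ?yi ?k0 ?oppr0 ?mul0r ?xcoord0 ?ycoord0.
have [x0|oq] := cone_cover i0 h q; last first.
  by have [_ _ dm0] := off_cone_dir_der oq dav dbv dmv; rewrite /k dm0 mul0r.
have s0 : 0 < sg q by rewrite /sg ltr_wpDr ?sqr_ge0// exprn_gt0.
have t0 : dth q v = 0.
  by rewrite /dth xv yv (_ : _ - _ = 0) ?mul0r//; ring.
have dsE : dsg q v = - 2 * k * sg q by rewrite /dsg xv yv /sg; ring.
have := gm v; rewrite du0 t0 !mulr0 !addr0 dsE.
have m1 := mu1_gt0 i0 h fing N q.
have -> : dm v = k * (2 * (1 + mu N q)).
  by rewrite /k divfK// mulf_neq0// gt_eqF.
move=> e; have : (2 * (1 + P) * sg q) * k = 0 by move: e; lra.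
move=> /eqP; rewrite mulf_eq0 => /orP[|/eqP//].
by rewrite gt_eqF// !mulr_gt0//; lra.
Qed.

End DiffInjective.

(** * Polar coordinates and bijectivity of the rotation *)

Section Polar.
Context {R : realType}.
Implicit Types x y r t : R.

Lemma polar_decomp x y : 0 < x -> let r := Num.sqrt (x ^+ 2 + y ^+ 2) in
  x = r * cos (atan (y / x)) /\ y = r * sin (atan (y / x)).
Proof.
move=> x0 r; have x0' : x != 0 by rewrite gt_eqF.
have c0 : 0 < cos (atan (y / x)) by apply: cos_gt0_pihalf; rewrite atan_gtNpi2 atan_ltpi2.
have rx : r * cos (atan (y / x)) = x.
  rewrite cos_atan; have -> : 1 + (y / x) ^+ 2 = (x ^+ 2 + y ^+ 2) / x ^+ 2 by field.
  rewrite sqrtrM ?addr_ge0 ?sqr_ge0// sqrtrV ?sqr_ge0// sqrtr_sqr gtr0_norm// invfM invrK.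
  rewrite mulrA mulfV ?mul1r// gt_eqF// sqrtr_gt0 ltr_wpDr ?sqr_ge0// exprn_gt0//.
split; first by rewrite rx.
have ts : tan (atan (y / x)) = y / x by exact: atanK.
move: c0 rx ts; rewrite /tan; move: (atan _) => A c0 rx ts.
have -> : sin A = y / x * cos A by rewrite -ts divfK// gt_eqF.
by rewrite mulrCA rx divfK.
Qed.

Lemma polar_atan r t : 0 < r -> - (pi / 2) < t < pi / 2 ->
  0 < r * cos t /\ atan ((r * sin t) / (r * cos t)) = t.
Proof.
move=> r0 tpi; have c0 : 0 < cos t by exact: cos_gt0_pihalf.
split; first by rewrite mulr_gt0.
have -> : (r * sin t) / (r * cos t) = tan t by rewrite /tan; field; rewrite !gt_eqF.
by rewrite tanK// in_itv.
Qed.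

End Polar.

Section Rotation.
Context {R : realType} {n : nat} (i0 : 'I_n) (h : 'I_n -> R).
Hypothesis h_gt0 : forall i, 0 < h i.
Context {c w : nat -> R} {B dB : nat -> R -> R}.
Hypothesis fing : pulses c w B dB.
Local Notation E := 'rV[R]_(n + n).
Implicit Types (q v : E) (k N : nat).
Local Notation sg := (@sg R n i0).
Local Notation uu := (@uu R n i0 h).
Local Notation HH := (@HH R n i0 h).
Local Notation th := (@th R n i0).
Local Notation gate := (@gate R n i0).
Local Notation mu := (@mu R n i0 h w dB).
Local Notation al := (@al R n i0 h w B).
Local Notation be := (@be R n i0 h w B).
Local Notation OM := (@OM R n i0 h w B).
Local Notation angle := (@angle R n i0 h w B).

Definition incone q := 0 < xcoord q i0 /\ 0 <= th q <= 2^-1.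

Lemma gate_out f q : conical f -> ~ incone q -> gate f q = 0.
Proof.
move=> fc nq; rewrite /gate; case: ifPn => // x0; apply: fc.
have [t0|t0] := ltP (th q) 0; first by left; exact: ltW.
have [t1|t1] := leP (th q) 2^-1; last by right; exact: ltW.
by exfalso; apply: nq; split => //; rewrite t0.
Qed.

Lemma out_eq0 N q : ~ incone q -> [/\ al N q = 0, be N q = 0 & mu N q = 0].
Proof.
move=> nq; split; rewrite /al /be /mu big1// => k _;
  have [cB cdB] := conicalB fing k.
- by rewrite /alk !(gate_out cB nq) !mulr0 addr0 !mul0r addr0.
- by rewrite /bek (gate_out cB nq) !mulr0 mul0r.
- by rewrite /muk (gate_out cdB nq) mulr0 mul0r.
Qed.

Lemma OM_sqnorm N q i : xcoord (OM N q) i ^+ 2 + ycoord (OM N q) i ^+ 2 =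
  xcoord q i ^+ 2 + ycoord q i ^+ 2.
Proof.
rewrite xcoord_mkE ycoord_mkE; have := cos2Dsin2 (angle N i q).
move: (cos _) (sin _) (xcoord q i) (ycoord q i) => C S x y CS.
by rewrite -[RHS]mul1r -CS; ring.
Qed.

Lemma OM_sg N q : sg (OM N q) = sg q. Proof. exact: OM_sqnorm. Qed.

Lemma OM_uu N q : uu (OM N q) = uu q.
Proof. by apply: eq_bigr => i _; rewrite OM_sqnorm. Qed.

Lemma OM_HH N q : HH (OM N q) = HH q.
Proof. by rewrite /HH OM_sg OM_uu. Qed.

(** The factor of [B k] in [alk], expressed by [s = h i0 * sg] and [H = HH], both preserved by the
    rotation. *)
Definition slope k (s H : R) : R :=
  let y := 2 * s - 1 in let d := 1 - (1 - H) / w k in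
  (flat 0 y + 2 * s * flat 2 y) * flat 0 d + s * flat 0 y * (flat 2 d / w k).

(** The angle in the plane [i0] after the rotation, as a function of the angle before. Its
    derivative is [1] plus the mixed derivative of the generating function. *)
Definition turn N s H t := t + \sum_(k < N) slope k s H * B k t.

Lemma al_turn N q : 0 < xcoord q i0 ->
  th q + al N q = turn N (h i0 * sg q) (HH q) (th q).
Proof.
move=> x0; congr (_ + _); apply: eq_bigr => k _.
rewrite /alk /slope /depth /gate x0 /yy -!mulrA; ring.
Qed.

Lemma turn_lt N s H t t' : 0 <= s <= 1 -> t < t' -> turn N s H t < turn N s H t'.
Proof.
move=> s01 tt'.
pose dt x := 1 + \sum_(k < N) slope k s H * dB k x.
apply: (increasing_derive tt' (df := dt)) => x _.
  apply: dir_der_is_derive; apply: dir_derD; first exact: dir_der_id.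
  apply: dir_der_sum => k _.
  have [_ _ [_ _ Bd _ _ _ _]] := fing k.
  apply: dir_der_eq; first exact: (dir_derM (dir_der_cst x 1 _) (is_derive_dir_der (Bd x))).
  by rewrite mul0r add0r.
have : - \sum_(k < N) (4 * 2 ^+ k)^-1 <= \sum_(k < N) slope k s H * dB k x.
  rewrite -sumrN; apply: ler_sum => k _.
  have [_ _ [_ _ _ _ dge _ _]] := fing k.
  exact: (slope_bound fing _ _ s01 (dge x)).
by have := @pulse_sum_le R N; rewrite /dt; lra.
Qed.

Lemma turn_le N s H t t' : 0 <= s <= 1 -> t <= t' -> turn N s H t <= turn N s H t'.
Proof.
move=> s01; rewrite le_eqVlt => /predU1P[->//|tt']; apply/ltW; exact: turn_lt.
Qed.

Lemma turn0 N s H : turn N s H 0 = 0.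
Proof.
rewrite /turn big1 ?addr0// => k _; have [cB _] := conicalB fing k.
by rewrite cB ?mulr0//; left.
Qed.

Lemma turn_half N s H : turn N s H 2^-1 = 2^-1.
Proof.
rewrite /turn big1 ?addr0// => k _; have [cB _] := conicalB fing k.
by rewrite cB ?mulr0//; right.
Qed.

Lemma half_pihalf (t : R) : 0 <= t <= 2^-1 -> - (pi / 2) < t < pi / 2.
Proof.
move=> /andP[t0 t1]; have p2 := @pi_ge2 R; have : pi / 2 = 2^-1 * pi :> R by rewrite mulrC.
by move: (pi / 2) => p ->; apply/andP; split; lra.
Qed.

Lemma sg_gt0 q : 0 < xcoord q i0 -> 0 < sg q.
Proof. by move=> x0; rewrite /sg ltr_wpDr ?sqr_ge0// exprn_gt0. Qed.

Lemma OM_incone N q : h i0 * sg q <= 1 -> incone q ->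
  incone (OM N q) /\ th (OM N q) = turn N (h i0 * sg q) (HH q) (th q).
Proof.
move=> hs [x0 t01]; have s0 := sg_gt0 x0.
have hs01 : 0 <= h i0 * sg q <= 1 by rewrite hs andbT mulr_ge0// ltW.
set T := turn _ _ _ _.
have T01 : 0 <= T <= 2^-1.
  have /andP[t0 t1] := t01.
  rewrite -{1}(turn0 N (h i0 * sg q) (HH q)) -{1}(turn_half N (h i0 * sg q) (HH q)).
  by rewrite !turn_le.
have r0 : 0 < Num.sqrt (sg q) by rewrite sqrtr_gt0.
have [] := polar_decomp (ycoord q i0) x0; rewrite -/(sg q) -/(th q) => xE yE.
have XE : xcoord (OM N q) i0 = Num.sqrt (sg q) * cos T.
  rewrite xcoord_mkE /angle eqxx /T -al_turn// addrC cosD.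
  by rewrite {1}xE {1}yE; ring.
have YE : ycoord (OM N q) i0 = Num.sqrt (sg q) * sin T.
  rewrite ycoord_mkE /angle eqxx /T -al_turn// addrC sinD.
  by rewrite {1}xE {1}yE; ring.
have [p1 p2] := polar_atan r0 (half_pihalf T01).
by rewrite /incone /th XE YE p2.
Qed.

Lemma OM_out N q : ~ incone q -> OM N q = q.
Proof.
move=> nq; have [a0 b0 _] := out_eq0 N nq.
have g0 i : angle N i q = 0 by rewrite /angle a0 b0 mulr0; case: ifP.
by apply: coord_ext => i; rewrite ?xcoord_mkE ?ycoord_mkE g0 cos0 sin0; ring.
Qed.

Lemma be_eq N q q' : 0 < xcoord q i0 -> 0 < xcoord q' i0 -> sg q = sg q' ->
  uu q = uu q' -> th q = th q' -> be N q = be N q'.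
Proof.
move=> x0 x0' sE uE tE; apply: eq_bigr => k _.
by rewrite /bek /depth /gate /yy /HH x0 x0' sE uE tE.
Qed.

(** As [sg], [uu] and [HH] are invariant, equal images force equal values of [turn], hence equal
    angles in the plane [i0]. All rotation angles then agree and can be undone. *)
Lemma OM_inj N q q' : h i0 * sg q <= 1 -> OM N q = OM N q' -> q = q'.
Proof.
move=> hs OE.
have sE : sg q = sg q' by rewrite -(OM_sg N q) OE OM_sg.
have uE : uu q = uu q' by rewrite -(OM_uu N q) OE OM_uu.
have HE : HH q = HH q' by rewrite /HH sE uE.
have hs' : h i0 * sg q' <= 1 by rewrite -sE.
have [cq'|nq'] := pselect (incone q'); last first.
  have [cq|nq] := pselect (incone q); last by rewrite -(OM_out N nq) OE (OM_out N nq').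
  by exfalso; apply: (nq'); have [] := OM_incone N hs cq; rewrite OE (OM_out N nq').
have [cq|nq] := pselect (incone q); last first.
  by exfalso; apply: (nq); have [] := OM_incone N hs' cq'; rewrite -OE (OM_out N nq).
have [x0 _] := cq; have [x0' _] := cq'.
have [_ t1] := OM_incone N hs cq; have [_ t2] := OM_incone N hs' cq'.
have hs01 : 0 <= h i0 * sg q <= 1 by rewrite hs andbT mulr_ge0// ltW// sg_gt0.
have tE : th q = th q'.
  have tt : turn N (h i0 * sg q) (HH q) (th q) = turn N (h i0 * sg q) (HH q) (th q').
    by rewrite -t1 OE t2 sE HE.
  by case: (ltgtP (th q) (th q')) => // /(turn_lt N (HH q) hs01); rewrite tt ltxx.
have bE := be_eq N x0 x0' sE uE tE.
have aE : al N q = al N q'.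
  by apply: (addrI (th q)); rewrite {2}tE !al_turn// sE HE tE.
have gE i : angle N i q = angle N i q' by rewrite /angle aE bE.
have rot i : xcoord q i = xcoord q' i /\ ycoord q i = ycoord q' i.
  have := congr1 (fun p => xcoord p i) OE; have := congr1 (fun p => ycoord p i) OE.
  rewrite !xcoord_mkE !ycoord_mkE gE.
  have := cos2Dsin2 (angle N i q'); move: (cos _) (sin _) => C S CS.
  move: (xcoord q i) (ycoord q i) (xcoord q' i) (ycoord q' i) => x y x' y' e1 e2.
  split.
    transitivity ((C ^+ 2 + S ^+ 2) * x); first by rewrite CS mul1r.
    transitivity (C * (C * x - S * y) + S * (S * x + C * y)); first by ring.
    rewrite e1 e2; transitivity ((C ^+ 2 + S ^+ 2) * x'); first by ring.
    by rewrite CS mul1r.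
  transitivity ((C ^+ 2 + S ^+ 2) * y); first by rewrite CS mul1r.
  transitivity (C * (S * x + C * y) - S * (C * x - S * y)); first by ring.
  rewrite e1 e2; transitivity ((C ^+ 2 + S ^+ 2) * y'); first by ring.
  by rewrite CS mul1r.
by apply: coord_ext => i; have [] := rot i.
Qed.

Lemma continuous_turn N s H : continuous (turn N s H).
Proof.
move=> x; apply: differentiable_continuous.
suff [] : dir_der (turn N s H) x 1 (1 + \sum_(k < N) slope k s H * dB k x) by [].
apply: dir_derD; first exact: dir_der_id.
apply: dir_der_sum => k _; have [_ _ [_ _ Bd _ _ _ _]] := fing k.
apply: dir_der_eq; first exact: (dir_derM (dir_der_cst x 1 _) (is_derive_dir_der (Bd x))).
by rewrite mul0r add0r.
Qed.

(** [turn] fixes both ends of the interval from [0] to [1 / 2], so the intermediate value theorem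
    gives the angle in the plane [i0]; the other planes are rotated back by an angle that is then
    known. *)
Lemma OM_surj N z : h i0 * sg z <= 1 -> exists q, OM N q = z.
Proof.
move=> hs; have [[x0 z01]|nz] := pselect (incone z); last first.
  by exists z; exact: OM_out.
have s0 := sg_gt0 x0; set s := h i0 * sg z; set H := HH z.
have hs01 : 0 <= s <= 1 by rewrite hs andbT mulr_ge0// ltW.
have [t t01 tE] : exists2 t, 0 <= t <= 2^-1 & turn N s H t = th z.
  have p1 : 0 <= 2^-1 :> R by rewrite invr_ge0.
  have p2 : {within `[0, 2^-1], continuous (turn N s H)}.
    exact/continuous_subspaceT/continuous_turn.
  have p3 : Num.min (turn N s H 0) (turn N s H 2^-1) <= th z
      <= Num.max (turn N s H 0) (turn N s H 2^-1).
    by rewrite turn0 turn_half min_l ?max_r.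
  by have [t] := IVT p1 p2 p3; rewrite in_itv /= => t01; exists t.
have r0 : 0 < Num.sqrt (sg z) by rewrite sqrtr_gt0.
have [p1 p2] := polar_atan r0 (half_pihalf t01).
(* The value of [be N] at the preimage, available before the preimage is built because it depends
   only on the invariants and on [t]. *)
pose b := \sum_(k < N) sg z * (flat 0 (2 * s - 1) * B k t) * (flat 2 (1 - (1 - H) / w k) / w k).
pose q := mkE (fun i => if i == i0 then Num.sqrt (sg z) * cos t else
     cos (h i * b) * xcoord z i + sin (h i * b) * ycoord z i)
   (fun i => if i == i0 then Num.sqrt (sg z) * sin t else
     - sin (h i * b) * xcoord z i + cos (h i * b) * ycoord z i).
have qx : xcoord q i0 = Num.sqrt (sg z) * cos t by rewrite xcoord_mkE eqxx.
have qy : ycoord q i0 = Num.sqrt (sg z) * sin t by rewrite ycoord_mkE eqxx.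
have qx0 : 0 < xcoord q i0 by rewrite qx.
have qt : th q = t by rewrite /th qx qy.
have qs : sg q = sg z.
  rewrite /sg qx qy !exprMn -mulrDr cos2Dsin2 mulr1 sqr_sqrtr// ltW//.
have qu : uu q = uu z.
  apply: eq_bigr => i ii0; congr (_ * _); rewrite xcoord_mkE ycoord_mkE (negbTE ii0).
  have := cos2Dsin2 (h i * b); move: (cos _) (sin _) => C S CS.
  by rewrite -[RHS]mul1r -CS; ring.
have qH : HH q = HH z by rewrite /HH qs qu.
have qb : be N q = b.
  apply: eq_bigr => k _; rewrite /bek /depth /gate qx0 qt qs qH /yy.
  by rewrite qs /s -(mulrA 2).
have aE : turn N s H t = t + al N q.
  by rewrite -[in RHS]qt al_turn// qt qs qH.
exists q; apply: coord_ext => i; have [ii0|ii0] := eqVneq i i0.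
- rewrite ii0 xcoord_mkE /angle eqxx qx qy.
  have [-> _] := polar_decomp (ycoord z i0) x0; rewrite -/(sg z) -/(th z).
  by rewrite -tE aE cosD; ring.
- rewrite xcoord_mkE /angle (negbTE ii0) qb xcoord_mkE ycoord_mkE (negbTE ii0).
  have := cos2Dsin2 (h i * b); move: (cos _) (sin _) => C S CS.
  by rewrite -[RHS]mul1r -CS; ring.
- rewrite ii0 ycoord_mkE /angle eqxx qx qy.
  have [_ ->] := polar_decomp (ycoord z i0) x0; rewrite -/(sg z) -/(th z).
  by rewrite -tE aE sinD; ring.
- rewrite ycoord_mkE /angle (negbTE ii0) qb xcoord_mkE ycoord_mkE (negbTE ii0).
  have := cos2Dsin2 (h i * b); move: (cos _) (sin _) => C S CS.
  by rewrite -[RHS]mul1r -CS; ring.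
Qed.

End Rotation.

(** * The image of the ellipsoid *)

Section Radial.
Context {R : realType} {n : nat} (i0 : 'I_n) (h : 'I_n -> R).
Hypothesis h_gt0 : forall i, 0 < h i.
Context {c w : nat -> R} {B dB : nat -> R -> R}.
Hypothesis fing : pulses c w B dB.
Hypothesis sep : forall k l, k != l -> 2 * (w k + w l) <= `|c k - c l|.
Local Notation E := 'rV[R]_(n + n).
Implicit Types (q v z : E) (k N : nat).
Local Notation sg := (@sg R n i0).
Local Notation uu := (@uu R n i0 h).
Local Notation HH := (@HH R n i0 h).
Local Notation th := (@th R n i0).
Local Notation gate := (@gate R n i0).
Local Notation mu := (@mu R n i0 h w dB).
Local Notation muk := (@muk R n i0 h w dB).
Local Notation NM := (@NM R n i0 h w dB).
Local Notation stretch := (@stretch R n i0 h w dB).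

Let w0 k : 0 < w k. Proof. by have [/andP[]] := fing k. Qed.

Lemma sg_ge0 q : 0 <= sg q. Proof. by rewrite addr_ge0 ?sqr_ge0. Qed.

Lemma uu_ge0 q : 0 <= uu q.
Proof. by rewrite sumr_ge0// => i _; rewrite mulr_ge0 ?addr_ge0 ?sqr_ge0// ltW. Qed.

Lemma HH_ge0 q : 0 <= HH q.
Proof. by rewrite addr_ge0 ?uu_ge0// mulr_ge0 ?sg_ge0// ltW. Qed.

Definition dil (l : R) z : E :=
  mkE (fun i => if i == i0 then l * xcoord z i else xcoord z i)
      (fun i => if i == i0 then l * ycoord z i else ycoord z i).

Lemma dil_x l z : xcoord (dil l z) i0 = l * xcoord z i0.
Proof. by rewrite xcoord_mkE eqxx. Qed.

Lemma dil_y l z : ycoord (dil l z) i0 = l * ycoord z i0.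
Proof. by rewrite ycoord_mkE eqxx. Qed.

Lemma dil_sg l z : sg (dil l z) = l ^+ 2 * sg z.
Proof. by rewrite /sg dil_x dil_y; ring. Qed.

Lemma dil_uu l z : uu (dil l z) = uu z.
Proof.
by apply: eq_bigr => i ii0; rewrite xcoord_mkE ycoord_mkE (negbTE ii0).
Qed.

Lemma dil_th l z : 0 < l -> th (dil l z) = th z.
Proof.
move=> l0; rewrite /th dil_x dil_y; congr atan.
by rewrite -mulf_div mulfV ?mul1r// gt_eqF.
Qed.

Lemma dil_gate f l z : 0 < l -> gate f (dil l z) = gate f z.
Proof. by move=> l0; rewrite /gate dil_th// dil_x pmulr_rgt0. Qed.

Lemma dil_dil l m z : dil l (dil m z) = dil (l * m) z.
Proof.
apply: coord_ext => i; rewrite !(xcoord_mkE, ycoord_mkE); case: eqVneq => // _;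
  by rewrite mulrA.
Qed.

Lemma dil1 z : dil 1 z = z.
Proof.
by apply: coord_ext => i; rewrite !(xcoord_mkE, ycoord_mkE) mul1r; case: ifP.
Qed.

Lemma NM_dil N q : NM N q = dil (Num.sqrt (1 + mu N q)) q.
Proof.
apply: coord_ext => i; rewrite !(xcoord_mkE, ycoord_mkE) /stretch;
  by case: ifP => // _; rewrite mul1r.
Qed.

Lemma NM_sg N q : sg (NM N q) = sg q * (1 + mu N q).
Proof.
by rewrite NM_dil dil_sg sqr_sqrtr 1?mulrC// ltW// (mu1_gt0 i0 h fing).
Qed.

Lemma NM_uu N q : uu (NM N q) = uu q. Proof. by rewrite NM_dil dil_uu. Qed.

(* [radial g] is the new squared radius as a function of the old one, where [g]
   collects the values of the [dB k] at the angle under consideration. *)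
Definition radial N (g : nat -> R) (u s : R) : R :=
  s * (1 + \sum_(k < N) flat 0 (2 * h i0 * s - 1) * g k * flat 0 (1 - (1 - (h i0 * s + u)) / w k)).

Lemma NM_radial N q : sg (NM N q) = radial N (fun k => gate (dB k) q) (uu q) (sg q).
Proof. by rewrite NM_sg. Qed.

(** The derivative in [s] is [1] plus a sum with the same coefficients [slope] as for [turn], hence
    at least [1 / 2]. *)
Lemma radial_lt N g u s s' : (forall k, - (w k / (52 * 2 ^+ k)) <= g k) ->
  0 <= s < s' -> h i0 * s' <= 1 -> radial N g u s < radial N g u s'.
Proof.
move=> gk /andP[s0 ss'] hs'; have h0 := h_gt0 i0.
pose dr x := 1 + \sum_(k < N) slope (w := w) k (h i0 * x) (h i0 * x + u) * g k.
apply: (increasing_derive ss' (df := dr)) => x /andP[sx xs'].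
  apply: dir_der_is_derive; apply: dir_der_eq.
    apply: dir_derM; first exact: dir_der_id.
    apply: dir_derD; first exact: dir_der_cst.
    apply: dir_der_sum => k _.
    apply: dir_derM.
      apply: dir_derM; last exact: dir_der_cst.
      apply: (dir_der_comp (is_derive_flat0 _)).
      apply: dir_derB; last exact: dir_der_cst.
      by apply: dir_derM; [exact: dir_der_cst|exact: dir_der_id].
    apply: (dir_der_comp (is_derive_flat0 _)).
    apply: dir_derB; first exact: dir_der_cst.
    apply: dir_derM; last exact: dir_der_cst.
    apply: dir_derB; first exact: dir_der_cst.
    apply: dir_derD; last exact: dir_der_cst.
    by apply: dir_derM; [exact: dir_der_cst|exact: dir_der_id].
  rewrite /dr mul1r add0r -addrA mulr_sumr -big_split /=; congr (_ + _).
  by apply: eq_bigr => k _; rewrite /slope (mulrA 2 (h i0) x); ring.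
have hx : 0 <= h i0 * x <= 1.
  rewrite mulr_ge0 ?(ltW h0) ?(le_trans s0)//=.
  by rewrite (le_trans _ hs')// ler_pM2l.
have : - \sum_(k < N) (4 * 2 ^+ k)^-1 <= \sum_(k < N) slope (w := w) k (h i0 * x) (h i0 * x + u) * g k.
  rewrite -sumrN; apply: ler_sum => k _; exact: (slope_bound fing _ _ hx (gk k)).
by have := @pulse_sum_le R N; rewrite /dr; lra.
Qed.

Lemma gate_ge k q : - (w k / (52 * 2 ^+ k)) <= gate (dB k) q.
Proof.
have [_ _ [_ _ _ _ dge _ _]] := fing k; rewrite /gate; case: ifP => // _.
by rewrite oppr_le0 divr_ge0 ?mulr_ge0 ?exprn_ge0// ltW.
Qed.

(** Points with the same image are dilates of each other in the plane [i0], so they share [uu] and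
    all gates; along such a ray [radial] is strictly increasing. *)
Lemma NM_inj N q q' : h i0 * sg q <= 1 -> h i0 * sg q' <= 1 -> NM N q = NM N q' -> q = q'.
Proof.
wlog sqq : q q' / sg q <= sg q' => [hw hs hs' NE|].
  by have [|/ltW] := leP (sg q) (sg q') => ?; [exact: hw|apply/esym; exact: hw].
move=> hs hs' NE; have [l0 l0'] := (mu1_gt0 i0 h fing N q, mu1_gt0 i0 h fing N q').
have qE : q = dil (Num.sqrt (1 + mu N q') / Num.sqrt (1 + mu N q)) q'.
  rewrite mulrC -dil_dil -NM_dil -NE NM_dil dil_dil mulVf ?dil1//.
  by rewrite gt_eqF// sqrtr_gt0.
have r0 : 0 < Num.sqrt (1 + mu N q') / Num.sqrt (1 + mu N q) by rewrite divr_gt0// sqrtr_gt0.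
move: (_ / _) r0 qE => r r0 qE.
have gE k : gate (dB k) q = gate (dB k) q' by rewrite qE dil_gate.
have uE : uu q = uu q' by rewrite qE dil_uu.
have sE : sg q = sg q'.
  apply/eqP; rewrite eq_le sqq /= leNgt; apply/negP => lt.
  have := @radial_lt N (fun k => gate (dB k) q') (uu q') (sg q) (sg q') (fun k => gate_ge k q').
  rewrite sg_ge0 lt => /(_ isT hs').
  rewrite -NM_radial -NE NM_radial uE.
  rewrite (_ : (fun k => gate (dB k) q) = (fun k => gate (dB k) q')) ?ltxx//.
  by apply/funext => k.
have [s0|s0] := eqVneq (sg q') 0.
  have z0 p : sg p = 0 -> xcoord p i0 = 0 /\ ycoord p i0 = 0.
    move=> /eqP; rewrite paddr_eq0 ?sqr_ge0// !sqrf_eq0 => /andP[/eqP ? /eqP ?] //.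
  have [x0 y0] := z0 _ s0.
  rewrite qE; apply: coord_ext => i; rewrite !(xcoord_mkE, ycoord_mkE);
    by case: eqVneq => // ->; rewrite ?x0 ?y0 mulr0.
suff r1 : r = 1 by rewrite qE r1 dil1.
have : r ^+ 2 = 1.
  by apply: (mulIf s0); rewrite mul1r -dil_sg -qE.
by move=> /eqP; rewrite sqrf_eq1 => /orP[/eqP//|/eqP]; lra.
Qed.

Definition hit k z := 0 < xcoord z i0 /\ `|th z - c k| < w k.

Lemma hit_unique k l t : `|t - c k| < w k -> `|t - c l| < w l -> k = l.
Proof.
move=> tk tl; have [//|/sep kl] := eqVneq k l; exfalso; move: kl.
have := ler_normD (c k - t) (t - c l); rewrite addrA subrK (distrC (c k) t).
have := w0 k; have := w0 l; lra.
Qed.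

Lemma finger_out k t : ~ `|t - c k| < w k -> B k t = 0 /\ dB k t = 0.
Proof.
move=> /negP; rewrite -leNgt; have [_ _ [_ _ _ supp _ _ _]] := fing k; exact: supp.
Qed.

(** The sum of all [dB k] at the angle of [z]. The supports being disjoint, the one term that can be
    nonzero is selected, so that no series has to converge. *)
Definition profile z : R :=
  if pselect (exists k, hit k z) is left ex then dB (xget 0%N [set k | hit k z]) (th z) else 0.

Lemma profile_hit k z : hit k z -> profile z = dB k (th z).
Proof.
move=> hk; rewrite /profile; case: pselect => [_|]; last by case; exists k.
case: xgetP => [l _ /= [_ hl]|/(_ k) []//].
by rewrite (@hit_unique l k (th z)) //; case: hk.
Qed.

Lemma profile_out z : (forall k, ~ hit k z) -> profile z = 0.
Proof. by move=> nh; rewrite /profile; case: pselect => // -[k /nh]. Qed.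

Lemma gate_out_hit k z : ~ hit k z -> gate (B k) z = 0 /\ gate (dB k) z = 0.
Proof.
rewrite /gate /hit; case: ifP => // x0 nk; apply: finger_out => ?.
by apply: nk.
Qed.

(** The truncation omits the term [k] only when [k >= N]; the second alternative then makes that
    term [0] at [q]. *)
Lemma mu_hit N k q : hit k q -> (k < N)%N \/ w k <= 1 - HH q ->
  mu N q = flat 0 (2 * h i0 * sg q - 1) * dB k (th q) * flat 0 (1 - (1 - HH q) / w k).
Proof.
move=> hk kN; have [x0 _] := hk.
have other j : j != k -> muk j q = 0.
  move=> jk; rewrite /muk (gate_out_hit _).2 ?mulr0 ?mul0r// => hj.
  by move/eqP: jk; apply; case: hj hk => _ h1 [_ h2]; exact: (hit_unique h1 h2).
have kE : muk k q = flat 0 (2 * h i0 * sg q - 1) * dB k (th q) * flat 0 (1 - (1 - HH q) / w k).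
  by rewrite /muk /gate x0.
rewrite -kE; have [kN'|Nk] := ltnP k N.
  by rewrite /mu (bigD1 (Ordinal kN'))//= big1 ?addr0// => j jk; exact: other.
have {kN} wk : w k <= 1 - HH q by case: kN => //; rewrite ltnNge Nk.
rewrite /mu big1 => [|j _]; last by apply: other; rewrite ltn_eqF// (leq_trans _ Nk).
by rewrite /muk /depth [flat 0 (1 - _)]flat_le0 ?mulr0// subr_le0 ler_pdivlMr// mul1r.
Qed.

Lemma mu_out N q : (forall k, ~ hit k q) -> mu N q = 0.
Proof.
by move=> nh; rewrite /mu big1// => k _; rewrite /muk (gate_out_hit (nh k)).2 mulr0 mul0r.
Qed.

(** The value of [h i0 * sg * flat 0 yy * flat 0 depth] on [HH = 1], where [h i0 * sg = 1 - u] and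
    the depth is [1]. *)
Definition Lam (u : R) : R := (1 - u) * flat 0 (1 - 2 * u) * flat 0 1.

Definition newU : set E := [set z | HH z < 1 + Lam (uu z) * profile z].

Lemma dil_hit l k z : 0 < l -> hit k (dil l z) <-> hit k z.
Proof. by move=> l0; rewrite /hit dil_th// dil_x pmulr_rgt0. Qed.

Definition radial1 (k : nat) (b u s : R) : R :=
  s * (1 + flat 0 (2 * h i0 * s - 1) * b * flat 0 (1 - (1 - (h i0 * s + u)) / w k)).

Lemma radial1_lt k b u s s' : - (w k / (52 * 2 ^+ k)) <= b ->
  0 <= s < s' -> h i0 * s' <= 1 -> radial1 k b u s < radial1 k b u s'.
Proof.
move=> bk ss hs; pose g j := if j == k then b else 0.
have gk j : - (w j / (52 * 2 ^+ j)) <= g j.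
  rewrite /g; case: eqVneq => [->//|_].
  by rewrite oppr_le0 divr_ge0 ?mulr_ge0 ?exprn_ge0// ltW.
have := @radial_lt k.+1 g u s s' gk ss hs.
have rE x : radial k.+1 g u x = radial1 k b u x.
  rewrite /radial /radial1 (bigD1 ord_max)//= /g eqxx big1 ?addr0// => j jk.
  by rewrite ifN ?mulr0 ?mul0r// (inj_eq val_inj (j : 'I_k.+1) ord_max).
by rewrite !rE.
Qed.

Lemma radial1_top k b u : u <= 1 -> h i0 * radial1 k b u ((1 - u) / h i0) = 1 - u + Lam u * b.
Proof.
move=> u1; have h0 : h i0 != 0 by rewrite gt_eqF.
have e : h i0 * ((1 - u) / h i0) = 1 - u by rewrite mulrC divfK.
rewrite /radial1 /Lam (mulrA (h i0)) e -(mulrA 2) e subrK subrr mul0r subr0.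
have -> : 2 * (1 - u) - 1 = 1 - 2 * u by ring.
by ring.
Qed.

Lemma Lam_ge0 u : 0 <= Lam u.
Proof.
rewrite /Lam; have [u1|u1] := leP u 2^-1.
  by rewrite !mulr_ge0 ?flat_ge0//; lra.
by rewrite [flat 0 (1 - _)]flat_le0 ?mulr0 ?mul0r//; lra.
Qed.

Lemma Lam_eq0 u : 2^-1 <= u -> Lam u = 0.
Proof. by move=> u1; rewrite /Lam [flat 0 (1 - _)]flat_le0 ?mulr0 ?mul0r//; lra. Qed.

Lemma newU_out z : (forall k, ~ hit k z) -> newU z <-> HH z < 1.
Proof. by move=> nh; rewrite /newU /= profile_out// mulr0 addr0. Qed.

(** At fixed angle and [uu < 1], the bound on [sg] is the image under [radial1] of the endpoint
    [(1 - uu) / h i0] of the ellipsoid. For [uu >= 1] the factor [Lam] is [0] and nothing is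
    added. *)
Lemma newU_hit k z : hit k z -> newU z <-> uu z < 1 /\
  sg z < radial1 k (dB k (th z)) (uu z) ((1 - uu z) / h i0).
Proof.
move=> hk; rewrite /newU /= (profile_hit hk); have [u1|u1] := ltP (uu z) 1; last first.
  rewrite Lam_eq0 ?mul0r ?addr0; last by lra.
  split=> [|[]//]; rewrite ltNge => /negP; case.
  by rewrite (le_trans u1)// lerDr mulr_ge0 ?sg_ge0// ltW.
have -> : (HH z < 1 + Lam (uu z) * dB k (th z)) =
    (sg z < radial1 k (dB k (th z)) (uu z) ((1 - uu z) / h i0)).
  rewrite -(ltr_pM2l (h_gt0 i0) (sg z)) radial1_top ?ltW// /HH.
  by apply/idP/idP; lra.
by split=> [|[]].
Qed.

Lemma NM_newU N q : HH q < 1 -> (forall k, (N <= k)%N -> w k <= 1 - HH q) -> newU (NM N q).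
Proof.
move=> H1 adm; have l0 : 0 < Num.sqrt (1 + mu N q) by rewrite sqrtr_gt0 (mu1_gt0 i0 h fing).
have [[k hk]|nh] := pselect (exists k, hit k q); last first.
  have {}nh k : ~ hit k q by move=> hk; apply: nh; exists k.
  have NE : NM N q = q by rewrite NM_dil mu_out// addr0 sqrtr1 dil1.
  by rewrite NE; apply/newU_out.
have h0 := h_gt0 i0; have s0 := sg_ge0 q; have u0 := uu_ge0 q.
apply/(@newU_hit k); first by rewrite NM_dil; apply/dil_hit.
rewrite NM_uu NM_sg (mu_hit hk); last first.
  by have [?|?] := ltnP k N; [left|right; exact: adm].
have u1 : uu q < 1.
  by apply: le_lt_trans H1; rewrite lerDr mulr_ge0// ltW.
split=> //; rewrite NM_dil dil_th//.
apply: (@radial1_lt k (dB k (th q)) (uu q) (sg q)).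
- by have [_ _ [_ _ _ _ dge _ _]] := fing k.
- by rewrite s0 /= ltr_pdivlMr// mulrC; move: H1; rewrite /HH; lra.
- by rewrite mulrC divfK ?gt_eqF//; lra.
Qed.

Lemma continuous_radial1 k b u : continuous (radial1 k b u).
Proof.
have idc j : Ck_on j [set: R] (fun x : R => x).
  case: j => [|j]; first by move=> x _; exact: cvg_id.
  split=> [x _|v]; first exact: ex_diff.
  apply: eq_Ck_on (Ck_on_cst j setT v) => // [|x _]; first exact: openT.
  by rewrite derive_id.
have oT : open [set: R] := openT.
suff cc : Ck_on 1 setT (radial1 k b u) by move=> x; exact: (Ck_on_continuous cc I).
have cst (a : R) := Ck_on_cst 1 [set: R] a.
have lin (a : R) := Ck_onM oT (cst a) (idc 1%N).
apply: (Ck_onM oT (idc 1%N)); apply: (Ck_onD oT (cst 1)).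
apply: (Ck_onM oT (Ck_onM oT (Ck_on_flat 0 oT (Ck_onB oT (lin _) (cst 1))) (cst b))).
apply: (Ck_on_flat 0 oT (Ck_onB oT (cst 1) (Ck_onM oT _ (cst (w k)^-1)))).
exact: (Ck_onB oT (cst 1) (Ck_onD oT (lin _) (cst u))).
Qed.

(** The intermediate value theorem for [radial1] along the ray. One [q] serves every admissible
    truncation, as the map without truncation requires. *)
Lemma NM_surj z : newU z -> exists2 q, HH q < 1 &
  forall N, (forall k, (N <= k)%N -> w k <= 1 - HH q) -> NM N q = z.
Proof.
move=> Uz; have [[k hk]|nh] := pselect (exists k, hit k z); last first.
  have {}nh k : ~ hit k z by move=> hk; apply: nh; exists k.
  exists z; first exact/newU_out.
  by move=> N _; rewrite NM_dil mu_out// addr0 sqrtr1 dil1.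
have [u1 zs] := (newU_hit hk).1 Uz; have h0 := h_gt0 i0.
have [x0 _] := hk; have s0 : 0 < sg z := sg_gt0 x0.
set b := dB k (th z) in zs; set u := uu z in u1 zs; set sm := (1 - u) / h i0 in zs.
have bk : - (w k / (52 * 2 ^+ k)) <= b.
  by have [_ _ [_ _ _ _ dge _ _]] := fing k; exact: dge.
have sm0 : 0 < sm by rewrite divr_gt0// subr_gt0.
have r0 : radial1 k b u 0 = 0 by rewrite /radial1 mul0r.
have rc : {within `[0, sm], continuous (radial1 k b u)}.
  exact/continuous_subspaceT/continuous_radial1.
have rz : Num.min (radial1 k b u 0) (radial1 k b u sm) <= sg z <=
    Num.max (radial1 k b u 0) (radial1 k b u sm).
  have rs : 0 <= radial1 k b u sm by apply: ltW (lt_trans s0 zs).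
  by rewrite r0 min_l// max_r// !ltW.
have [s + sE] := IVT (ltW sm0) rc rz; rewrite in_itv /= => /andP[s00 ssm].
have {}s00 : 0 < s.
  rewrite lt_neqAle s00 andbT eq_sym; apply/eqP => se; move: sE s0.
  by rewrite se r0 => <-; rewrite ltxx.
have {}ssm : s < sm.
  rewrite lt_neqAle ssm andbT; apply/eqP => se; move: sE zs.
  by rewrite se => ->; rewrite ltxx.
pose l := Num.sqrt (s / sg z).
have l0 : 0 < l by rewrite sqrtr_gt0 divr_gt0.
pose q := dil l z.
have qs : sg q = s by rewrite dil_sg sqr_sqrtr ?divfK ?gt_eqF// divr_ge0 ?ltW.
have qu : uu q = u by rewrite dil_uu.
have qH : HH q < 1.
  rewrite /HH qs qu; move: ssm; rewrite /sm ltr_pdivlMr// mulrC; lra.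
exists q => // N adm; have hq : hit k q by apply/dil_hit.
have muE : s * (1 + mu N q) = sg z.
  rewrite (mu_hit hq); last by have [?|?] := ltnP k N; [left|right; exact: adm].
  by rewrite /HH qs qu /q dil_th// -/b.
rewrite NM_dil dil_dil -[RHS]dil1; congr dil.
have m0 : 0 <= 1 + mu N q by rewrite ltW// (mu1_gt0 i0 h fing).
rewrite /l -sqrtrM// -[RHS]sqrtr1; congr Num.sqrt.
by rewrite mulrA (mulrC _ s) muE mulfV// gt_eqF.
Qed.

End Radial.

(** A cluster point of [g] at [z0] lies in [K] and is mapped to [z0] by [f], so it is [g z0]; a
    filter on a compact set with a single cluster point converges to it. *)
Lemma continuous_inverse_compact (T U : topologicalType) (K : set T)
    (f : T -> U) (g : U -> T) (z0 : U) :
  hausdorff_space T -> hausdorff_space U -> compact K -> nbhs (g z0) K ->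
  (forall q, K q -> {for q, continuous f}) ->
  (\forall z \near z0, K (g z) /\ f (g z) = z) ->
  (forall q, K q -> f q = z0 -> q = g z0) -> {for z0, continuous g}.
Proof.
move=> hT hU cK nK fc gK uniq.
have FK : (g @ z0) K by apply: filterS gK => z [].
have clP q : cluster (g @ z0) q -> q = g z0.
  move=> cq; have Kq : K q.
    apply: (compact_closed hT cK); move=> V nV.
    exact: cq FK nV.
  apply: uniq => //; apply: hU => A A' nA nA'.
  have nfA : nbhs q (f @^-1` A) by exact: (fc q Kq A nA).
  have nfA' : \forall z \near z0, (f @^-1` A') (g z).
    near=> z => /=; have [_ ->] : K (g z) /\ f (g z) = z by near: z.
    by near: z.
  by have [p [pA' pA]] := cq _ _ nfA' nfA; exists (f p).
have PF : ProperFilter (g @ z0) by exact: fmap_proper_filter.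
apply: (compact_cluster_set1 hT cK nK PF FK).
apply/seteqP; split=> [q /clP|_ ->]; first by move=> ->.
by have [q [Kq cq]] := cK _ PF FK; rewrite -(clP q cq).
Unshelve. all: by end_near. Qed.

Lemma eq_diff_on (R : realType) (V W : normedModType R) (U : set V) (f g : V -> W) x v :
  open U -> U x -> (forall y, U y -> f y = g y) -> differentiable g x ->
  'd f x v = 'd g x v.
Proof.
move=> oU Ux fg gd.
have fd : differentiable f x.
  apply: differentiable_near gd; near=> y; apply/esym/fg.
  by near: y; exact: open_nbhs_nbhs.
by rewrite -!deriveE//; exact: eq_derive_on fg Ux.
Unshelve. all: by end_near. Qed.

Lemma sum_ord_stable (R : realType) (F : nat -> R) N M :
  (forall k, (N <= k)%N -> F k = 0) -> (N <= M)%N -> \sum_(k < M) F k = \sum_(k < N) F k.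
Proof.
move=> F0 NM; rewrite -!(big_mkord xpredT F) (big_cat_nat (n := N))//=.
by rewrite [X in _ + X]big_nat [X in _ + X]big1 ?addr0// => k /andP[/F0].
Qed.

(** * The maps with all pulses on the open ellipsoid *)

Section Global.
Context {R : realType} {n : nat} (i0 : 'I_n) (h : 'I_n -> R).
Hypothesis h_gt0 : forall i, 0 < h i.
Context {c w : nat -> R} {B dB : nat -> R -> R}.
Hypothesis fing : pulses c w B dB.
Hypothesis sep : forall k l, k != l -> 2 * (w k + w l) <= `|c k - c l|.
Hypothesis wsmall : forall e : R, 0 < e -> exists N, forall k, (N <= k)%N -> w k < e.
Local Notation E := 'rV[R]_(n + n).
Implicit Types (q v z p : E) (k N : nat).
Local Notation sg := (@sg R n i0).
Local Notation uu := (@uu R n i0 h).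
Local Notation HH := (@HH R n i0 h).
Local Notation th := (@th R n i0).
Local Notation gate := (@gate R n i0).
Local Notation mu := (@mu R n i0 h w dB).
Local Notation al := (@al R n i0 h w B).
Local Notation be := (@be R n i0 h w B).
Local Notation OM := (@OM R n i0 h w B).
Local Notation NM := (@NM R n i0 h w dB).
Local Notation newU := (@newU R n i0 h c w dB).
Local Notation profile := (@profile R n i0 c w dB).
Local Notation hit := (@hit R n i0 c w).

Let w0 k : 0 < w k. Proof. by have [/andP[]] := fing k. Qed.

Definition adm N (tau : R) := forall k, (N <= k)%N -> w k <= tau.

(** The truncation index depends on the point only through [1 - HH]. The rotation preserves [HH], so
    two points with the same image use the same index. *)
Definition Nf (tau : R) : nat := xget 0%N [set N | adm N tau].

Lemma adm_Nf tau : 0 < tau -> adm (Nf tau) tau.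
Proof.
move=> /wsmall[N NP]; rewrite /Nf; case: xgetP => [M _ //|/(_ N)[]].
by move=> k /NP /ltW.
Qed.

Lemma adm_terms N q : adm N (1 - HH q) -> forall k, (N <= k)%N -> forall j, flat j (@depth R n i0 h w k q) = 0.
Proof.
move=> adN k /adN wk j; rewrite flat_le0// /depth subr_le0 ler_pdivlMr// mul1r//.
Qed.

Lemma adm_eq N M q : adm N (1 - HH q) -> adm M (1 - HH q) ->
  OM N q = OM M q /\ NM N q = NM M q.
Proof.
wlog NM_ : N M / (N <= M)%N => [hw aN aM|aN aM].
  have [NM_|/ltnW MN] := leqP N M; first exact: hw.
  by have [-> ->] := hw M N MN aM aN.
have t := adm_terms aN.
have mE : mu N q = mu M q.
  apply/esym/(sum_ord_stable (F := fun k => @muk R n i0 h w dB k q)) => // k Nk.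
  by rewrite /muk t// mulr0.
have aE : al N q = al M q.
  apply/esym/(sum_ord_stable (F := fun k => @alk R n i0 h w B k q)) => // k Nk.
  by rewrite /alk !t// mul0r !mulr0 addr0.
have bE : be N q = be M q.
  apply/esym/(sum_ord_stable (F := fun k => @bek R n i0 h w B k q)) => // k Nk.
  by rewrite /bek !t// mul0r mulr0.
split; apply: coord_ext => i; rewrite !(xcoord_mkE, ycoord_mkE).
- by rewrite /angle aE bE.
- by rewrite /angle aE bE.
- by rewrite /stretch mE.
- by rewrite /stretch mE.
Qed.

Definition E0 : set E := [set q | HH q < 1].

Lemma continuous_HH : continuous HH.
Proof. by apply: smooth_continuous => k; exact: smooth_HH openT. Qed.

Lemma open_HH_lt (r : R) : open [set q | HH q < r].
Proof.
have := @open_comp _ _ HH [set t | t < r]; apply; last exact: open_lt.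
by move=> q _; exact: continuous_HH.
Qed.

(** Local finiteness: on a sublevel set [HH < 1 - tau] one index serves all points, because only
    finitely many [w k] exceed [tau]. *)
Lemma adm_local q : E0 q -> exists N V, [/\ open V, V q, V `<=` E0 & forall p, V p -> adm N (1 - HH p)].
Proof.
move=> q1; pose tau := (1 - HH q) / 2.
have tau0 : 0 < tau by rewrite divr_gt0// subr_gt0.
have [N NP] := wsmall tau0; exists N, [set p | HH p < 1 - tau]; split.
- exact: open_HH_lt.
- by move: q1; rewrite /E0 /tau /=; lra.
- by move=> p; rewrite /E0 /=; lra.
- by move=> p /= pt k /NP; lra.
Qed.

Definition Omap q := OM (Nf (1 - HH q)) q.
Definition Nmap q := NM (Nf (1 - HH q)) q.

Lemma map_adm N q : E0 q -> adm N (1 - HH q) -> Omap q = OM N q /\ Nmap q = NM N q.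
Proof. by move=> q1 aN; apply: adm_eq => //; apply: adm_Nf; rewrite subr_gt0. Qed.

Lemma map_local q : E0 q -> exists N V, [/\ open V, V q, V `<=` E0 &
  forall p, V p -> Omap p = OM N p /\ Nmap p = NM N p].
Proof.
move=> /adm_local[N [V [oV Vq VE aV]]]; exists N, V; split => // p Vp.
by apply: map_adm (aV p Vp); exact: VE.
Qed.

Lemma hs_le1 q : E0 q -> h i0 * sg q <= 1.
Proof.
move=> q1; apply: ltW (le_lt_trans _ q1); rewrite lerDl; exact: uu_ge0.
Qed.

Lemma open_E0 : open E0. Proof. exact: open_HH_lt. Qed.

Lemma smooth_Omap k : Ck_on k E0 Omap.
Proof.
apply: Ck_on_local => q /map_local[N [V [oV Vq VE fE]]]; exists V => //.
apply: (@eq_Ck_on _ _ _ _ _ (OM N)) => // [p /fE[]//|].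
by apply: subset_Ck_on (smooth_OM i0 h fing N k).
Qed.

Lemma smooth_Nmap k : Ck_on k E0 Nmap.
Proof.
apply: Ck_on_local => q /map_local[N [V [oV Vq VE fE]]]; exists V => //.
apply: (@eq_Ck_on _ _ _ _ _ (NM N)) => // [p /fE[]//|].
by apply: subset_Ck_on (smooth_NM i0 h fing N k).
Qed.

Lemma diff_Omap_inj q v : E0 q -> 'd Omap q v = 0 -> v = 0.
Proof.
move=> q1; have [N [V [oV Vq VE fE]]] := map_local q1.
rewrite (@eq_diff_on _ _ _ V _ (OM N)) => // [|p /fE[]//|]; last exact: differentiable_OM.
by apply: diff_OM_inj => //; exact: hs_le1.
Qed.

Lemma diff_Nmap_inj q v : E0 q -> 'd Nmap q v = 0 -> v = 0.
Proof.
move=> q1; have [N [V [oV Vq VE fE]]] := map_local q1.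
rewrite (@eq_diff_on _ _ _ V _ (NM N)) => // [|p /fE[]//|]; last exact: (differentiable_NM i0 h fing).
by apply: diff_NM_inj => //; exact: hs_le1.
Qed.

Lemma omega_maps q u v : E0 q ->
  omega0 ('d Nmap q u) ('d Nmap q v) = omega0 ('d Omap q u) ('d Omap q v).
Proof.
move=> q1; have [N [V [oV Vq VE fE]]] := map_local q1.
have dN y : 'd Nmap q y = 'd (NM N) q y.
  by apply: (@eq_diff_on _ _ _ V) => // [p /fE[]//|]; exact: (differentiable_NM i0 h fing).
have dO y : 'd Omap q y = 'd (OM N) q y.
  by apply: (@eq_diff_on _ _ _ V) => // [p /fE[]//|]; exact: differentiable_OM.
refine (@eq_trans _ _ (omega0 ('d (NM N) q u) ('d (NM N) q v)) _ _ _).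
  exact (f_equal2 omega0 (dN u) (dN v)).
refine (@eq_trans _ _ (omega0 ('d (OM N) q u) ('d (OM N) q v)) _ _ _).
  exact (omega_pair h_gt0 fing N u v (hs_le1 q1)).
exact (f_equal2 omega0 (esym (dO u)) (esym (dO v))).
Qed.

Lemma Omap_HH q : HH (Omap q) = HH q. Proof. exact: OM_HH. Qed.

Lemma Omap_inj q q' : E0 q -> Omap q = Omap q' -> q = q'.
Proof.
move=> q1 OE; have HE : HH q = HH q' by rewrite -(Omap_HH q) OE Omap_HH.
move: OE; rewrite /Omap -HE; apply: OM_inj => //; exact: hs_le1.
Qed.

Definition Oinv z := xget 0 [set q | E0 q /\ Omap q = z].

Lemma OinvP z : E0 z -> E0 (Oinv z) /\ Omap (Oinv z) = z.
Proof.
move=> z1; have [q qz] := @OM_surj _ _ _ _ h_gt0 _ _ _ _ fing (Nf (1 - HH z)) z (hs_le1 z1).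
have HE : HH q = HH z by rewrite -qz OM_HH.
rewrite /Oinv; case: xgetP => [p _ //|/(_ q)[]]; split; first by rewrite /E0 /= HE.
by rewrite /Omap HE.
Qed.

Lemma Nmap_newU q : E0 q -> newU (Nmap q).
Proof.
by move=> q1; apply: (NM_newU h_gt0 fing sep) => //; apply: adm_Nf; rewrite subr_gt0.
Qed.

Lemma Nmap_inj q q' : E0 q -> E0 q' -> Nmap q = Nmap q' -> q = q'.
Proof.
move=> q1 q1'; have a1 := adm_Nf (ltac:(by rewrite subr_gt0) : 0 < 1 - HH q).
have a2 := adm_Nf (ltac:(by rewrite subr_gt0) : 0 < 1 - HH q').
pose N := maxn (Nf (1 - HH q)) (Nf (1 - HH q')).
have [_ ->] : Omap q = OM N q /\ Nmap q = NM N q.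
  by apply: map_adm => // k Nk; apply: a1; apply: leq_trans Nk; exact: leq_maxl.
have [_ ->] : Omap q' = OM N q' /\ Nmap q' = NM N q'.
  by apply: map_adm => // k Nk; apply: a2; apply: leq_trans Nk; exact: leq_maxr.
by apply: NM_inj => //; exact: hs_le1.
Qed.

Definition Ninv z := xget 0 [set q | E0 q /\ Nmap q = z].

Lemma NinvP z : newU z -> E0 (Ninv z) /\ Nmap (Ninv z) = z.
Proof.
move=> Uz; have [q q1 qz] := NM_surj h_gt0 fing sep Uz.
rewrite /Ninv; case: xgetP => [p _ //|/(_ q)[]]; split => //.
by apply: qz; apply: adm_Nf; rewrite subr_gt0.
Qed.

Lemma compact_HH_le (r : R) : compact [set q | HH q <= r].
Proof.
apply: bounded_closed_compact; last first.
  have := @closed_comp _ _ HH [set t | t <= r]; apply; last exact: closed_le.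
  by move=> q _; exact: continuous_HH.
have [M M0 MP] : exists2 M, 0 <= M & forall i, `|r| / h i <= M.
  exists (\sum_i `|r| / h i) => [|i].
    by rewrite sumr_ge0// => i _; rewrite divr_ge0// ltW.
  by rewrite (bigD1 i)//= lerDl sumr_ge0// => j _; rewrite divr_ge0// ltW.
have sqb q i : HH q <= r -> h i * (xcoord q i ^+ 2 + ycoord q i ^+ 2) <= `|r|.
  move=> qr; apply: le_trans (ler_norm r); apply: le_trans qr.
  have [->|ii0] := eqVneq i i0; first by rewrite lerDl; exact: uu_ge0.
  rewrite /HH /uu (bigD1 i)//= addrCA lerDl addr_ge0//.
    by rewrite mulr_ge0 ?sg_ge0// ltW.
  by rewrite sumr_ge0// => j _; rewrite mulr_ge0 ?addr_ge0 ?sqr_ge0// ltW.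
have cb q i : HH q <= r -> xcoord q i ^+ 2 <= M /\ ycoord q i ^+ 2 <= M.
  move=> /(sqb q i); rewrite -ler_pdivlMl// mulrC => s; have := MP i.
  have := sqr_ge0 (xcoord q i); have := sqr_ge0 (ycoord q i).
  by split; lra.
exists (M + 1); split; first exact: num_real.
move=> K MK q /= qr; apply: normr_rV_le => [|j].
  by rewrite ltW// (le_lt_trans _ MK)// addr_ge0.
have sq_le (x : R) : x ^+ 2 <= M -> `|x| <= K.
  move=> xM; apply: (@le_trans _ _ (M + 1)); last exact: ltW.
  rewrite -real_normK ?num_real// in xM.
  have := sqr_ge0 (`|x| - 1); have := normr_ge0 x; nra.
by case: (fintype.split_ordP j) => i ->; apply: sq_le; have [] := cb q i qr.
Qed.

Lemma nbhs_HH_le q (r : R) : HH q < r -> nbhs q [set p | HH p <= r].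
Proof.
move=> qr; apply: (@filterS _ _ _ [set p | HH p < r]); first by move=> p /ltW.
by apply: open_nbhs_nbhs; split => //; exact: open_HH_lt.
Qed.

Lemma rV_hausdorff : hausdorff_space E. Proof. exact: norm_hausdorff. Qed.

(** Properness is immediate here: the rotation preserves [HH], so the inverse stays in a compact
    sublevel set. *)
Lemma continuous_Oinv z : E0 z -> {for z, continuous Oinv}.
Proof.
move=> z1; pose r := (1 + HH z) / 2.
have z1' : HH z < 1 := z1.
have zr : HH z < r by rewrite /r; lra.
have r1 : r < 1 by rewrite /r; lra.
have OH p : E0 p -> HH (Oinv p) = HH p.
  by move=> p1; rewrite -[LHS]Omap_HH (OinvP p1).2.
apply: (@continuous_inverse_compact _ _ [set q | HH q <= r] Omap).
- exact: rV_hausdorff.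
- exact: rV_hausdorff.
- exact: compact_HH_le.
- by apply: nbhs_HH_le; rewrite OH.
- move=> q /= qr; apply: (Ck_on_continuous (smooth_Omap 0)).
  by rewrite /E0 /= (le_lt_trans qr).
- have : \forall p \near z, HH p < r.
    by apply: open_nbhs_nbhs; split => //; exact: open_HH_lt.
  apply: filterS => p pr; have p1 : E0 p by exact: lt_trans pr r1.
  by rewrite /= OH// ltW//; split => //; exact: (OinvP p1).2.
- move=> q /= qr qz; have [oz1 oz2] := OinvP z1.
  apply: Omap_inj; first by rewrite /E0 /= (le_lt_trans qr).
  by rewrite qz oz2.
Qed.

Lemma smooth_Oinv k : Ck_on k E0 Oinv.
Proof.
suff : Ck_on k.+1 E0 Oinv by exact: Ck_onW.
apply: (@Ck_on_inverse _ _ k E0 E0 Omap).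
- exact: open_E0.
- exact: open_E0.
- exact: OinvP.
- exact: continuous_Oinv.
- by move=> q q1 v; exact: diff_Omap_inj.
- exact: smooth_Omap.
Qed.

End Global.

(** * Topology of the new domain *)

Section Topology.
Context {R : realType} {n : nat} (i0 : 'I_n) (h : 'I_n -> R).
Hypothesis h_gt0 : forall i, 0 < h i.
Context {c w : nat -> R} {B dB : nat -> R -> R}.
Hypothesis fing : pulses c w B dB.
Hypothesis sep : forall k l, k != l -> 2 * (w k + w l) <= `|c k - c l|.
Hypothesis wsmall : forall e : R, 0 < e -> exists N, forall k, (N <= k)%N -> w k < e.
Local Notation E := 'rV[R]_(n + n).
Implicit Types (q v z p : E) (k N : nat).
Local Notation sg := (@sg R n i0).
Local Notation uu := (@uu R n i0 h).
Local Notation HH := (@HH R n i0 h).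
Local Notation th := (@th R n i0).
Local Notation gate := (@gate R n i0).
Local Notation newU := (@newU R n i0 h c w dB).
Local Notation profile := (@profile R n i0 c w dB).
Local Notation hit := (@hit R n i0 c w).

Let w0 k : 0 < w k. Proof. by have [/andP[]] := fing k. Qed.

Lemma eta_le k : w k / (52 * 2 ^+ k) <= 52^-1.
Proof.
have [/andP[_ w1] _ _] := fing k.
have p1 : 1 <= (2 ^+ k : R) by rewrite exprn_ege1// ler1n.
have p0 : 0 < (2 ^+ k : R) by rewrite (lt_le_trans _ p1).
rewrite ler_pdivrMr ?mulr_gt0// mulrA mulVf// mul1r (le_trans w1)//.
Qed.

Lemma eta_lew k : w k / (52 * 2 ^+ k) <= w k.
Proof.
have p1 : 1 <= (2 ^+ k : R) by rewrite exprn_ege1// ler1n.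
have p0 : 0 < (2 ^+ k : R) by rewrite (lt_le_trans _ p1).
rewrite ler_pdivrMr ?mulr_gt0// ler_peMr ?(ltW (w0 k))//; lra.
Qed.

Lemma profile_bounds z : - 52^-1 <= profile z <= 2.
Proof.
have [[k hk]|nh] := pselect (exists k, hit k z).
  rewrite (profile_hit fing sep hk); have [_ _ [_ _ _ _ dge dle _]] := fing k.
  have := dge (th z); have := dle (th z); have := eta_le k; lra.
rewrite profile_out; first by rewrite oppr_le0 invr_ge0 !ler0n.
by move=> k hk; apply: nh; exists k.
Qed.

Lemma Lam_le1 u : 0 <= u -> @Lam R u <= 1.
Proof.
move=> u0; have [u1|u1] := leP u 2^-1; last by rewrite Lam_eq0 ?ltW.
rewrite /Lam !mulr_ile1 ?mulr_ge0 ?flat_ge0 ?flat0_le1//; lra.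
Qed.

Lemma Lam_le u u' : 0 <= u <= u' -> @Lam R u' <= Lam u.
Proof.
move=> /andP[u0 uu']; have [u1|u1] := leP u' 2^-1; last first.
  by rewrite [leLHS]Lam_eq0 ?Lam_ge0// ltW.
rewrite /Lam ler_wpM2r ?flat_ge0//; apply: ler_pM; rewrite ?flat_ge0//; try lra.
by apply: flat0_nondecreasing; lra.
Qed.

(** [9 = 1 + 4 * 2]: the slope of [1 - u], plus the Lipschitz constant [4] of [flat 0] times the
    slope of [1 - 2 * u]. *)
Lemma Lam_lipschitz u u' : 0 <= u <= u' -> @Lam R u - Lam u' <= 9 * (u' - u).
Proof.
move=> /andP[u0 uu']; have [u1|u1] := leP 2^-1 u.
  by rewrite !Lam_eq0 ?subrr ?mulr_ge0 ?subr_ge0// (le_trans u1).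
have [u'1|u'1] := leP u' 1; last first.
  by rewrite [X in _ - X]Lam_eq0; [have := Lam_le1 u0; lra|lra].
have f1 := flat0_le1 (1 : R); have f10 := flat_ge0 0 (1 : R).
have e0 := flat_ge0 0 (1 - 2 * u); have e1 := flat0_le1 (1 - 2 * u).
have e2 : flat 0 (1 - 2 * u) - flat 0 (1 - 2 * u') <= 8 * (u' - u).
  have := flat0_lipschitz (1 - 2 * u) (1 - 2 * u').
  rewrite (_ : 1 - 2 * u - (1 - 2 * u') = 2 * (u' - u)); last by ring.
  rewrite [in leRHS]ger0_norm ?mulr_ge0 ?subr_ge0//.
  by move=> hh; have := ler_norm (flat 0 (1 - 2 * u) - flat 0 (1 - 2 * u')); lra.
have e3 : 0 <= flat 0 (1 - 2 * u) - flat 0 (1 - 2 * u').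
  by rewrite subr_ge0; apply: flat0_nondecreasing; lra.
have -> : @Lam R u - Lam u' = ((u' - u) * flat 0 (1 - 2 * u) +
   (1 - u') * (flat 0 (1 - 2 * u) - flat 0 (1 - 2 * u'))) * flat 0 1.
  by rewrite /Lam; ring.
apply: (@le_trans _ _ (((u' - u) * 1 + 1 * (8 * (u' - u))) * 1)); last by lra.
apply: ler_pM => //.
  by rewrite addr_ge0// mulr_ge0//; lra.
apply: lerD; first by rewrite ler_wpM2l// subr_ge0.
by apply: ler_pM => //; lra.
Qed.

Lemma scale_coord l z i : xcoord (l *: z) i = l * xcoord z i /\ ycoord (l *: z) i = l * ycoord z i.
Proof. by rewrite /xcoord /ycoord !mxE. Qed.

Lemma scale_sg l z : sg (l *: z) = l ^+ 2 * sg z.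
Proof. by rewrite /sg; have [-> ->] := scale_coord l z i0; ring. Qed.

Lemma scale_uu l z : uu (l *: z) = l ^+ 2 * uu z.
Proof.
rewrite /uu mulr_sumr; apply: eq_bigr => i _; have [-> ->] := scale_coord l z i; ring.
Qed.

Lemma scale_HH l z : HH (l *: z) = l ^+ 2 * HH z.
Proof. by rewrite /HH scale_sg scale_uu; ring. Qed.

Lemma scale_th l z : 0 < l -> th (l *: z) = th z.
Proof.
move=> l0; rewrite /th; have [-> ->] := scale_coord l z i0; congr atan.
by rewrite -mulf_div mulfV ?mul1r// gt_eqF.
Qed.

Lemma scale_hit l k z : 0 < l -> hit k (l *: z) <-> hit k z.
Proof.
by move=> l0; rewrite /hit scale_th//; have [-> _] := scale_coord l z i0; rewrite pmulr_rgt0.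
Qed.

Lemma scale_profile l z : 0 < l -> profile (l *: z) = profile z.
Proof.
move=> l0; have [[k hk]|nh] := pselect (exists k, hit k z).
  by rewrite (profile_hit fing sep hk) (@profile_hit _ _ _ _ _ _ _ fing sep k) ?scale_th//; apply/scale_hit.
rewrite !profile_out// => k hk; apply: nh; exists k => //; first exact/(scale_hit _ _ l0).
Qed.

(** The profile is constant on the ray, and [HH] is multiplied by [l ^+ 2]. For a nonnegative
    profile the left side can only decrease, since [Lam] does; for a negative one it grows by at
    most [9 / 52] of the increment of [uu]. *)
Lemma star_strict l z : 1 < l -> ~ newU z ->
  1 + Lam (uu (l *: z)) * profile (l *: z) < HH (l *: z).
Proof.
move=> l1 /negP; rewrite -leNgt => Hz.
have l0 : 0 < l by rewrite (lt_trans _ l1).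
have u0 := uu_ge0 i0 h_gt0 z; have s0 := sg_ge0 i0 z; have h0 := h_gt0 i0.
rewrite scale_profile// scale_uu scale_HH.
have l2 : 1 < l ^+ 2 by rewrite exprn_egt1.
have ul : uu z <= l ^+ 2 * uu z by rewrite ler_peMl// ltW.
have [s00|sp] := eqVneq (sg z) 0.
  have x0 : xcoord z i0 = 0.
    by move/eqP: s00; rewrite paddr_eq0 ?sqr_ge0// !sqrf_eq0 => /andP[/eqP].
  have p0 : profile z = 0.
    by apply: profile_out => k []; rewrite x0 ltxx.
  move: Hz; rewrite p0 !mulr0 !addr0 /HH s00 mulr0 !add0r => Hz.
  by rewrite (lt_le_trans l2)// ler_peMr// ltW// (lt_trans _ l2).
have {}sp : 0 < sg z by rewrite lt_neqAle eq_sym sp.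
have mono : Lam (l ^+ 2 * uu z) * profile z - Lam (uu z) * profile z <= l ^+ 2 * uu z - uu z.
  have uul : 0 <= uu z <= l ^+ 2 * uu z by rewrite u0.
  have L1 := Lam_le uul; have L2 := Lam_lipschitz uul.
  have /andP[pl _] := profile_bounds z.
  rewrite -mulrBl; have [p0|p0] := leP 0 (profile z).
    by apply: (@le_trans _ _ 0); [rewrite mulr_le0_ge0// subr_le0|rewrite subr_ge0].
  move: (Lam _) (Lam _) L1 L2 => a b ab L2.
  move: (profile z) pl p0 => d d1 d0.
  rewrite -mulrNN opprB; apply: (@le_trans _ _ (9 * (l ^+ 2 * uu z - uu z) * 52^-1)); last lra.
  by apply: ler_pM; lra.
have : h i0 * sg z < l ^+ 2 * (h i0 * sg z).
  by rewrite ltr_pMl// mulr_gt0.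
by move: Hz mono; rewrite /HH mulrDr; lra.
Qed.

Lemma newU0 : newU 0.
Proof.
have x0 : xcoord (0 : E) i0 = 0 by rewrite /xcoord mxE.
rewrite /newU /= profile_out ?mulr0 ?addr0; last by move=> k []; rewrite x0 ltxx.
by rewrite -(scale0r (0 : E)) scale_HH expr0n mul0r.
Qed.

Lemma newU_star : star_shaped0 newU.
Proof.
split; first exact: newU0.
move=> z t Uz /andP[t0 t1]; have [->|tn0] := eqVneq t 0.
  by rewrite scale0r; exact: newU0.
have {}t0 : 0 < t by rewrite lt_neqAle eq_sym tn0.
have [->|tn1] := eqVneq t 1; first by rewrite scale1r.
have {}t1 : t < 1 by rewrite lt_neqAle tn1.
apply: contrapT => /(@star_strict t^-1); rewrite invf_gt1// => /(_ t1).
by rewrite scalerA mulVf// scale1r => /lt_trans /(_ Uz); rewrite ltxx.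
Qed.

Lemma newU_HH_le z : newU z -> HH z <= 3.
Proof.
move=> /ltW /le_trans; apply; have /andP[_ p2] := profile_bounds z.
have u0 := uu_ge0 i0 h_gt0 z; have L1 := Lam_le1 u0; have L0 := @Lam_ge0 R (uu z).
have : Lam (uu z) * profile z <= 2; last by lra.
have [p0|p0] := leP 0 (profile z).
  by rewrite -[leRHS]mul1r; apply: ler_pM.
by rewrite (@le_trans _ _ 0)// mulr_ge0_le0// ltW.
Qed.

Lemma closure_newU_HH_le z : closure newU z -> HH z <= 3.
Proof.
have cl : closed [set q | HH q <= 3].
  have := @closed_comp _ _ HH [set t | t <= 3]; apply; last exact: closed_le.
  by move=> q _; exact: continuous_HH.
by move=> Uz; apply: cl; apply: closure_subset Uz => q; exact: newU_HH_le.
Qed.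

Lemma compact_closure_newU : compact (closure newU).
Proof.
apply: (@subclosed_compact _ _ [set q | HH q <= 3]).
- exact: closed_closure.
- exact: compact_HH_le.
- by move=> z; exact: closure_newU_HH_le.
Qed.

Lemma bounded_newU : bounded_set newU.
Proof.
have : bounded_set [set q | HH q <= 3].
  by apply: compact_bounded; exact: compact_HH_le.
by move=> [M [Mr MP]]; exists M; split=> // K /MP MK q /newU_HH_le; exact: MK.
Qed.

End Topology.

Lemma continuous_near (T U : topologicalType) (f g : T -> U) z :
  (\forall p \near z, f p = g p) -> {for z, continuous g} -> {for z, continuous f}.
Proof.
move=> fg gc; have fz : f z = g z := nbhs_singleton fg.
rewrite /prop_for /continuous_at fz.
apply: cvg_trans gc; apply: near_eq_cvg; near=> p; apply/esym; near: p; exact: fg.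
Unshelve. all: by end_near. Qed.

Lemma continuous_near_gt (R : realType) (T : topologicalType) (f : T -> R) z (a : R) :
  {for z, continuous f} -> a < f z -> \forall p \near z, a < f p.
Proof. by move=> fc; exact: cvgr_gt fc _. Qed.

Lemma continuous_near_lt (R : realType) (T : topologicalType) (f : T -> R) z (a : R) :
  {for z, continuous f} -> f z < a -> \forall p \near z, f p < a.
Proof. by move=> fc; exact: cvgr_lt fc _. Qed.

Section Regularity.
Context {R : realType} {n : nat} (i0 : 'I_n) (h : 'I_n -> R).
Hypothesis h_gt0 : forall i, 0 < h i.
Context {c w : nat -> R} {B dB : nat -> R -> R}.
Hypothesis fing : pulses c w B dB.
Hypothesis sep : forall k l, k != l -> 2 * (w k + w l) <= `|c k - c l|.
Hypothesis wsmall : forall e : R, 0 < e -> exists N, forall k, (N <= k)%N -> w k < e.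
Local Notation E := 'rV[R]_(n + n).
Implicit Types (q v z p : E) (k N : nat).
Local Notation sg := (@sg R n i0).
Local Notation uu := (@uu R n i0 h).
Local Notation HH := (@HH R n i0 h).
Local Notation th := (@th R n i0).
Local Notation gate := (@gate R n i0).
Local Notation newU := (@newU R n i0 h c w dB).
Local Notation profile := (@profile R n i0 c w dB).
Local Notation hit := (@hit R n i0 c w).

Let w0 k : 0 < w k. Proof. by have [/andP[]] := fing k. Qed.

(** Polar coordinates in the plane [i0], with the radius and the angle stored in the two coordinates
    of that plane. The formula is smooth on the whole space, hence Lipschitz on bounded sets. *)
Definition Psi p : E :=
  mkE (fun i => if i == i0 then xcoord p i * cos (ycoord p i) else xcoord p i)
      (fun i => if i == i0 then xcoord p i * sin (ycoord p i) else ycoord p i).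

Lemma smooth_Psi k : Ck_on k setT Psi.
Proof.
have oT : open [set: E] := openT.
apply: (@Ck_on_mkE _ _ k setT
  (fun i p => if i == i0 then xcoord p i * cos (ycoord p i) else xcoord p i)
  (fun i p => if i == i0 then xcoord p i * sin (ycoord p i) else ycoord p i)) => // i;
  case: eqP => _; try exact: smooth_xcoord; try exact: smooth_ycoord.
- by apply: Ck_onM => //; [exact: smooth_xcoord|apply: Ck_on_cos => //; exact: smooth_ycoord].
- by apply: Ck_onM => //; [exact: smooth_xcoord|apply: Ck_on_sin => //; exact: smooth_ycoord].
Qed.

Definition slot (r t : R) z : E :=
  mkE (fun i => if i == i0 then r else xcoord z i)
      (fun i => if i == i0 then t else ycoord z i).

Lemma Psi_slot_x r t z : xcoord (Psi (slot r t z)) i0 = r * cos t.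
Proof. by rewrite !(xcoord_mkE, ycoord_mkE) eqxx. Qed.

Lemma Psi_slot_y r t z : ycoord (Psi (slot r t z)) i0 = r * sin t.
Proof. by rewrite !(xcoord_mkE, ycoord_mkE) eqxx. Qed.

Lemma Psi_slot_sg r t z : sg (Psi (slot r t z)) = r ^+ 2.
Proof.
by rewrite /sg Psi_slot_x Psi_slot_y !exprMn -mulrDr cos2Dsin2 mulr1.
Qed.

Lemma Psi_slot_uu r t z : uu (Psi (slot r t z)) = uu z.
Proof.
by apply: eq_bigr => i ii0; rewrite !(xcoord_mkE, ycoord_mkE) !(negbTE ii0).
Qed.

Lemma Psi_slot_th r t z : 0 < r -> - (pi / 2) < t < pi / 2 ->
  0 < xcoord (Psi (slot r t z)) i0 /\ th (Psi (slot r t z)) = t.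
Proof. by rewrite /th Psi_slot_x Psi_slot_y; exact: polar_atan. Qed.

Lemma Psi_slotK z : 0 < xcoord z i0 -> Psi (slot (Num.sqrt (sg z)) (th z) z) = z.
Proof.
move=> x0; have [xE yE] := polar_decomp (ycoord z i0) x0.
apply: coord_ext => i; rewrite !(xcoord_mkE, ycoord_mkE); case: eqVneq => // ->.
  exact: esym xE.
exact: esym yE.
Qed.

Lemma continuous_slot r z (t : R) : {for t, continuous (fun t => slot r t z)}.
Proof.
apply: (@continuous_rV R _ R) => j; case: (fintype.split_ordP j) => i ->.
  apply: (@continuous_near _ _ _ (fun=> if i == i0 then r else xcoord z i)).
    by near=> y; exact: xcoord_mkE.
  exact: cvg_cst.
apply: (@continuous_near _ _ _ (fun t => if i == i0 then t else ycoord z i)).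
  by near=> y; exact: ycoord_mkE.
by case: eqP => _; [exact: cvg_id|exact: cvg_cst].
Unshelve. all: by end_near. Qed.

Lemma continuous_rotation r z (t : R) : {for t, continuous (fun t => Psi (slot r t z))}.
Proof.
apply: continuous_comp; first exact: continuous_slot.
exact: (smooth_Psi 0%N _ I).
Qed.

(** The centers approaching [t] have indices other than [k], so they keep the distance [2 * w k]
    from [c k], and [t] inherits it. *)
Lemma accum_far t k : accum c t -> 2 * w k <= `|t - c k|.
Proof.
move=> ct; rewrite leNgt; apply/negP => lt.
have e0 : 0 < 2 * w k - `|t - c k| by rewrite subr_gt0.
have [l kl ltl] := ct _ k.+1 e0.
have := @sep k l; rewrite ltn_eqF// => /(_ isT).
have := ler_normD (c k - t) (t - c l); rewrite addrA subrK (distrC (c k) t) (distrC t (c l)).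
have := w0 l; lra.
Qed.

Lemma accum_itv t : accum c t -> 0 <= t <= 2^-1.
Proof.
move=> ct; apply/andP; split; rewrite leNgt; apply/negP => lt.
  have [k _] := ct (- t) 0%N (ltac:(lra)); have [_ + _] := fing k; have := w0 k.
  by rewrite ltr_norml; lra.
have [k _] := ct (t - 2^-1) 0%N (ltac:(lra)); have [_ + _] := fing k; have := w0 k.
by rewrite ltr_norml; lra.
Qed.

Lemma not_accum t : ~ accum c t ->
  exists e N, 0 < e /\ forall k, (N <= k)%N -> e <= `|t - c k|.
Proof.
move=> nt; apply: contrapT => no; apply: nt => e N e0.
apply: contrapT => nk; apply: no; exists e, N; split => // k Nk.
by rewrite leNgt distrC; apply/negP => lt; apply: nk; exists k.
Qed.

Lemma continuous_th z : 0 < xcoord z i0 -> {for z, continuous th}.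
Proof. exact: (@smooth_th R n i0 0%N z). Qed.

Lemma continuous_x0 : continuous (fun z => xcoord z i0).
Proof. exact: coord_continuous. Qed.

Lemma continuous_uu : continuous uu.
Proof. by apply: smooth_continuous => k; exact: smooth_uu openT. Qed.

Lemma continuous_Lam_uu : continuous (fun z => Lam (uu z)).
Proof.
apply: smooth_continuous => k; have oT : open [set: E] := openT.
have uk := smooth_uu i0 h k oT; have one := Ck_on_cst k [set: E] (1 : R).
apply: (Ck_onM oT _ (Ck_on_cst k _ _)); apply: (Ck_onM oT (Ck_onB oT one uk)).
by apply: Ck_on_flat => //; apply: (Ck_onB oT one (Ck_onM oT (Ck_on_cst k _ _) uk)).
Qed.

Lemma continuous_dB k : continuous (dB k).
Proof.
have [_ _ [_ sB _ _ _ _ _]] := fing k.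
have idc : Ck_on 0 [set: R] (id : R -> R) by move=> y _; exact: cvg_id.
by move=> x; exact: (sB _ _ _ _ openT idc x I).
Qed.

Lemma continuous_gate k z : 0 < xcoord z i0 -> {for z, continuous (gate (dB k))}.
Proof.
move=> x0; apply: (@continuous_near _ _ _ (dB k \o th)).
  have := continuous_near_gt (@continuous_x0 z) x0.
  by apply: filterS => p p0; rewrite /gate p0.
by apply: continuous_comp; [exact: continuous_th|exact: continuous_dB].
Qed.

Lemma profile_sum N z : (forall k, (N <= k)%N -> ~ hit k z) ->
  profile z = \sum_(k < N) gate (dB k) z.
Proof.
move=> nh; have [[k hk]|no] := pselect (exists k, hit k z); last first.
  have {}no k : ~ hit k z by move=> hk; apply: no; exists k.
  by rewrite profile_out// big1// => k _; rewrite (gate_out_hit fing (no k)).2.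
have kN : (k < N)%N by rewrite ltnNge; apply/negP => /nh.
rewrite (profile_hit fing sep hk) (bigD1 (Ordinal kN))//= big1 ?addr0.
  by rewrite /gate; case: hk => ->.
move=> j jk; rewrite (gate_out_hit fing _).2// => hj; move/eqP: jk; apply.
by apply: val_inj; apply: (hit_unique fing sep hj.2 hk.2).
Qed.

Lemma hit_itv k z : hit k z -> 0 < th z < 2^-1.
Proof.
move=> [_]; have [_ + _] := fing k; have := w0 k; rewrite ltr_norml; lra.
Qed.

Definition bump z := Lam (uu z) * profile z.

(** Where [xcoord] is positive at [i0] and the angle is not an accumulation point, only finitely
    many pulses occur nearby. Elsewhere [bump] vanishes near [z]: at [sg z = 0] because
    [uu z >= 3 / 4] puts [z] where [Lam] is [0], otherwise because the angles of the pulses are not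
    met. *)
Lemma continuous_bump z : 3 / 4 <= HH z -> (0 < xcoord z i0 -> ~ accum c (th z)) ->
  {for z, continuous bump}.
Proof.
move=> Hz nz; have [x0|x0] := ltP 0 (xcoord z i0).
  have [e [N1 [e0 N1P]]] := not_accum (nz x0).
  have [N2 N2P] := wsmall (ltac:(lra) : 0 < e / 2).
  pose N := maxn N1 N2.
  apply: (@continuous_near _ _ _ (fun p => Lam (uu p) * \sum_(k < N) gate (dB k) p)).
    have /cvgrPdist_lt/(_ _ (ltac:(lra) : 0 < e / 2)) := continuous_th x0.
    apply: filterS => p /= pz.
    rewrite /bump (@profile_sum N)// => k; rewrite geq_max => /andP[/N1P h1 /N2P h2] [_ h3].
    have := ler_normD (th z - th p) (th p - c k); rewrite addrA subrK; lra.
  apply: continuousM; first exact: continuous_Lam_uu.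
  have oU : open [set q : E | 0 < xcoord q i0] by apply: open_pos; exact: continuous_x0.
  suff : Ck_on 0 [set q : E | 0 < xcoord q i0] (fun p => \sum_(k < N) gate (dB k) p).
    by move=> /(_ z x0).
  by apply: Ck_on_sum => // k _ p; exact: continuous_gate.
apply: (@continuous_near _ _ _ (cst (0 : R))); last exact: cst_continuous.
have [s0|s0] := eqVneq (sg z) 0.
  have u0 : 2^-1 < uu z by move: Hz; rewrite /HH s0; lra.
  have := continuous_near_gt (@continuous_uu z) u0.
  by apply: filterS => p pu; rewrite /bump Lam_eq0 ?mul0r// ltW.
have oz : 0 < `|ycoord z i0| - xcoord z i0.
  rewrite subr_gt0 lt_neqAle (le_trans x0)// andbT.
  apply: contra s0 => /eqP xE; rewrite /sg.
  have y0 : ycoord z i0 = 0 by apply/eqP; rewrite -normr_le0 -xE.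
  by rewrite xE y0 normr0 expr0n addr0.
have ad : \forall p \near z, 0 < `|ycoord p i0| - xcoord p i0.
  apply: (@continuous_near_gt R _ (fun p : E => `|ycoord p i0| - xcoord p i0) z 0 _ oz).
  have yc : (ycoord p i0) @[p --> z] --> ycoord z i0 by exact: coord_continuous.
  have xc : (xcoord p i0) @[p --> z] --> xcoord z i0 by exact: coord_continuous.
  exact: (cvgB (cvg_comp _ _ yc (@norm_continuous _ R _)) xc).
apply: filterS ad => p; rewrite subr_gt0 => xy.
rewrite /bump profile_out ?mulr0// => k hk; have := hit_itv hk.
by case: hk => x0' _; have [|] := th_off x0' xy; lra.
Qed.

End Regularity.

Section NewDomain.
Context {R : realType} {n : nat} (i0 : 'I_n) (h : 'I_n -> R).
Hypothesis h_gt0 : forall i, 0 < h i.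
Context {c w : nat -> R} {B dB : nat -> R -> R}.
Hypothesis fing : pulses c w B dB.
Hypothesis sep : forall k l, k != l -> 2 * (w k + w l) <= `|c k - c l|.
Hypothesis wsmall : forall e : R, 0 < e -> exists N, forall k, (N <= k)%N -> w k < e.
Local Notation E := 'rV[R]_(n + n).
Implicit Types (q v z p : E) (k N : nat).
Local Notation sg := (@sg R n i0).
Local Notation uu := (@uu R n i0 h).
Local Notation HH := (@HH R n i0 h).
Local Notation th := (@th R n i0).
Local Notation newU := (@newU R n i0 h c w dB).
Local Notation profile := (@profile R n i0 c w dB).
Local Notation bump := (@bump R n i0 h c w dB).
Local Notation hit := (@hit R n i0 c w).
Local Notation Psi := (@Psi R n i0).
Local Notation slot := (@slot R n i0).

Let w0 k : 0 < w k. Proof. by have [/andP[]] := fing k. Qed.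

Lemma bump_ge z e : 0 <= e -> - e <= profile z -> - e <= bump z.
Proof.
move=> e0 pe; have u0 := uu_ge0 i0 h_gt0 z.
have L0 := @Lam_ge0 R (uu z); have L1 := Lam_le1 u0.
rewrite /bump; have [p0|p0] := leP 0 (profile z).
  apply: (@le_trans _ _ 0); first by rewrite oppr_le0.
  exact: (mulr_ge0 L0 p0).
apply: (le_trans pe); rewrite -subr_ge0 -{2}[profile z]mul1r -mulrBl.
apply: mulr_le0; [by rewrite subr_le0|exact: ltW].
Qed.

Lemma HH_low z : HH z < 3 / 4 -> newU z.
Proof.
move=> Hz; have /andP[pz _] := profile_bounds i0 fing sep z.
have i52 : 0 <= 52^-1 :> R by rewrite invr_ge0 ler0n.
have := bump_ge i52 pz; rewrite /newU /bump /=; lra.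
Qed.

Lemma accum_nohit z k : accum c (th z) -> ~ hit k z.
Proof. by move=> /(accum_far fing sep k) far [_]; have := w0 k; lra. Qed.

Lemma continuous_gap z : 3 / 4 <= HH z -> (0 < xcoord z i0 -> ~ accum c (th z)) ->
  {for z, continuous (fun p => 1 + bump p - HH p)}.
Proof.
move=> Hz nz.
have bc : (bump p) @[p --> z] --> bump z by exact: continuous_bump.
have hc : (HH p) @[p --> z] --> HH z by exact: continuous_HH.
have oc : (1 : R) @[p --> z] --> (1 : R) by exact: (@cst_continuous E R 1 z).
exact: (cvgB (cvgD oc bc) hc).
Qed.

(** At an accumulation angle [bump] may jump upwards, but openness only asks for a lower bound: the
    pulses met near [z] have large index, and there [dB k >= - w k] is close to [0]. *)
Lemma near_newU z : newU z -> \forall p \near z, newU p.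
Proof.
move=> Uz; have [Hz|Hz] := ltP (HH z) (3 / 4).
  by apply: filterS (continuous_near_lt (@continuous_HH R n i0 h z) Hz) => p; exact: HH_low.
have [[x0 az]|nz] := pselect (0 < xcoord z i0 /\ accum c (th z)); last first.
  have gz : {for z, continuous (fun p => 1 + bump p - HH p)}.
    by apply: continuous_gap => // x0 az; apply: nz.
  have := continuous_near_gt gz (ltac:(by rewrite subr_gt0) : 0 < 1 + bump z - HH z).
  by apply: filterS => p; rewrite subr_gt0.
have p0 : profile z = 0 by apply: profile_out => k; exact: accum_nohit.
have {}Uz : HH z < 1 by move: Uz; rewrite /newU /= p0 mulr0 addr0.
pose e := (1 - HH z) / 2; have e0 : 0 < e by rewrite /e; lra.
have [N NP] := wsmall e0.
have nearN : \forall p \near z, forall k : 'I_N, ~ hit k p.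
  have FF : Filter (nbhs z) by exact: nbhs_filter.
  apply: (@filter_forall _ _ (fun (k : 'I_N) p => ~ hit k p) _ FF) => k.
  have /cvgrPdist_lt/(_ _ (w0 k)) := continuous_th x0.
  apply: filterS => p pz [_ hp]; have := accum_far fing sep k az.
  have := ler_normD (th z - th p) (th p - c k); rewrite addrA subrK; lra.
have nearH : \forall p \near z, HH p < 1 - e.
  by apply: (continuous_near_lt (@continuous_HH R n i0 h z)); rewrite /e; lra.
near=> p; have : - e <= bump p.
  apply: bump_ge; first exact: ltW.
  have [[k hk]|nh] := pselect (exists k, hit k p); last first.
    by rewrite profile_out ?oppr_le0 ?ltW// => k hk; apply: nh; exists k.
  have [kN|kN] := ltnP k N.
    exfalso; have : forall k : 'I_N, ~ hit k p by near: p; exact: nearN.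
    by move=> /(_ (Ordinal kN)).
  rewrite (profile_hit fing sep hk); have [_ _ [_ _ _ _ + _ _]] := fing k.
  by move=> /(_ (th p)); have := eta_lew fing k; have := NP k kN; lra.
have : HH p < 1 - e by near: p; exact: nearH.
rewrite /newU /bump /=; lra.
Unshelve. all: by end_near. Qed.

Lemma open_newU : open newU.
Proof. by rewrite openE => z; exact: near_newU. Qed.

Lemma not_newU_closure z : (\forall p \near z, ~ newU p) -> ~ closure newU z.
Proof. by move=> nz /(_ _ nz) [p [Up]]. Qed.

(** If [z] were outside, the strict inequality of [star_strict] and the continuity of [bump] would
    put [l *: z] outside the closure for every [l > 1], although these points tend to [z]. *)
Lemma interior_scale z : interior (closure newU) z -> 3 / 4 <= HH z ->
  (0 < xcoord z i0 -> ~ accum c (th z)) -> newU z.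
Proof.
move=> iz Hz nz; apply: contrapT => nU.
have cs : (fun l : R => l *: z) @ (1 : R) --> z.
  by rewrite -[X in _ --> X]scale1r; apply: cvgZl; exact: cvg_id.
have /nbhs_ballP[d /= d0 dP] := cs _ iz.
pose l := 1 + d / 2; have l1 : 1 < l by rewrite /l; lra.
have : closure newU (l *: z).
  by apply: dP; rewrite /ball /= /l opprD addNKr normrN gtr0_norm//; lra.
apply: not_newU_closure.
have l0 : 0 < l by rewrite (lt_trans _ l1).
have gz : {for (l *: z), continuous (fun p => 1 + bump p - HH p)}.
  apply: continuous_gap; last first.
    by have [-> _] := scale_coord l z i0; rewrite pmulr_rgt0// scale_th.
  rewrite scale_HH (le_trans Hz)// ler_peMl ?(HH_ge0 i0 h_gt0)//.
  by rewrite exprn_ege1// ltW.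
have := continuous_near_lt gz (_ : _ < 0); rewrite subr_lt0 => /(_ (star_strict h_gt0 fing sep l1 nU)).
by apply: filterS => p; rewrite subr_lt0 => /ltW; rewrite leNgt => /negP.
Qed.

(** The delicate points are those at accumulation angles, near which the frontier moves out and in
    again. A slight rotation brings [z] to an angle that no pulse meets; there the scaling argument
    applies and gives [HH z < 1]. *)
Lemma interior_closure_newU : interior (closure newU) = newU.
Proof.
apply/seteqP; split => [z iz|z Uz]; last first.
  by apply: filterS (near_newU Uz); exact: subset_closure.
have [Hz|Hz] := ltP (HH z) (3 / 4); first exact: HH_low.
have [[x0 az]|nz] := pselect (0 < xcoord z i0 /\ accum c (th z)); last first.
  by apply: interior_scale => // x0 az; apply: nz.
have p0 : profile z = 0 by apply: profile_out => k; exact: accum_nohit.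
pose rot t := Psi (slot (Num.sqrt (sg z)) t z).
have rotE : rot (th z) = z by exact: Psi_slotK.
have s0 := sg_gt0 x0; have r0 : 0 < Num.sqrt (sg z) by rewrite sqrtr_gt0.
have : \forall t \near th z, interior (closure newU) (rot t).
  apply: (continuous_rotation (r := Num.sqrt (sg z)) (z := z) (t := th z)).
  by rewrite -/(rot _) rotE; exact: (open_nbhs_nbhs (conj (@open_interior _ _) iz)).
move=> /nbhs_ballP[d /= d0 dP].
have [N NP] := wsmall (ltac:(lra) : 0 < d / 4).
have [k Nk ckz] := az (d / 2) N (ltac:(lra)).
(* At distance [3 / 2 * w k] from [c k] the angle is outside the pulse [k], and by the separation it
   is outside all other pulses and not an accumulation point. *)
pose t := c k + 3 / 2 * w k.
have tck : t - c k = 3 / 2 * w k by rewrite /t addrAC subrr add0r.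
have tn : `|t - c k| = 3 / 2 * w k by rewrite tck ger0_norm// mulr_ge0// ltW.
have tI : interior (closure newU) (rot t).
  apply: dP; rewrite /ball /= /t; have := NP k Nk; have := w0 k.
  by move: ckz; rewrite ltr_norml ltr_norml; lra.
have [_ ck _] := fing k.
have tpi : - (pi / 2) < t < pi / 2 by apply: half_pihalf; rewrite /t; have := w0 k; lra.
have [xt tt] := Psi_slot_th i0 z r0 tpi.
have Hrot : HH (rot t) = HH z.
  by rewrite /HH Psi_slot_sg Psi_slot_uu sqr_sqrtr// ltW.
have : newU (rot t).
  apply: interior_scale => //; first by rewrite Hrot.
  move=> _; rewrite tt => /(accum_far fing sep k).
  by rewrite tn; have := w0 k; lra.
rewrite /newU /= Hrot [profile (rot t)]profile_out ?mulr0 ?addr0 => [|l [_]].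
  by rewrite p0 mulr0 addr0.
rewrite tt; have [->|lk] := eqVneq l k.
  by rewrite tn; have := w0 k; lra.
have := sep lk; have := ler_normD (c l - t) (t - c k); rewrite addrA subrK.
by rewrite tn (distrC (c l) t); have := w0 l; have := w0 k; lra.
Qed.

Lemma frontier_cases z : closure newU z -> ~ newU z ->
  (0 < xcoord z i0 /\ accum c (th z)) \/ HH z = 1 + bump z.
Proof.
move=> cz /negP; rewrite -leNgt -/(bump z) => Uz; have [Hz|Hz] := ltP (HH z) (3 / 4).
  by exfalso; have := HH_low Hz; rewrite /newU /= ltNge Uz.
have [az|nz] := pselect (0 < xcoord z i0 /\ accum c (th z)); [by left|right].
have gz : {for z, continuous (fun p => 1 + bump p - HH p)}.
  by apply: continuous_gap => // x0 az; apply: nz.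
apply/eqP; rewrite eq_le Uz andbT leNgt; apply/negP => lt.
apply: not_newU_closure cz.
have := continuous_near_lt gz (_ : _ < 0); rewrite subr_lt0 => /(_ lt).
by apply: filterS => p; rewrite subr_lt0 => /ltW; rewrite leNgt => /negP.
Qed.

(** Rotating [z] to a nearby center raises the profile to [flat 0 1], which brings the point into
    the domain; at the accumulation angle itself the profile is [0]. *)
Lemma frontier_has z : 0 < xcoord z i0 -> accum c (th z) ->
  1 <= HH z < 1 + Lam (uu z) * flat 0 1 -> closure newU z /\ ~ newU z.
Proof.
move=> x0 az /andP[H1 H2]; split; last first.
  rewrite /newU /= profile_out; last by move=> k; exact: accum_nohit.
  by rewrite mulr0 addr0; apply/negP; rewrite -leNgt.
move=> V nV; pose rot t := Psi (slot (Num.sqrt (sg z)) t z).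
have rotE : rot (th z) = z by exact: Psi_slotK.
have s0 := sg_gt0 x0; have r0 : 0 < Num.sqrt (sg z) by rewrite sqrtr_gt0.
have : \forall t \near th z, V (rot t).
  apply: (continuous_rotation (r := Num.sqrt (sg z)) (z := z) (t := th z)).
  by rewrite -/(rot _) rotE.
move=> /nbhs_ballP[d /= d0 dP]; have [k _ ckz] := az d 0%N d0.
exists (rot (c k)); split; last by apply: dP; rewrite /ball /= distrC.
have [_ ck [_ _ _ _ _ _ top]] := fing k.
have cpi : - (pi / 2) < c k < pi / 2 by apply: half_pihalf; have := w0 k; lra.
have [xc tc] := Psi_slot_th i0 z r0 cpi.
have hk : hit k (rot (c k)) by split => //; rewrite tc subrr normr0.
rewrite /newU /= (profile_hit fing sep hk) tc top Psi_slot_uu.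
by rewrite /HH Psi_slot_sg Psi_slot_uu sqr_sqrtr// ltW.
Qed.

End NewDomain.

(** * The symplectomorphism *)

Section InverseStretch.
Context {R : realType} {n : nat} (i0 : 'I_n) (h : 'I_n -> R).
Hypothesis h_gt0 : forall i, 0 < h i.
Context {c w : nat -> R} {B dB : nat -> R -> R}.
Hypothesis fing : pulses c w B dB.
Hypothesis sep : forall k l, k != l -> 2 * (w k + w l) <= `|c k - c l|.
Hypothesis wsmall : forall e : R, 0 < e -> exists N, forall k, (N <= k)%N -> w k < e.
Local Notation E := 'rV[R]_(n + n).
Implicit Types (q v z p : E) (k N : nat).
Local Notation sg := (@sg R n i0).
Local Notation uu := (@uu R n i0 h).
Local Notation HH := (@HH R n i0 h).
Local Notation gate := (@gate R n i0).
Local Notation mu := (@mu R n i0 h w dB).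
Local Notation NM := (@NM R n i0 h w dB).
Local Notation newU := (@newU R n i0 h c w dB).
Local Notation profile := (@profile R n i0 c w dB).
Local Notation hit := (@hit R n i0 c w).
Local Notation dil := (@dil R n i0).
Local Notation E0 := (@E0 R n i0 h).
Local Notation Nmap := (@Nmap R n i0 h w dB).
Local Notation Ninv := (@Ninv R n i0 h w dB).
Local Notation Omap := (@Omap R n i0 h w B).
Local Notation Oinv := (@Oinv R n i0 h w B).
Local Notation radial := (@radial R n i0 h w).

Hypothesis newU_open : open newU.

Lemma Nmap_dil q : exists2 m, 0 < m & Nmap q = dil m q.
Proof.
rewrite /Nmap NM_dil; eexists; last by reflexivity.
by rewrite sqrtr_gt0 (mu1_gt0 i0 h fing).
Qed.

Lemma Nmap_sg q : sg q <= 2 * sg (Nmap q).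
Proof.
rewrite (NM_sg i0 h fing) mulrCA ler_peMr ?sg_ge0//.
by have := mu_ge i0 h fing (Nf (w := w) (1 - HH q)) q; lra.
Qed.

Lemma Nmap_uu q : uu (Nmap q) = uu q. Proof. exact: NM_uu. Qed.

Lemma Nmap_radial l q : 0 < l -> E0 q -> E0 (dil l q) -> exists N g,
  [/\ forall k, - (w k / (52 * 2 ^+ k)) <= g k,
      sg (Nmap q) = radial N g (uu q) (sg q) &
      sg (Nmap (dil l q)) = radial N g (uu q) (sg (dil l q))].
Proof.
move=> l0 q1 p1; set p := dil l q in p1 *.
have a1 := adm_Nf wsmall (ltac:(by rewrite subr_gt0) : 0 < 1 - HH q).
have a2 := adm_Nf wsmall (ltac:(by rewrite subr_gt0) : 0 < 1 - HH p).
pose N := maxn (Nf (w := w) (1 - HH q)) (Nf (w := w) (1 - HH p)).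
have [_ ->] : Omap q = @OM R n i0 h w B N q /\ Nmap q = NM N q.
  by apply: (map_adm fing wsmall) => // k Nk; apply: a1; apply: leq_trans Nk; exact: leq_maxl.
have [_ ->] : Omap p = @OM R n i0 h w B N p /\ Nmap p = NM N p.
  by apply: (map_adm fing wsmall) => // k Nk; apply: a2; apply: leq_trans Nk; exact: leq_maxr.
exists N, (fun k => gate (dB k) q); split => [k||]; first exact: gate_ge.
  exact: (NM_radial i0 h fing).
rewrite (NM_radial i0 h fing) dil_uu; congr radial.
by apply/funext => k; rewrite dil_gate.
Qed.

Lemma Nmap_ray_lt l q : 0 < l -> E0 q -> E0 (dil l q) -> sg q < sg (dil l q) ->
  sg (Nmap q) < sg (Nmap (dil l q)).
Proof.
move=> l0 q1 p1 lt; have [N [g [gk -> ->]]] := Nmap_radial l0 q1 p1.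
by apply: (radial_lt h_gt0 fing) => //; [rewrite sg_ge0|exact: (hs_le1 h_gt0)].
Qed.

Lemma Nmap_ray_le l q : 0 < l -> E0 q -> E0 (dil l q) -> sg (dil l q) <= sg q ->
  sg (Nmap (dil l q)) <= sg (Nmap q).
Proof.
move=> l0 q1 p1; rewrite le_eqVlt => /predU1P[eq|lt].
  by have [N [g [gk -> ->]]] := Nmap_radial l0 q1 p1; rewrite eq.
have qE : q = dil l^-1 (dil l q) by rewrite dil_dil mulVf ?dil1// gt_eqF.
rewrite ltW// [X in _ < sg (Nmap X)]qE; apply: Nmap_ray_lt; rewrite -?qE// invr_gt0//.
Qed.

Lemma smooth_dil l k : Ck_on k setT (dil l).
Proof.
have oT : open [set: E] := openT.
apply: (@Ck_on_mkE _ _ k setT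
  (fun i p => if i == i0 then l * xcoord p i else xcoord p i)
  (fun i p => if i == i0 then l * ycoord p i else ycoord p i)) => // i;
  case: eqP => _; try exact: smooth_xcoord; try exact: smooth_ycoord.
- by apply: Ck_onM => //; [exact: Ck_on_cst|exact: smooth_xcoord].
- by apply: Ck_onM => //; [exact: Ck_on_cst|exact: smooth_ycoord].
Qed.

Lemma continuous_sg : continuous sg.
Proof. by apply: smooth_continuous => k; exact: smooth_sg openT. Qed.

(** The stretch does not preserve [HH], so a barrier is used: a dilate [dil l z] still in the
    ellipsoid whose image has larger [sg] than [z]. For [p] near [z] the image of [dil l p] is still
    beyond [p], and monotonicity along the ray keeps [Ninv p] below [dil l p]. *)
Lemma Ninv_proper z : newU z -> exists2 r, r < 1 & \forall p \near z, HH (Ninv p) <= r.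
Proof.
move=> Uz; have nearU : \forall p \near z, newU p by exact: open_nbhs_nbhs.
have [q1 qz] := NinvP h_gt0 fing sep wsmall Uz; have h0 := h_gt0 i0.
(* At [sg z = 0] there is no ray to follow; the estimate [sg (Ninv p) <= 2 * sg p] suffices. *)
have [s0|s0] := eqVneq (sg z) 0.
  have x0 : xcoord z i0 = 0.
    by move/eqP: s0; rewrite paddr_eq0 ?sqr_ge0// !sqrf_eq0 => /andP[/eqP].
  have u1 : uu z < 1.
    move: Uz; rewrite /newU /= profile_out => [|k [] ]; last by rewrite x0 ltxx.
    by rewrite mulr0 addr0 /HH s0 mulr0 add0r.
  exists ((1 + uu z) / 2); first by lra.
  have fc : {for z, continuous (fun p => 2 * h i0 * sg p + uu p)}.
    have oT : open [set: E] := openT.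
    have : Ck_on 0 setT (fun p => 2 * h i0 * sg p + uu p).
      apply: Ck_onD => //; last exact: smooth_uu.
      by apply: Ck_onM => //; [exact: Ck_on_cst|exact: smooth_sg].
    by move=> /(_ z I).
  have := @continuous_near_lt _ _ _ _ ((1 + uu z) / 2) fc; rewrite s0 mulr0 add0r => nz.
  have {}nz := nz ltac:(lra).
  near=> p; have Up : newU p by near: p; exact: nearU.
have [p1 pz] := NinvP h_gt0 fing sep wsmall Up.
  have pr : 2 * h i0 * sg p + uu p < (1 + uu z) / 2 by near: p; exact: nz.
  have := Nmap_sg (Ninv p); rewrite pz -(ler_pM2l h0) => sp.
  have : uu p = uu (Ninv p) by rewrite -[in LHS]pz Nmap_uu.
  by rewrite /HH; lra.
have {}s0 : 0 < sg z by rewrite lt_neqAle eq_sym s0 sg_ge0.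
set q := Ninv z in q1 qz.
have [m m0 mE] := Nmap_dil q; rewrite qz in mE.
(* The increment puts [HH] of the barrier halfway between [HH q] and [1]. *)
have qs0 : sg q < sg q + (1 - HH q) / (2 * h i0).
  by rewrite ltrDl divr_gt0// ?subr_gt0// mulr_gt0.
set s' := (X in _ < X) in qs0; have s'0 : 0 < s' := le_lt_trans (sg_ge0 i0 q) qs0.
pose l := Num.sqrt (s' / sg z); have l0 : 0 < l by rewrite sqrtr_gt0 divr_gt0.
have ls : sg (dil l z) = s' by rewrite dil_sg sqr_sqrtr ?divfK ?gt_eqF// divr_ge0 ?ltW.
have Hl : HH (dil l z) = (1 + HH q) / 2.
  have uE : uu z = uu q by rewrite -[in LHS]qz Nmap_uu.
  rewrite /HH ls dil_uu uE /s' /HH; field; by rewrite gt_eqF.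
have l1 : E0 (dil l z) by rewrite /E0 /= Hl; move: q1; rewrite /E0 /=; lra.
have lE : dil l z = dil (l * m) q by rewrite mE dil_dil.
have lt0 : sg z < sg (Nmap (dil l z)).
  rewrite -[X in sg X < _]qz lE; apply: Nmap_ray_lt; rewrite -?lE ?ls//.
  exact: mulr_gt0.
pose r := (1 + HH (dil l z)) / 2.
have r1 : r < 1 by move: l1; rewrite /r /E0 /=; lra.
exists r => //.
have dc : {for z, continuous (dil l)} by exact: (smooth_dil l 0%N _ I).
have near1 : \forall p \near z, HH (dil l p) < r.
  apply: (@continuous_near_lt _ _ (HH \o dil l) z).
    by apply: continuous_comp; [exact: dc|exact: continuous_HH].
  by move: l1; rewrite /r /E0 /=; lra.
have near2 : \forall p \near z, 0 < sg (Nmap (dil l p)) - sg p.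
  apply: (@continuous_near_gt _ _ (fun p => sg (Nmap (dil l p)) - sg p) z).
    have c1 : {for z, continuous (Nmap \o dil l)}.
      apply: continuous_comp; first exact: dc.
      exact: (smooth_Nmap i0 h fing wsmall 0%N _ l1).
    have c2 : {for z, continuous (sg \o (Nmap \o dil l))}.
      by apply: continuous_comp; [exact: c1|exact: continuous_sg].
    have c3 : {for z, continuous sg} by exact: continuous_sg.
    exact: (cvgB c2 c3).
  by rewrite subr_gt0.
near=> p; have Up : newU p by near: p; exact: nearU.
have [p1 pz] := NinvP h_gt0 fing sep wsmall Up.
have pr : HH (dil l p) < r by near: p; exact: near1.
have ps : 0 < sg (Nmap (dil l p)) - sg p by near: p; exact: near2.
have [m' m'0 m'E] := Nmap_dil (Ninv p); rewrite pz in m'E.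
have pE : dil l p = dil (l * m') (Ninv p) by rewrite {1}m'E dil_dil.
have p1' : E0 (dil l p) by rewrite /E0 /= (lt_trans pr).
have lm0 : 0 < l * m' by exact: mulr_gt0.
have [le|lt] := leP (sg (dil l p)) (sg (Ninv p)).
  exfalso; move: ps; apply/negP; rewrite -leNgt subr_le0.
  by rewrite -[X in _ <= sg X]pz pE; apply: Nmap_ray_le; rewrite -?pE.
apply: le_trans (ltW pr); rewrite /HH {2}pE dil_uu lerD2r ler_pM2l//; exact: ltW.
Unshelve. all: by end_near. Qed.

Lemma continuous_Ninv z : newU z -> {for z, continuous Ninv}.
Proof.
move=> Uz; have [r r1 rz] := Ninv_proper Uz; have [q1 qz] := NinvP h_gt0 fing sep wsmall Uz.
pose r' := Num.max ((1 + HH (Ninv z)) / 2) r.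
have qr : HH (Ninv z) < r'.
  by rewrite /r' lt_max; apply/orP; left; move: q1; rewrite /E0 /=; lra.
have r'1 : r' < 1.
  by rewrite /r' gt_max r1 andbT; move: q1; rewrite /E0 /=; lra.
apply: (@continuous_inverse_compact _ _ [set q | HH q <= r'] Nmap).
- exact: rV_hausdorff.
- exact: rV_hausdorff.
- exact: compact_HH_le.
- exact: nbhs_HH_le.
- move=> q /= qr'; apply: (Ck_on_continuous (smooth_Nmap i0 h fing wsmall 0)).
  by rewrite /E0 /= (le_lt_trans qr').
- have nearU : \forall p \near z, newU p by exact: open_nbhs_nbhs.
  near=> p; split.
    rewrite /= /r' le_max; apply/orP; right; near: p; exact: rz.
  have Up : newU p by near: p.
  exact: (NinvP h_gt0 fing sep wsmall Up).2.
- move=> q /= qr' qE.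
  have q1' : E0 q by rewrite /E0 /= (le_lt_trans qr').
  exact: (Nmap_inj h_gt0 fing wsmall q1' q1 (etrans qE (esym qz))).
Unshelve. all: by end_near. Qed.

Lemma smooth_Ninv k : Ck_on k newU Ninv.
Proof.
suff : Ck_on k.+1 newU Ninv by exact: Ck_onW.
apply: (@Ck_on_inverse _ _ k E0 newU Nmap).
- exact: open_E0.
- exact: newU_open.
- by move=> z Uz; have [] := NinvP h_gt0 fing sep wsmall Uz.
- exact: continuous_Ninv.
- by move=> q q1 v; exact: (diff_Nmap_inj h_gt0 fing wsmall).
- exact: smooth_Nmap.
Qed.

End InverseStretch.

Lemma Ck_on_comp_rV (R : realType) (m m' : nat) (V : normedModType R) k (U : set V)
    (U' : set 'rV[R]_m) (F : V -> 'rV[R]_m) (G : 'rV[R]_m -> 'rV[R]_m') :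
  open U -> open U' -> (forall x, U x -> U' (F x)) ->
  Ck_on k U F -> Ck_on k U' G -> Ck_on k U (G \o F).
Proof.
move=> oU oU' FU Fk Gk; apply: Ck_on_rV => // i.
apply: (@Ck_on_comp _ _ _ k U U' F (fun y => G y 0 i)) => //.
exact: Ck_on_rV_coord.
Qed.

Section Assembly.
Context {R : realType} {n : nat}.
Local Notation E := 'rV[R]_(n + n).

(* [Nf] and [Of] pull [omega0] back to the same form, so [Of \o Nf^-1] is symplectic. *)
Lemma symplectomorphic_of_maps (Nf Of Ni Oi : E -> E) (U V W : set E) :
  open U -> open V -> open W ->
  (forall q, V q -> U (Nf q)) -> (forall z, U z -> V (Ni z) /\ Nf (Ni z) = z) ->
  (forall q, V q -> W (Of q)) -> (forall z, W z -> V (Oi z) /\ Of (Oi z) = z) ->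
  (forall q q', V q -> V q' -> Nf q = Nf q' -> q = q') ->
  (forall q q', V q -> V q' -> Of q = Of q' -> q = q') ->
  smooth_on V Nf -> smooth_on V Of -> smooth_on U Ni -> smooth_on W Oi ->
  (forall q u v, V q -> omega0 ('d Nf q u) ('d Nf q v) = omega0 ('d Of q u) ('d Of q v)) ->
  symplectomorphic U W.
Proof.
move=> oU oV oW NV NiP OV OiP Ninj Oinj sN sO sNi sOi om.
exists (Of \o Ni), (Nf \o Oi); split.
- move=> z Uz /=; have [Vz zE] := NiP z Uz; split; first exact: OV.
  have [V' E'] := OiP _ (OV _ Vz); rewrite -[RHS]zE; congr Nf.
  exact: Oinj.
- move=> z Wz /=; have [Vz zE] := OiP z Wz; split; first exact: NV.
  have [V' E'] := NiP _ (NV _ Vz); rewrite -[RHS]zE; congr Of.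
  exact: Ninj.
- by move=> k; apply: (@Ck_on_comp_rV _ _ _ _ k U V) => // z /NiP[].
- by move=> k; apply: (@Ck_on_comp_rV _ _ _ _ k W V) => // z /OiP[].
- move=> z Uz u v; have [Vz zE] := NiP z Uz.
  have [dNi _] := sNi 1%N; have [dN _] := sN 1%N; have [dO _] := sO 1%N.
  have dc (a : E) : 'd (Of \o Ni) z a = 'd Of (Ni z) ('d Ni z a).
    exact: (congr1 (fun L : E -> E => L a) (diff_comp (dNi z Uz) (dO _ Vz))).
  have inv (a : E) : 'd Nf (Ni z) ('d Ni z a) = a.
    apply: (etrans (esym (congr1 (fun L : E -> E => L a) (diff_comp (dNi z Uz) (dN _ Vz))))).
    apply: (@etrans _ _ ('d (id : E -> E) z a)).
      by apply: (@eq_diff_on _ _ _ U) => // y /NiP[].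
    by rewrite -deriveE ?derive_id.
  apply: (etrans (f_equal2 omega0 (dc u) (dc v))).
  apply: (etrans (esym (om (Ni z) _ _ Vz))).
  exact: (f_equal2 omega0 (inv u) (inv v)).
Qed.

End Assembly.

Section NewDomainSymplectic.
Context {R : realType} {n : nat} (i0 : 'I_n) (h : 'I_n -> R).
Hypothesis h_gt0 : forall i, 0 < h i.
Context {c w : nat -> R} {B dB : nat -> R -> R}.
Hypothesis fing : pulses c w B dB.
Hypothesis sep : forall k l, k != l -> 2 * (w k + w l) <= `|c k - c l|.
Hypothesis wsmall : forall e : R, 0 < e -> exists N, forall k, (N <= k)%N -> w k < e.

Lemma symplectomorphic_newU :
  symplectomorphic (@newU R n i0 h c w dB) (@E0 R n i0 h).
Proof.
have oU := open_newU (i0 := i0) h_gt0 fing sep wsmall.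
apply: (@symplectomorphic_of_maps R n (@Nmap R n i0 h w dB) (@Omap R n i0 h w B)
  (@Ninv R n i0 h w dB) (@Oinv R n i0 h w B) _ (@E0 R n i0 h)).
- exact: oU.
- exact: open_E0.
- exact: open_E0.
- exact (Nmap_newU h_gt0 fing sep wsmall).
- exact (NinvP h_gt0 fing sep wsmall).
- by move=> q; rewrite /E0 /= Omap_HH.
- exact (OinvP h_gt0 fing).
- exact (Nmap_inj h_gt0 fing wsmall).
- by move=> q q' q1 _; exact (Omap_inj h_gt0 fing q1).
- exact (smooth_Nmap i0 h fing wsmall).
- exact (smooth_Omap i0 h fing wsmall).
- exact (smooth_Ninv h_gt0 fing sep wsmall oU).
- exact (smooth_Oinv i0 h_gt0 fing wsmall).
- by move=> q u v q1; exact (omega_maps h_gt0 fing wsmall u v q1).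
Qed.

End NewDomainSymplectic.

Section Ellipsoid.
Context {R : realType} {n : nat} (i0 : 'I_n) (a : 'I_n -> R).
Hypothesis a_gt0 : forall i, 0 < a i.
Local Notation HH := (@HH R n i0 (fun i => pi / a i)).

Lemma ellipsoidE : ellipsoid a = [set q | HH q <= 1].
Proof.
apply/seteqP; split=> q; rewrite /ellipsoid /= (bigD1 i0)//= /HH /uu /sg mulrAC;
  under eq_bigr do rewrite mulrAC; by [].
Qed.

Lemma interior_ellipsoid : interior (ellipsoid a) = @E0 R n i0 (fun i => pi / a i).
Proof.
have h_gt0 i : 0 < (pi : R) / a i by rewrite divr_gt0 ?pi_gt0.
rewrite ellipsoidE; apply/seteqP; split=> [q iq|q q1]; last exact: nbhs_HH_le.
rewrite /E0 /=.
have cs : (fun l : R => l *: q) @ (1 : R) --> q.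
  by rewrite -[X in _ --> X]scale1r; apply: cvgZl; exact: cvg_id.
have /nbhs_ballP[d /= d0 dP] := cs _ iq.
have : HH ((1 + d / 2) *: q) <= 1.
  by apply: dP; rewrite /ball /= opprD addNKr normrN gtr0_norm//; lra.
rewrite scale_HH; have := HH_ge0 i0 h_gt0 q; rewrite le_eqVlt => /predU1P[<-//|H0].
move=> le1; apply: lt_le_trans le1; rewrite ltr_pMl//; apply: exprn_egt1 => //; lra.
Qed.

End Ellipsoid.

(** * Dimension of the frontier *)

Section LipschitzC1.
Context {R : realType}.

Lemma C1_lipschitz_real m (f : 'rV[R]_m -> R) r : Ck_on 1 setT f ->
  exists C, forall x y, `|x| <= r -> `|y| <= r -> `|f x - f y| <= C * `|x - y|.
Proof.
move=> [fd fk].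
have cB : compact [set x : 'rV[R]_m | `|x| <= r].
  apply: bounded_closed_compact.
    by exists r; split; [exact: num_real|move=> K /ltW rK x /= xr; exact: le_trans rK].
  have := @closed_comp _ _ (fun x : 'rV[R]_m => `|x|) [set t | t <= r].
  by apply => [x _|]; [exact: norm_continuous|exact: closed_le].
have [i|M MP] := @choice 'I_m R (fun i a => forall x, `|x| <= r -> `|'D_(delta_mx 0 i) f x| <= a).
  have : compact ('D_(delta_mx 0 i) f @` [set x : 'rV[R]_m | `|x| <= r]).
    apply: continuous_compact cB; apply: continuous_subspaceT => x.
    exact: (fk (delta_mx 0 i) x I).
  move=> /compact_bounded[M [Mr MP]]; exists (M + 1) => x xr.
  by apply: (MP (M + 1)); [rewrite ltrDl|exists x].
exists (\sum_i M i) => x y xr yr.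
have M0 : 0 <= \sum_i M i.
  by apply: sumr_ge0 => i _; apply: le_trans (MP i x xr); exact: normr_ge0.
pose g (t : R) : 'rV[R]_m := y + t *: (x - y).
have g0 : g 0 = y by rewrite /g scale0r addr0.
have g1 : g 1 = x by rewrite /g scale1r addrC subrK.
have gr t : 0 <= t <= 1 -> `|g t| <= r.
  move=> /andP[t0 t1]; have -> : g t = (1 - t) *: y + t *: x.
    by rewrite /g scalerBr scalerBl scale1r addrA addrAC.
  apply: (le_trans (ler_normD _ _)); rewrite !normrZ !ger0_norm ?subr_ge0//.
  have -> : r = (1 - t) * r + t * r by ring.
  by rewrite lerD// ler_wpM2l// subr_ge0.
have gi t i : dir_der (fun s => g s 0 i) t 1 ((x - y) 0 i).
  apply: (@dir_der_near R R (fun s : R => y 0 i + s * (x - y) 0 i)).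
    by near=> s; rewrite /g !mxE.
  apply: dir_der_eq.
    apply: dir_derD; first exact: dir_der_cst.
    by apply: dir_derM; [exact: dir_der_id|exact: dir_der_cst].
  by rewrite mulr0 add0r addr0 mul1r.
have gd t : differentiable g t by apply: differentiable_rV => i; have [] := gi t i.
have := @lipschitz_derive R (f \o g) (fun t => 'D_1 (f \o g) t) 0 1 ((\sum_i M i) * `|x - y|).
move=> /(_ _ _ 1 0); rewrite /= g0 g1 ler01 lexx subr0 normr1 mulr1; apply => //.
- move=> t _; apply: dir_der_is_derive; split => //.
  by apply: differentiable_comp; [exact: gd|exact: (fd _ I)].
- move=> t tI; rewrite derive_comp_rV; [|exact: gd|exact: (fd _ I)].
  rewrite (le_trans (ler_norm_sum _ _ _))// mulr_suml ler_sum// => i _.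
  have [_ ->] := gi t i; rewrite normrM ler_pM//; first exact/MP/gr.
  exact: normr_coord.
Unshelve. all: first [by end_near|by rewrite lexx]. Qed.

Lemma C1_lipschitz m m' (f : 'rV[R]_m -> 'rV[R]_m') r : Ck_on 1 setT f ->
  exists C, forall x y, `|x| <= r -> `|y| <= r -> `|f x - f y| <= C * `|x - y|.
Proof.
move=> fk.
have [i|M MP] := @choice 'I_m' R (fun i a => forall x y, `|x| <= r -> `|y| <= r ->
    `|f x 0 i - f y 0 i| <= a * `|x - y|).
  by apply: C1_lipschitz_real; apply: Ck_on_rV_coord => //; exact: openT.
exists (\sum_i `|M i|) => x y xr yr; apply: normr_rV_le => [|i].
  by rewrite mulr_ge0// sumr_ge0.
rewrite !mxE (le_trans (MP i x y xr yr))// ler_wpM2r//.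
by rewrite (le_trans (ler_norm _))// (bigD1 i)//= lerDl sumr_ge0.
Qed.

Lemma fin_null_cover m s (I : finType) (A : I -> set 'rV[R]_m) (Z : set 'rV[R]_m) :
  (forall i, fin_null s (A i)) -> (forall x, Z x -> exists i, A i x) -> fin_null s Z.
Proof.
move=> As ZA.
suff H (r : seq I) : fin_null s [set x | exists2 i, i \in r & A i x].
  apply: subset_fin_null (H (enum I)) => x /ZA[i Ai].
  by exists i => //; rewrite mem_enum.
elim: r => [|i r IH].
  move=> e e0; exists void, (fun=> set0), (fun=> 1); split=> [x [i]|[]|[]|]; first by rewrite in_nil.
  by rewrite big1 ?ltW// => -[].
apply: subset_fin_null (fin_nullU (As i) IH) => x [j].
by rewrite inE => /predU1P[->|jr] Aj; [left|right; exists j].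
Qed.

End LipschitzC1.

Section UpperDimension.
Context {R : realType} {n : nat} (i0 : 'I_n) (h : 'I_n -> R).
Hypothesis h_gt0 : forall i, 0 < h i.
Local Notation E := 'rV[R]_(n + n).
Implicit Types (q v z p : E) (k N K : nat).
Local Notation sg := (@sg R n i0).
Local Notation uu := (@uu R n i0 h).
Local Notation HH := (@HH R n i0 h).
Local Notation th := (@th R n i0).

Lemma HH_bounded : exists2 r, 0 < r & forall z, HH z <= 3 -> `|z| <= r.
Proof.
have : bounded_set [set q | HH q <= 3] by apply: compact_bounded; exact: compact_HH_le.
move=> [M [Mr MP]]; exists (`|M| + 1); first by rewrite ltr_wpDl.
by move=> z; apply: MP; rewrite ltr_pwDr// ler_norm.
Qed.

Let wt (j : 'I_(n + n)) : R := h (match fintype.split j with inl i => i | inr i => i end).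

Let wt_gt0 j : 0 < wt j. Proof. exact: h_gt0. Qed.

Let HH_sum q : HH q = \sum_j wt j * (q 0 j) ^+ 2.
Proof.
rewrite big_split_ord /= -big_split /= (bigD1 i0)//= /HH /uu /sg.
have wl i : wt (lshift n i) = h i by rewrite /wt -/(unsplit (inl i)) unsplitK.
have wr i : wt (rshift n i) = h i by rewrite /wt -/(unsplit (inr i)) unsplitK.
rewrite wl wr mulrDr; congr (_ + _); apply: eq_bigr => i _.
by rewrite wl wr mulrDr.
Qed.

(** Finitely many caps, on each of which one coordinate has a fixed sign and is bounded away from
    [0], cover the sphere; each cap is a Lipschitz graph over the other coordinates. *)
Lemma fin_null_sphere s : 0 < s -> fin_null (s + (n + n).-1%:R) [set q | HH q = 1].
Proof.
move=> s0; have [r r0 rP] := HH_bounded.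
have m0 : 0 < (n + n)%:R :> R by rewrite ltr0n addn_gt0 (leq_trans _ (ltn_ord i0)).
(* By the pigeonhole principle some coordinate satisfies [wt j * q_j ^ 2 >= 1 / (n + n)]. *)
pose d j := Num.sqrt ((n + n)%:R * wt j)^-1.
have d0 j : 0 < d j by rewrite sqrtr_gt0 invr_gt0 mulr_gt0.
pose A (x : 'I_(n + n) * bool) : set E := [set q | HH q = 1 /\ d x.1 <= (-1) ^+ x.2 * q 0 x.1].
apply: (@fin_null_cover _ _ _ _ A) => [[j b]|q H1]; last first.
  have [j jP] : exists j, ((n + n)%:R)^-1 <= wt j * (q 0 j) ^+ 2.
    apply: contrapT => no; have : HH q < 1; last by rewrite H1 ltxx.
    rewrite HH_sum; apply: (@lt_le_trans _ _ (\sum_(j < n + n) (n + n)%:R^-1)).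
      apply: ltr_sum => [|j _]; last by rewrite ltNge; apply/negP => le; apply: no; exists j.
      by apply/hasP; exists (lshift n i0) => //; rewrite mem_index_enum.
    by rewrite sumr_const card_ord -(mulr_natr (_^-1)) mulVf// gt_eqF.
  have dj : d j <= `|q 0 j|.
    rewrite -sqrtr_sqr ler_wsqrtr// invfM -ler_pdivlMr ?invr_gt0// invrK mulrC//.
  have [q0|q0] := leP 0 (q 0 j).
    by exists (j, false); split; rewrite //= expr0 mul1r -(ger0_norm q0).
  by exists (j, true); split; rewrite //= expr1 mulN1r -(ltr0_norm q0).
(* Subtracting the two equations [HH = 1] bounds [wt j * |x_j - y_j| * |x_j + y_j|] by the sum of
   the [wt i] times [2 * r * cc], and [|x_j + y_j| >= 2 * d j] on the cap. *)
pose L := r * (\sum_i wt i) / (wt j * d j).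
apply: (@fin_null_graph _ _ j _ r L) => // [q [H1 _] i|x y cc [Hx xd] [Hy yd] xyc c0].
  by rewrite (le_trans (normr_coord q i))// rP// H1; lra.
have xr : `|x| <= r by apply: rP; rewrite Hx; lra.
have yr : `|y| <= r by apply: rP; rewrite Hy; lra.
have eq : wt j * (x 0 j ^+ 2 - y 0 j ^+ 2) = \sum_(i | i != j) wt i * (y 0 i ^+ 2 - x 0 i ^+ 2).
  rewrite (eq_bigr (fun i => wt i * y 0 i ^+ 2 - wt i * x 0 i ^+ 2)) ?sumrB; last first.
    by move=> i _; rewrite mulrBr.
  have := Hx; rewrite HH_sum (bigD1 j)//= => X1.
  have := Hy; rewrite HH_sum (bigD1 j)//= => Y1.
  lra.
have bnd : `|\sum_(i | i != j) wt i * (y 0 i ^+ 2 - x 0 i ^+ 2)| <= (\sum_i wt i) * (cc * (2 * r)).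
  apply: (le_trans (ler_norm_sum _ _ _)); rewrite mulr_suml [leRHS](bigD1 j)//=.
  apply: ler_wpDl; first by rewrite !mulr_ge0// ltW.
  apply: ler_sum => i ij; rewrite normrM gtr0_norm// ler_pM2l// subr_sqr normrM.
  apply: ler_pM => //; first by rewrite distrC xyc.
  have := ler_normD (y 0 i) (x 0 i); have := normr_coord x i; have := normr_coord y i; lra.
have low : 2 * d j <= `|x 0 j + y 0 j|.
  have : 2 * d j <= (-1) ^+ b * (x 0 j + y 0 j) by rewrite mulrDr; move: xd yd => /=; lra.
  by move=> /le_trans; apply; rewrite -[leRHS](normrMsign b) ler_norm.
rewrite -eq normrM gtr0_norm// subr_sqr normrM in bnd.
rewrite /L mulrAC ler_pdivlMr ?mulr_gt0//.
have := normr_ge0 (x 0 j - y 0 j); move: (`|x 0 j - y 0 j|) bnd => a bnd a0.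
have : wt j * (a * (2 * d j)) <= wt j * (a * `|x 0 j + y 0 j|).
  by rewrite ler_pM2l// ler_wpM2l.
move: bnd; move: (\sum_i wt i) => W; lra.
Qed.

Section Frontier.
Context {c w : nat -> R} {B dB : nat -> R -> R}.
Hypothesis fing : pulses c w B dB.
Hypothesis sep : forall k l, k != l -> 2 * (w k + w l) <= `|c k - c l|.
Hypothesis wsmall : forall e : R, 0 < e -> exists N, forall k, (N <= k)%N -> w k < e.
Local Notation NM := (@NM R n i0 h w dB).
Local Notation newU := (@newU R n i0 h c w dB).
Local Notation profile := (@profile R n i0 c w dB).
Local Notation bump := (@bump R n i0 h c w dB).
Local Notation hit := (@hit R n i0 c w).
Local Notation Psi := (@Psi R n i0).
Local Notation slot := (@slot R n i0).

(** Over the angles of the first [K] pulses, and over those of no pulse, the frontier is the image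
    of the sphere under the truncated stretch, which is smooth beyond the ellipsoid as well. *)
Lemma graph_NM K z : (forall k, hit k z -> (k < K)%N) -> HH z = 1 + bump z ->
  exists2 q, HH q = 1 & NM K q = z.
Proof.
move=> hK; have h0 := h_gt0 i0; have [[k hk]|nh] := pselect (exists k, hit k z); last first.
  have {}nh k : ~ hit k z by move=> hk; apply: nh; exists k.
  rewrite /bump profile_out// mulr0 addr0 => H1; exists z => //.
  by rewrite NM_dil (mu_out h fing)// addr0 sqrtr1 dil1.
rewrite /bump (profile_hit fing sep hk) => Hz.
have s0 : 0 < sg z := sg_gt0 hk.1; set b := dB k (th z) in Hz; set u := uu z in Hz.
have u1 : u < 1.
  have [u2|u2] := ltP u 2^-1; first by lra.
  move: Hz; rewrite Lam_eq0// mul0r addr0 /HH -/u => <-.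
  by rewrite ltrDr mulr_gt0.
pose s := (1 - u) / h i0; have s1 : 0 < s by rewrite divr_gt0// subr_gt0.
pose l := Num.sqrt (s / sg z); have l0 : 0 < l by rewrite sqrtr_gt0 divr_gt0.
pose q := dil i0 l z.
have qs : sg q = s by rewrite dil_sg sqr_sqrtr ?divfK ?gt_eqF// divr_ge0 ?ltW.
have qu : uu q = u by rewrite dil_uu.
have qH : HH q = 1 by rewrite /HH qs qu /s mulrC divfK ?gt_eqF//; ring.
exists q => //; have hq : hit k q by apply/dil_hit.
have muE : s * (1 + mu i0 h (w := w) (dB := dB) K q) = sg z.
  apply: (mulfI (lt0r_neq0 h0)); have := @radial1_top R n i0 h h_gt0 w k b u (ltW u1).
  rewrite /radial1 (mu_hit fing sep hq); last by left; exact: hK.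
  rewrite /HH qs qu /q dil_th// -/b -/s => ->.
  by move: Hz; rewrite /HH -/u; lra.
rewrite NM_dil dil_dil -[RHS](dil1 i0); congr dil.
have m0 : 0 <= 1 + mu i0 h (w := w) (dB := dB) K q by rewrite ltW// (mu1_gt0 i0 h fing).
rewrite /l -sqrtrM// -[RHS]sqrtr1; congr Num.sqrt.
by rewrite mulrA (mulrC _ s) muE mulfV// gt_eqF.
Qed.

(** Over the angles of the tail no structure is used besides boundedness. The radius [2 * r + 1]
    bounds the polar coordinates: the square root of [sg] is at most [2 * r], and the angle at most
    [1]. *)
Lemma frontier_cover r K : (forall z, HH z <= 3 -> `|z| <= r) ->
  closure newU `\` newU `<=`
    Psi @` (slab (rshift n i0) (tail c w K) (2 * r + 1)) `|` NM K @` [set q | HH q = 1].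
Proof.
move=> rP z [cz nz]; have zr := rP z (closure_newU_HH_le h_gt0 fing sep cz).
have r0 : 0 <= r := le_trans (normr_ge0 z) zr.
have polar : 0 < xcoord z i0 -> tail c w K (th z) ->
    (Psi @` (slab (rshift n i0) (tail c w K) (2 * r + 1))) z.
  move=> x0 tz; exists (slot (Num.sqrt (sg z)) (th z) z); last exact: Psi_slotK.
  have yE : slot (Num.sqrt (sg z)) (th z) z 0 (rshift n i0) = th z.
    by rewrite -/(ycoord _ i0) ycoord_mkE eqxx.
  split; first by rewrite yE.
  have t01 : 0 <= th z <= 2^-1.
    case: tz => [|[k _ kz]]; first exact: (accum_itv fing).
    have [w0 ck _] := fing k; move: kz; rewrite ltr_norml; lra.
  have zi i : `|z 0 i| <= 2 * r + 1.
    by rewrite (le_trans (normr_coord z i))//; lra.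
  move=> j; case: (fintype.split_ordP j) => i ->.
    rewrite -/(xcoord _ i) xcoord_mkE; case: eqP => _; last exact: zi.
    rewrite ger0_norm ?sqrtr_ge0//.
    have -> : 2 * r + 1 = Num.sqrt ((2 * r + 1) ^+ 2).
      by rewrite sqrtr_sqr ger0_norm// addr_ge0// mulr_ge0.
    rewrite ler_wsqrtr//.
    have xb : `|xcoord z i0| <= r := le_trans (normr_coord z _) zr.
    have yb : `|ycoord z i0| <= r := le_trans (normr_coord z _) zr.
    have x2 : xcoord z i0 ^+ 2 <= r ^+ 2.
      by rewrite -real_normK ?num_real// lerXn2r ?nnegrE.
    have y2 : ycoord z i0 ^+ 2 <= r ^+ 2.
      by rewrite -real_normK ?num_real// lerXn2r ?nnegrE.
    by rewrite /sg; have := sqr_ge0 r; nra.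
  rewrite -/(ycoord _ i) ycoord_mkE; case: eqP => _; last exact: zi.
  by rewrite ler_norml; lra.
have [[x0 tz]|nt] := pselect (0 < xcoord z i0 /\ tail c w K (th z)); first by left; apply: polar.
right; have Hz : HH z = 1 + bump z.
  have [[x0 az]|//] := frontier_cases h_gt0 fing sep wsmall cz nz.
  by exfalso; apply: nt; split => //; left.
have [|q H1 qz] := @graph_NM K z _ Hz; last by exists q.
move=> k hk; rewrite ltnNge; apply/negP => Kk; apply: nt; split; first by case: hk.
by right; exists k => //; case: hk.
Qed.

(** The index [K] depends on the accuracy [e], since a fixed tail contains intervals. The slab is
    therefore covered at one accuracy, while the image of the sphere is null for every [K]. *)
Lemma fin_null_frontier a s :
  (forall t e, a < t -> 0 < e -> exists K, box_cover t e (tail c w K)) ->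
  0 <= a < s -> fin_null (s + (n + n).-1%:R) (closure newU `\` newU).
Proof.
move=> tc /andP[a0 as_] e e0; have [r r0 rP] := HH_bounded.
have e20 : 0 < e / 2 by rewrite divr_gt0.
have [C CP] := C1_lipschitz (2 * r + 1) (smooth_Psi i0 1).
have C0 : 0 < `|C| + 1 by rewrite ltr_wpDl.
have r1 : 0 < 2 * r + 1 by rewrite addr_gt0// mulr_gt0.
pose e1 := e / 2 / (`|C| + 1) `^ (s + (n + n).-1%:R).
have e10 : 0 < e1 by rewrite divr_gt0// powR_gt0.
have [|K Kc] := tc s (e1 / (2 * (2 * r + 1) + 1) ^+ (n + n).-1) as_.
  by rewrite divr_gt0// exprn_gt0// addr_gt0// mulr_gt0.
apply: subset_fin_cover (frontier_cover K rP) _; rewrite (splitr e); apply: fin_coverU.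
  apply: (fin_cover_image C0); last exact: fin_cover_slab.
  have slr p : slab (rshift n i0) (tail c w K) (2 * r + 1) p -> `|p| <= 2 * r + 1.
    by move=> [_ pr]; apply: normr_rV_le => //; exact: ltW.
  move=> x y /slr xr /slr yr; rewrite (le_trans (CP x y xr yr))// ler_wpM2r//.
  by rewrite (le_trans (ler_norm _))// lerDl.
have [C' CP'] := C1_lipschitz r (smooth_NM i0 h fing K 1).
have S : fin_null (s + (n + n).-1%:R) (NM K @` [set q | HH q = 1]).
  apply: (@fin_null_image _ _ _ _ _ _ C'); last by apply: fin_null_sphere; exact: le_lt_trans as_.
  by move=> x y Hx Hy; apply: CP'; apply: rP; rewrite ?Hx ?Hy; lra.
exact: S.
Qed.

End Frontier.

End UpperDimension.

(** * Lower bound: a cube mapped into the frontier *)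

Lemma atan_lipschitz (R : realType) (x y : R) : `|atan x - atan y| <= `|x - y|.
Proof.
rewrite -[leRHS]mul1r.
apply: (@lipschitz_derive R atan (fun t => (1 + t ^+ 2)^-1) (Num.min x y) (Num.max x y));
  rewrite ?ge_min ?le_max ?lexx ?orbT//.
move=> t _; rewrite ger0_norm ?invr_ge0 ?addr_ge0 ?sqr_ge0//.
by rewrite invf_le1 ?lerDl ?sqr_ge0// ltr_pwDl// sqr_ge0.
Qed.

Section LowerDimension.
Context {R : realType} {n : nat} (i0 : 'I_n) (h : 'I_n -> R).
Hypothesis h_gt0 : forall i, 0 < h i.
Context {c w : nat -> R} {B dB : nat -> R -> R}.
Hypothesis fing : pulses c w B dB.
Hypothesis sep : forall k l, k != l -> 2 * (w k + w l) <= `|c k - c l|.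
Hypothesis wsmall : forall e : R, 0 < e -> exists N, forall k, (N <= k)%N -> w k < e.
Local Notation E := 'rV[R]_(n + n).
Implicit Types (q v z p : E) (k N K : nat) (x y : nat -> R).
Local Notation sg := (@sg R n i0).
Local Notation uu := (@uu R n i0 h).
Local Notation HH := (@HH R n i0 h).
Local Notation th := (@th R n i0).
Local Notation newU := (@newU R n i0 h c w dB).
Local Notation Psi := (@Psi R n i0).
Local Notation slot := (@slot R n i0).

Lemma th_lipschitz r d : 0 < d -> exists2 L, 0 <= L & forall z z',
  `|z| <= r -> `|z'| <= r -> d <= xcoord z i0 -> d <= xcoord z' i0 ->
  `|th z - th z'| <= L * `|z - z'|.
Proof.
move=> d0; exists (2 * `|r| / (d * d)); first by rewrite divr_ge0 ?mulr_ge0// ltW.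
move=> z z' zr zr' dx dx'.
have co p j : `|p| <= r -> `|p 0 j| <= `|r|.
  by move=> pr; rewrite (le_trans (normr_coord p j))// (le_trans pr)// ler_norm.
have df j : `|z 0 j - z' 0 j| <= `|z - z'|.
  by have := normr_coord (z - z') j; rewrite !mxE.
apply: le_trans (atan_lipschitz _ _) _; rewrite /xcoord /ycoord in dx dx' *.
have := df (lshift n i0); have := df (rshift n i0).
have := co z (lshift n i0) zr; have := co z (rshift n i0) zr.
move: (z 0 (lshift n i0)) (z 0 (rshift n i0)) dx => X Y dX.
move: (z' 0 (lshift n i0)) (z' 0 (rshift n i0)) dx' => X' Y' dX' Yr Xr Yd Xd.
have X0 : 0 < X := lt_le_trans d0 dX; have X'0 : 0 < X' := lt_le_trans d0 dX'.
have -> : Y / X - Y' / X' = (Y * (X' - X) + X * (Y - Y')) / (X * X').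
  by field; rewrite !gt_eqF.
have D0 := normr_ge0 (z - z').
rewrite normrM normfV (gtr0_norm (mulr_gt0 X0 X'0)) ler_pdivrMr ?mulr_gt0//.
apply: (@le_trans _ _ (2 * `|r| * `|z - z'|)).
  apply: (le_trans (ler_normD _ _)); rewrite !normrM (distrC X').
  have : `|Y| * `|X - X'| <= `|r| * `|z - z'| by exact: ler_pM.
  have : `|X| * `|Y - Y'| <= `|r| * `|z - z'| by exact: ler_pM.
  lra.
have dd : 0 < d * d by rewrite mulr_gt0.
have XX : d * d <= X * X' by apply: ler_pM => //; exact: ltW.
rewrite -[leLHS]mulr1 -(mulrAC _ _ (d * d)^-1) -!mulrA ler_wpM2l// ler_wpM2l//.
by rewrite ler_wpM2l// ler_pdivlMl// mulr1.
Qed.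

Section Parametrization.
Variables (alpha : R) (branch : R -> R).
Hypothesis branch_accum : forall t, 0 <= t < 1 -> accum c (branch t).
Hypothesis branch_expand : forall s, 0 < s < alpha -> exists2 C, 0 <= C &
  forall t t', 0 <= t < 1 -> 0 <= t' < 1 -> `|t - t'| <= C * `|branch t - branch t'| `^ s.

(** Small enough for [uu (base x) <= 1 / 4] on the whole cube. *)
Let delta : R := (1 + 8 * \sum_i h i)^-1.
(** A height of the frontier above [HH = 1] that is available for all [uu <= 1 / 4], since [Lam] is
    decreasing. *)
Let kappa : R := Lam 4^-1 * flat 0 1.
Let base x : E := mkE (fun i => delta * x i) (fun i => delta * x (n + i)%N).
(** The squared radius for which [HH] equals [1 + kappa * x i0]. *)
Let sigma x : R := (1 + kappa * x i0 - uu (base x)) / h i0.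
(** The parameter [i0] controls [HH], the parameter [n + i0] the angle through the Cantor set, and
    the others the remaining planes. *)
Let point x : E := Psi (slot (Num.sqrt (sigma x)) (branch (x (n + i0)%N)) (base x)).
Let cube x := forall j, (j < n + n)%N -> 0 <= x j < 1.

Let sum_h : 0 <= \sum_i h i. Proof. by apply: sumr_ge0 => i _; exact: ltW. Qed.

Let delta_gt0 : 0 < delta.
Proof. by rewrite invr_gt0 ltr_wpDr// mulr_ge0. Qed.

Let cube_lo x (i : 'I_n) : cube x -> 0 <= x i < 1.
Proof. by apply; rewrite ltn_addr. Qed.

Let cube_hi x (i : 'I_n) : cube x -> 0 <= x (n + i)%N < 1.
Proof. by apply; rewrite ltn_add2l. Qed.

Let kappa_gt0 : 0 < kappa.
Proof.
by rewrite /kappa /Lam !mulr_gt0 ?flat0_gt0//; lra.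
Qed.

Let uu_base x : cube x -> uu (base x) <= 4^-1.
Proof.
move=> cx; have sq (t : R) : 0 <= t < 1 -> (delta * t) ^+ 2 <= delta.
  move=> /andP[t0 t1]; have d1 : delta <= 1 by rewrite invf_le1 ?lerDl ?mulr_ge0// ltr_wpDr// mulr_ge0.
  have dt0 : 0 <= delta * t by apply: mulr_ge0 => //; exact: ltW.
  have dt : delta * t <= delta by rewrite ger_pMr// ltW.
  by rewrite expr2 -[leRHS]mulr1; apply: ler_pM => //; exact: le_trans d1.
apply: (@le_trans _ _ (\sum_i h i * (2 * delta))).
  rewrite /uu [leRHS](bigD1 i0)//=; apply: ler_wpDl.
    by rewrite !mulr_ge0 ?ltW.
  apply: ler_sum => i _; rewrite ler_pM2l// xcoord_mkE ycoord_mkE.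
  have := sq _ (cube_lo i cx); have := sq _ (cube_hi i cx); lra.
rewrite -mulr_suml /delta mulrA ler_pdivrMr ?ltr_wpDr ?mulr_ge0//.
move: sum_h; lra.
Qed.

Let h_sigma x : h i0 * sigma x = 1 + kappa * x i0 - uu (base x).
Proof. by rewrite /sigma [LHS]mulrC divfK ?gt_eqF. Qed.

Let sigma_ge x : cube x -> 3 / 4 <= h i0 * sigma x.
Proof.
move=> cx; rewrite h_sigma; have := uu_base cx.
have /andP[x0 _] := cube_lo i0 cx.
have : 0 <= kappa * x i0 by rewrite mulr_ge0// ltW.
by lra.
Qed.

Let sigma_gt0 x : cube x -> 0 < sigma x.
Proof. by move=> /sigma_ge hs; rewrite -(pmulr_rgt0 _ (h_gt0 i0)); lra. Qed.

Let point_th x : cube x -> 0 < xcoord (point x) i0 /\ th (point x) = branch (x (n + i0)%N).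
Proof.
move=> cx; apply: Psi_slot_th; first by rewrite sqrtr_gt0 sigma_gt0.
by apply: half_pihalf; apply: (accum_itv fing); apply: branch_accum; exact: cube_hi.
Qed.

Let point_sg x : cube x -> sg (point x) = sigma x.
Proof. by move=> cx; rewrite Psi_slot_sg sqr_sqrtr// ltW// sigma_gt0. Qed.

Let point_HH x : cube x -> HH (point x) = 1 + kappa * x i0.
Proof.
by move=> cx; rewrite /HH point_sg// Psi_slot_uu h_sigma subrK.
Qed.

Let point_frontier x : cube x -> (closure newU `\` newU) (point x).
Proof.
move=> cx; have [x0 tE] := point_th cx.
apply: (frontier_has fing sep) => //.
  by rewrite tE; apply: branch_accum; exact: cube_hi.
have /andP[X0 X1] := cube_lo i0 cx.
rewrite point_HH// lerDl mulr_ge0 ?(ltW kappa_gt0)//= ltrD2l Psi_slot_uu.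
apply: (@lt_le_trans _ _ kappa); first by rewrite gtr_pMr.
rewrite /kappa ler_pM2r ?flat0_gt0//; apply: Lam_le.
by rewrite uu_ge0//= uu_base.
Qed.

(** The angle is below [pi / 4], so the square of [xcoord] is at least half of [sg]. This keeps the
    points where [th] is Lipschitz. *)
Let point_x0 x : cube x -> Num.sqrt (3 / (8 * h i0)) <= xcoord (point x) i0.
Proof.
move=> cx; have [x0 tE] := point_th cx.
rewrite -[leRHS]ger0_norm ?(ltW x0)// -sqrtr_sqr ler_wsqrtr//.
have yx : `|ycoord (point x) i0| <= xcoord (point x) i0.
  rewrite leNgt; apply/negP => /(th_off x0); rewrite tE.
  have := accum_itv fing (branch_accum (cube_hi i0 cx)); lra.
have y2 : ycoord (point x) i0 ^+ 2 <= xcoord (point x) i0 ^+ 2.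
  by rewrite -real_normK ?num_real// lerXn2r ?nnegrE// ltW.
have := sigma_ge cx; rewrite -(point_sg cx) /sg => hs.
rewrite ler_pdivrMr ?mulr_gt0//.
have := h_gt0 i0; move: hs y2.
move: (xcoord _ _ ^+ 2) (ycoord _ _ ^+ 2) (h i0) => X Y H hs y2 H0.
by have : H * Y <= H * X; [rewrite ler_pM2l|lra].
Qed.

(** Every parameter is recovered from the point: [x i0] from [HH], which is Lipschitz on bounded
    sets; the parameter [n + i0] from [th] and the inverse bound on [branch], with exponent [s]; the
    others from coordinates scaled by [delta]. *)
Let point_expand s : 0 < s < alpha -> exists2 C, 0 <= C & forall x y, cube x -> cube y ->
  forall j, (j < n + n)%N ->
  `|x j - y j| <= C * `|point x - point y| `^ (if j == (n + i0)%N then s else 1).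
Proof.
move=> sa; have [s0 _] := andP sa; have [Cb Cb0 CbP] := branch_expand sa.
have [r r0 rP] := HH_bounded i0 h_gt0.
have d0 : 0 < Num.sqrt (3 / (8 * h i0)) by rewrite sqrtr_gt0 divr_gt0// mulr_gt0.
have [L L0 LP] := th_lipschitz r d0.
have [CH CHP] := C1_lipschitz_real r (smooth_HH i0 h 1 openT).
have pr x : cube x -> `|point x| <= r.
  by move=> cx; apply: rP; exact: (closure_newU_HH_le h_gt0 fing sep (point_frontier cx).1).
have C1 : 0 <= Cb * L `^ s by rewrite mulr_ge0// powR_ge0.
have C2 : 0 <= `|CH| / kappa by rewrite divr_ge0// ltW.
have C3 : 0 <= delta^-1 by rewrite invr_ge0 ltW.
exists (Cb * L `^ s + `|CH| / kappa + delta^-1); first by rewrite !addr_ge0.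
move=> x y cx cy; set D := `|point x - point y|; have D0 : 0 <= D by exact: normr_ge0.
have df j : `|point x 0 j - point y 0 j| <= D.
  by have := normr_coord (point x - point y) j; rewrite !mxE.
have lin (C t : R) : 0 <= C -> C <= Cb * L `^ s + `|CH| / kappa + delta^-1 -> t <= C * D ->
    t <= (Cb * L `^ s + `|CH| / kappa + delta^-1) * D `^ 1.
  by move=> _ CC /le_trans; apply; rewrite powRr1// ler_wpM2r.
have dlin (a b : R) : `|delta * a - delta * b| <= D -> `|a - b| <= delta^-1 * D.
  by rewrite -mulrBr normrM gtr0_norm// ler_pdivlMl.
have main (j : 'I_(n + n)) : `|x j - y j| <= (Cb * L `^ s + `|CH| / kappa + delta^-1) *
    D `^ (if (j : nat) == (n + i0)%N then s else 1).
  have [i ->|i ->] := fintype.split_ordP j; rewrite /=.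
    rewrite ifN; last by rewrite neq_ltn ltn_addr.
    have [->|ii0] := eqVneq i i0.
      apply: (lin (`|CH| / kappa)) => //; first by lra.
      have := CHP _ _ (pr x cx) (pr y cy); rewrite !point_HH// -/D.
      rewrite opprD addrACA subrr add0r -mulrBr normrM gtr0_norm// => H.
      by rewrite mulrAC ler_pdivlMr// mulrC (le_trans H)// ler_wpM2r// ler_norm.
    apply: (lin delta^-1) => //; first by lra.
    apply: dlin; have := df (lshift n i).
    by rewrite -!/(xcoord _ i) /point !xcoord_mkE (negbTE ii0).
  rewrite eqn_add2l; have [->|ii0] := eqVneq i i0; rewrite ?eqxx; last first.
    rewrite ifN; last by [].
    apply: (lin delta^-1) => //; first by lra.
    apply: dlin; have := df (rshift n i).
    by rewrite -!/(ycoord _ i) /point !ycoord_mkE (negbTE ii0).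
  have := CbP _ _ (cube_hi i0 cx) (cube_hi i0 cy).
  rewrite -(point_th cx).2 -(point_th cy).2 => /le_trans; apply.
  apply: (@le_trans _ _ (Cb * L `^ s * D `^ s)); last first.
    by rewrite ler_wpM2r ?powR_ge0//; lra.
  rewrite -mulrA -powRM//; apply: ler_wpM2l => //.
  apply: ge0_ler_powR; rewrite ?nnegrE ?mulr_ge0 ?(ltW s0)//.
  apply: LP; rewrite ?pr ?point_x0//.
by move=> j jn; exact: (main (Ordinal jn)).
Qed.

Lemma hausdorff_measure_frontier_neq0 s : 0 < alpha -> 0 <= s < (n + n).-1%:R + alpha ->
  hausdorff_measure s (closure newU `\` newU) != 0%E.
Proof.
move=> alpha0 /andP[s0 sa].
(* The second entry is the midpoint of [s - (n + n).-1] and [alpha]; the first keeps [s'] positive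
   when [s] is small. *)
pose s' := Num.max (alpha / 2) ((s - (n + n).-1%:R + alpha) / 2).
have s'a : 0 < s' < alpha.
  by rewrite lt_max gt_max; apply/andP; split; [apply/orP; left; lra|apply/andP; split; lra].
have ss' : s - (n + n).-1%:R <= s' by rewrite le_max; apply/orP; right; lra.
have [C C0 CP] := point_expand s'a.
pose a (j : nat) : R := if j == (n + i0)%N then s' else 1.
have a0 j : 0 <= a j by rewrite /a; case: ifP => // _; case/andP: s'a => /ltW.
have aE : \sum_(j < n + n) a j = (n + n).-1%:R + s'.
  rewrite (bigD1 (rshift n i0))//= {1}/a eqxx addrC; congr (_ + _).
  rewrite (eq_bigr (fun=> 1)) => [|j jn].
    by rewrite sumr_const cardC1 card_ord.
  by rewrite /a ifN.
apply: (@hausdorff_measure_neq0 _ _ _ point C a) => //.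
- by rewrite aE ltr_wpDl//; case/andP: s'a.
- by rewrite s0 aE; lra.
- by move=> x y cx cy _; exact: CP.
Qed.

End Parametrization.

End LowerDimension.

Lemma pulses_exist (R : realType) (alpha : R) : 0 < alpha <= 1 ->
  exists B dB : nat -> R -> R, pulses (center alpha) (width alpha) B dB.
Proof.
move=> ha; have w0 := width_gt0 ha.
have p0 k : 0 < 52 * 2 ^+ k :> R by rewrite mulr_gt0// exprn_gt0.
have [k|f fP] := @boolp.choice nat ((R -> R) * (R -> R)) (fun k f =>
    finger (center alpha k) (width alpha k) (width alpha k / (52 * 2 ^+ k)) f.1 f.2).
  have [b [db bP]] := finger_exists (center alpha k) (w0 k) (divr_gt0 (w0 k) (p0 k)).
  by exists (b, db).
exists (fun k => (f k).1), (fun k => (f k).2) => k.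
have ck := center_itv ha k; split=> //.
by rewrite w0; lra.
Qed.

Theorem corollary1p1 (R : realType) (n : nat) (hn : (0 < n)%N)
    (a : 'I_n -> R) (ha : forall i, 0 < a i)
    (alpha : R) (halpha : 0 < alpha <= 1) :
  exists W : set 'rV[R]_(n + n),
    [/\ compact W,
        star_shaped_domain W,
        hausdorff_dim (boundary W) = ((2 * n)%:R - 1 + alpha)%:E &
        symplectomorphic (interior W) (interior (ellipsoid a))].
Proof.
pose i0 : 'I_n := Ordinal hn; pose h (i : 'I_n) : R := pi / a i.
have h_gt0 i : 0 < h i by rewrite divr_gt0 ?pi_gt0.
have [B [dB fing]] := pulses_exist halpha.
have sep := center_sep halpha; have wsmall := @width_small _ _ halpha.
pose U := @newU R n i0 h (center alpha) (width alpha) dB.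
have oU : open U by exact: (open_newU h_gt0 fing sep wsmall).
have iU : interior (closure U) = U by exact: (interior_closure_newU i0 h_gt0 fing sep wsmall).
have bE : boundary (closure U) = closure U `\` U.
  by rewrite /boundary iU -(iffLR (closure_id _) (@closed_closure _ U)).
have dimE : (2 * n)%:R - 1 = (n + n).-1%:R :> R.
  by rewrite mul2n -addnn -[in LHS](prednK (_ : 0 < n + n)%N) ?addn_gt0 ?hn// -natr1 addrK.
have [alpha0 alpha1] := andP halpha.
exists (closure U); split.
- exact: (compact_closure_newU h_gt0 fing sep).
- exists U; split => //.
    exact: (bounded_newU i0 h_gt0 fing sep).
  exact: (newU_star i0 h_gt0 fing sep).
- rewrite bE dimE; apply/eqP; rewrite eq_le; apply/andP; split.
    apply: hausdorff_dim_le => [|s Ds]; first by rewrite addr_ge0// ltW.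
    have -> : s = (s - (n + n).-1%:R) + (n + n).-1%:R by rewrite subrK.
    apply: (@fin_null_frontier R n i0 h h_gt0 _ _ _ _ fing sep wsmall alpha).
      by move=> t e; exact: tail_box_cover.
    by rewrite (ltW alpha0) ltrBrDl.
  apply: le_ereal_inf_tmp => _ [s [s0 sm] <-]; rewrite lee_fin leNgt; apply/negP => lt.
  have := @hausdorff_measure_frontier_neq0 R n i0 h h_gt0 _ _ _ _ fing sep alpha (branch alpha)
    (fun t => @branch_accum R alpha halpha t) (fun s => @branch_expand R alpha halpha s) s alpha0.
  by rewrite s0 lt => /(_ isT); rewrite sm eqxx.
- rewrite iU (interior_ellipsoid i0 ha); exact: (symplectomorphic_newU i0 h_gt0 fing sep wsmall).
Qed.
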